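(* Let $R$ be a commutative noetherian reduced ring and let $M$ be a finitely generated torsion-free $R$-module with $\operatorname{supp} M = \operatorname{supp} R$. Suppose that $A = \operatorname{End}_R(M)$ is homologically homogeneous. Then the centre $Z(A)$ is the normalization of $R$. In particular, the centre of a noncommutative crepant resolution (NCCR) of an equicodimensional ring $R$ is its normalization $\widetilde R$.
   Context: $R$ is a commutative noetherian reduced ring throughout, also in the last assertion, and $\operatorname{supp} R=\operatorname{Spec} R$. The normalization $\widetilde R$ of $R$ is its integral closure in its total quotient ring. A module is torsion-free if non-zero-divisors of $R$ act injectively on it. A ring $R$ is equicodimensional if all its maximal ideals have the same height. An $R$-algebra $A$ is homologically homogeneous if $A$ is finitely generated as an $R$-module, is noetherian, and all simple $A$-modules with the same annihilator in $R$ have the same projective dimension. $A$ is a non-singular $R$-order if $A$ is a maximal Cohen--Macaulay $R$-module and $\operatorname{gldim} A_{\mathfrak p} = \dim R_{\mathfrak p}$ for all $\mathfrak p \in \operatorname{Spec} R$. A finitely generated torsion-free $R$-module $M$ with $\operatorname{supp} M = \operatorname{supp} R$ gives a NCCR of $R$ if $A=\operatorname{End}_R(M)$ is a non-singular $R$-order; then $A$ is called a NCCR of $R$.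
   Formalization: In ''homologically homogeneous'' the common projective dimension of simple modules with the same annihilator is required to be finite; otherwise the claim fails for R = M = k[[x,y]]/(xy), where A = R has a single simple module but R is not normal. *)

(* Defs.v *)
From HB Require Import structures.
From mathcomp Require Import all_boot all_algebra generic_quotient.
From mathcomp Require Import boolp classical_sets ring.

Set Implicit Arguments.
Unset Strict Implicit.
Unset Printing Implicit Defensive.

Import GRing.Theory.
Local Open Scope ring_scope.
Local Open Scope quotient_scope.

(* R-algebras as rings with a central structure map: MathComp's algType
   excludes the zero ring, which End_R(M) is when M = 0. *)
Record ralgebra (R : comPzRingType) := RAlgebra {
  alg_ring :> pzRingType;
  alg_map : {rmorphism R -> alg_ring};
  alg_mapC : forall (r : R) (a : alg_ring), alg_map r * a = a * alg_map r
}.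
Arguments alg_map {R} A : rename.

Definition alg_isomorphic (R : comPzRingType) (A B : ralgebra R) : Prop :=
  exists2 f : {rmorphism A -> B}, bijective f
    & forall r : R, f (alg_map A r) = alg_map B r.

(* A as an R-module *)
Definition alg_mod (R : comPzRingType) (A : ralgebra R) : Type := A.

Section AlgebraModule.
Variables (R : comPzRingType) (A : ralgebra R).
HB.instance Definition _ := GRing.PzRing.on (alg_mod A).

Definition alg_scale (r : R) (a : alg_mod A) : alg_mod A := alg_map A r * (a : A).

Fact alg_scaleA r s a : alg_scale r (alg_scale s a) = alg_scale (r * s) a.
Proof. by rewrite /alg_scale rmorphM mulrA. Qed.
Fact alg_scale1 : left_id 1 alg_scale.
Proof. by move=> a; rewrite /alg_scale rmorph1 mul1r. Qed.
Fact alg_scaleDr : right_distributive alg_scale +%R.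
Proof. by move=> r a b; rewrite /alg_scale mulrDr. Qed.
Fact alg_scaleDl a : {morph alg_scale^~ a : r s / r + s}.
Proof. by move=> r s; rewrite /alg_scale rmorphD mulrDl. Qed.
HB.instance Definition _ := GRing.Zmodule_isLmodule.Build R (alg_mod A)
  alg_scaleA alg_scale1 alg_scaleDr alg_scaleDl.

Lemma alg_scaleAl (r : R) (a b : alg_mod A) : r *: (a * b) = (r *: a) * b.
Proof. exact: mulrA. Qed.
Lemma alg_scaleAr (r : R) (a b : alg_mod A) : r *: (a * b) = a * (r *: b).
Proof. by rewrite /GRing.scale /= /alg_scale mulrA alg_mapC mulrA. Qed.
End AlgebraModule.

(* The product of the endomorphism algebra is composition, so that M is a left
   End_R(M)-module. *)
Section Endomorphisms.
Variables (R : comPzRingType) (M : lmodType R).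

Definition End_ring : Type := {linear M -> M}.
Identity Coercion linear_of_End_ring : End_ring >-> GRing.Linear.type.

HB.instance Definition _ := gen_eqMixin End_ring.
HB.instance Definition _ := gen_choiceMixin End_ring.

Implicit Types f g h : End_ring.

Lemma End_ringP f g : f =1 g -> f = g.
Proof.
move=> /funext; case: f => f cf; case: g => g cg /= efg.
subst g; congr GRing.Linear.Pack.
case: cf => [[] [] a b []] c; case: cg => [[] [] a' b' []] c'.
by congr GRing.Linear.Class;
  [congr Algebra.isNmodMorphism.Axioms_|congr GRing.isScalable.Axioms_];
  exact: Prop_irrelevance.
Qed.

Definition End_zero : End_ring := \0.
Definition End_opp f : End_ring := \- f.
Definition End_add f g : End_ring := f \+ g.
Definition End_one : End_ring := idfun.
Definition End_mul f g : End_ring := f \o g.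

Fact End_addA : associative End_add.
Proof. by move=> f g h; apply: End_ringP => x /=; rewrite addrA. Qed.
Fact End_addC : commutative End_add.
Proof. by move=> f g; apply: End_ringP => x /=; rewrite addrC. Qed.
Fact End_add0 : left_id End_zero End_add.
Proof. by move=> f; apply: End_ringP => x /=; rewrite add0r. Qed.
Fact End_addN : left_inverse End_zero End_opp End_add.
Proof. by move=> f; apply: End_ringP => x /=; rewrite addNr. Qed.
HB.instance Definition _ :=
  GRing.isZmodule.Build End_ring End_addA End_addC End_add0 End_addN.

Fact End_mulA : associative End_mul.
Proof. by move=> f g h; apply: End_ringP. Qed.
Fact End_mul1 : left_id End_one End_mul.
Proof. by move=> f; apply: End_ringP. Qed.
Fact End_mulr1 : right_id End_one End_mul.
Proof. by move=> f; apply: End_ringP. Qed.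
Fact End_mulDl : left_distributive End_mul +%R.
Proof. by move=> f g h; apply: End_ringP. Qed.
Fact End_mulDr : right_distributive End_mul +%R.
Proof. by move=> f g h; apply: End_ringP => x /=; rewrite linearD. Qed.
HB.instance Definition _ := GRing.Zmodule_isPzRing.Build End_ring
  End_mulA End_mul1 End_mulr1 End_mulDl End_mulDr.

Definition End_scalar (r : R) : End_ring := r \*: idfun.

Fact End_scalar_zmod : zmod_morphism End_scalar.
Proof. by move=> r s; apply: End_ringP => x /=; rewrite scalerBl. Qed.
Fact End_scalar_monoid : monoid_morphism End_scalar.
Proof.
by split=> [|r s]; apply: End_ringP => x /=; rewrite ?scale1r ?scalerA.
Qed.
HB.instance Definition _ :=
  GRing.isZmodMorphism.Build R End_ring End_scalar End_scalar_zmod.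
HB.instance Definition _ :=
  GRing.isMonoidMorphism.Build R End_ring End_scalar End_scalar_monoid.

Fact End_scalarC (r : R) f : End_scalar r * f = f * End_scalar r.
Proof. by apply: End_ringP => x /=; rewrite linearZ. Qed.

Definition End_alg : ralgebra R := RAlgebra End_scalarC.
End Endomorphisms.

Section Center.
Variables (R : comPzRingType) (A : ralgebra R).

Definition central : {pred A} := [pred z | `[< forall a : A, z * a = a * z >]].

Fact central_subring : subring_closed central.
Proof.
split=> [|x y|x y]; rewrite ?inE.
- by move=> a; rewrite mul1r mulr1.
- move=> cx cy a.
  by rewrite mulrBl mulrBr cx cy.
- move=> cx cy a.
  by rewrite -mulrA cy !mulrA cx.
Qed.
HB.instance Definition _ := GRing.isSubringClosed.Build A central central_subring.

Record center_ring := CenterRing { center_val :> A; _ : center_val \in central }.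

HB.instance Definition _ := [isSub for center_val].
HB.instance Definition _ := [Choice of center_ring by <:].
HB.instance Definition _ := [SubChoice_isSubZmodule of center_ring by <:].
HB.instance Definition _ :=
  GRing.SubZmodule_isSubPzRing.Build A central center_ring central_subring.

Fact alg_map_central (r : R) : alg_map A r \in central.
Proof. by rewrite inE => a; apply: alg_mapC. Qed.

Definition center_map (r : R) : center_ring := CenterRing (alg_map_central r).

Fact center_map_zmod : zmod_morphism center_map.
Proof. by move=> r s; apply: val_inj; rewrite /= rmorphB. Qed.
Fact center_map_monoid : monoid_morphism center_map.
Proof. by split=> [|r s]; apply: val_inj; rewrite /= ?rmorph1 ?rmorphM. Qed.
HB.instance Definition _ :=
  GRing.isZmodMorphism.Build R center_ring center_map center_map_zmod.
HB.instance Definition _ :=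
  GRing.isMonoidMorphism.Build R center_ring center_map center_map_monoid.

Fact center_mapC (r : R) (z : center_ring) : center_map r * z = z * center_map r.
Proof. by apply: val_inj; rewrite /= alg_mapC. Qed.

Definition center : ralgebra R := RAlgebra center_mapC.
End Center.

Record mulset (R : comNzRingType) := MulSet {
  mulset_pred :> {pred R};
  mulset_closed : mulr_closed mulset_pred;
  mulset_proper : 0 \notin mulset_pred
}.

(* S^-1 M as the quotient of M * S by
   (x, s) ~ (y, t) <-> u *: (t *: x) = u *: (s *: y) for some u in S. *)
Section LocalizedModule.
Variables (R : comNzRingType) (S : mulset R) (M : lmodType R).

Local Notation den := {s : R | s \in S}.

Fact den1_in : 1 \in S. Proof. by case: (mulset_closed S). Qed.
Fact denM_in (s t : den) : sval s * sval t \in S.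
Proof. by have [_] := mulset_closed S; apply; [case: s|case: t]. Qed.
Definition den1 : den := exist _ 1 den1_in.
Definition denM (s t : den) : den := exist _ (sval s * sval t) (denM_in s t).

Local Notation frac := (M * den)%type.

Definition frac_eq (p q : frac) : bool :=
  `[< exists u : den,
        sval u *: (sval q.2 *: p.1) = sval u *: (sval p.2 *: q.1) >].

Fact frac_eq_refl : reflexive frac_eq.
Proof. by move=> p; apply/asboolP; exists den1. Qed.
Fact frac_eq_sym : symmetric frac_eq.
Proof. by move=> p q; apply/asboolP/asboolP => -[u e]; exists u. Qed.
Fact frac_eq_trans : transitive frac_eq.
Proof.
move=> q p r /asboolP[u e] /asboolP[v f]; apply/asboolP.
exists (denM (denM u v) q.2) => /=.
transitivity ((sval v * sval r.2) *: (sval u *: (sval p.2 *: q.1))).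
  by rewrite -e !scalerA; congr (_ *: _); ring.
transitivity ((sval u * sval p.2) *: (sval v *: (sval r.2 *: q.1))).
  by rewrite !scalerA; congr (_ *: _); ring.
by rewrite f !scalerA; congr (_ *: _); ring.
Qed.
Canonical frac_equiv :=
  EquivRel frac_eq frac_eq_refl frac_eq_sym frac_eq_trans.

Definition loc_mod : Type := {eq_quot frac_eq}.
HB.instance Definition _ : EqQuotient _ frac_eq loc_mod :=
  EqQuotient.on loc_mod.
HB.instance Definition _ := Choice.on loc_mod.

Definition lfrac (x : M) (s : den) : loc_mod := \pi_loc_mod (x, s).

Lemma lfracP (z : loc_mod) : exists x s, z = lfrac x s.
Proof.
by exists (repr z).1, (repr z).2; rewrite /lfrac -surjective_pairing reprK.
Qed.

Lemma lfrac_eq (x y : M) (s t : den) : lfrac x s = lfrac y t <->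
  exists u : den, sval u *: (sval t *: x) = sval u *: (sval s *: y).
Proof.
split=> [/eqmodP/asboolP//|e]; apply/eqmodP; exact/asboolP.
Qed.

Lemma lfrac_eqW (x y : M) (s t : den) :
  sval t *: x = sval s *: y -> lfrac x s = lfrac y t.
Proof. by move=> e; apply/lfrac_eq; exists den1; rewrite e. Qed.

Lemma lfrac_repr (x : M) (s : den) : exists u : den,
  sval u *: (sval s *: (repr (lfrac x s)).1)
    = sval u *: (sval (repr (lfrac x s)).2 *: x).
Proof. by apply/lfrac_eq; rewrite /lfrac -surjective_pairing reprK. Qed.
End LocalizedModule.

(* (x / s, y / t) |-> op x y / (s * t) *)
Section LocalizedBilinear.
Variables (R : comNzRingType) (S : mulset R) (M N P : lmodType R).
Variable op : M -> N -> P.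
Hypotheses (opl : forall (r : R) x y, op (r *: x) y = r *: op x y)
           (opr : forall (r : R) x y, op x (r *: y) = r *: op x y).

Definition loc_op (z : loc_mod S M) (w : loc_mod S N) : loc_mod S P :=
  lfrac (op (repr z).1 (repr w).1) (denM (repr z).2 (repr w).2).

Lemma loc_opE x s y t :
  loc_op (lfrac x s) (lfrac y t) = lfrac (op x y) (denM s t).
Proof.
have [u eu] := lfrac_repr x s; have [v ev] := lfrac_repr y t.
apply/lfrac_eq; exists (denM u v); rewrite /=.
set x' := (repr _).1 in eu *; set s' := (repr _).2 in eu *.
set y' := (repr _).1 in ev *; set t' := (repr _).2 in ev *.
move: (congr2 op eu ev); rewrite !(opl, opr) !scalerA => e.
rewrite [X in X *: _ = _](_ : _ = sval u * sval s * sval v * sval t); last by ring.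
by rewrite e; congr (_ *: _); ring.
Qed.
End LocalizedBilinear.

Section LocalizedZmodule.
Variables (R : comNzRingType) (S : mulset R) (M : lmodType R).
Implicit Types z w : loc_mod S M.

Definition loc_add z w : loc_mod S M :=
  lfrac (sval (repr w).2 *: (repr z).1 + sval (repr z).2 *: (repr w).1)
        (denM (repr z).2 (repr w).2).
Definition loc_opp z : loc_mod S M := lfrac (- (repr z).1) (repr z).2.
Definition loc_zero : loc_mod S M := lfrac 0 (den1 S).

Lemma loc_addE x s y t : loc_add (lfrac x s) (lfrac y t)
  = lfrac (sval t *: x + sval s *: y) (denM s t).
Proof.
have [u eu] := lfrac_repr x s; have [v ev] := lfrac_repr y t.
apply/lfrac_eq; exists (denM u v); rewrite /=.
set x' := (repr _).1 in eu *; set s' := (repr _).2 in eu *.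
set y' := (repr _).1 in ev *; set t' := (repr _).2 in ev *.
rewrite !(scalerDr, scalerA); congr (_ + _).
  move: (congr1 (fun a => (sval v * sval t * sval t') *: a) eu).
  rewrite /= !scalerA => e.
  rewrite [X in X *: _ = _](_ : _ = sval v * sval t * sval t' * sval u * sval s).
    by rewrite e; congr (_ *: _); ring.
  by ring.
move: (congr1 (fun a => (sval u * sval s * sval s') *: a) ev).
rewrite /= !scalerA => e.
rewrite [X in X *: _ = _](_ : _ = sval u * sval s * sval s' * sval v * sval t).
  by rewrite e; congr (_ *: _); ring.
by ring.
Qed.

Lemma loc_oppE x s : loc_opp (lfrac x s) = lfrac (- x) s.
Proof.
have [u eu] := lfrac_repr x s; apply/lfrac_eq; exists u.
by rewrite !scalerN eu.
Qed.

Fact loc_addA : associative loc_add.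
Proof.
move=> z w v; have [x [s ->]] := lfracP z; have [y [t ->]] := lfracP w.
have [a [u ->]] := lfracP v; rewrite !loc_addE; apply: lfrac_eqW => /=.
rewrite !(scalerDr, scalerA) addrA.
by congr (_ *: _ + _ *: _ + _ *: _); ring.
Qed.
Fact loc_addC : commutative loc_add.
Proof.
move=> z w; have [x [s ->]] := lfracP z; have [y [t ->]] := lfracP w.
by rewrite !loc_addE; apply: lfrac_eqW => /=; rewrite addrC mulrC.
Qed.
Fact loc_add0 : left_id loc_zero loc_add.
Proof.
move=> z; have [x [s ->]] := lfracP z; rewrite loc_addE; apply: lfrac_eqW.
by rewrite /= scaler0 add0r mul1r scale1r.
Qed.
Fact loc_addN : left_inverse loc_zero loc_opp loc_add.
Proof.
move=> z; have [x [s ->]] := lfracP z; rewrite loc_oppE loc_addE.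
by apply: lfrac_eqW; rewrite /= scalerN addNr !scaler0.
Qed.
HB.instance Definition _ :=
  GRing.isZmodule.Build (loc_mod S M) loc_addA loc_addC loc_add0 loc_addN.

Lemma lfracD x s y t : lfrac x s + lfrac y t
  = lfrac (sval t *: x + sval s *: y) (denM s t) :> loc_mod S M.
Proof. exact: loc_addE. Qed.
Lemma lfracN x s : - lfrac x s = lfrac (- x) s :> loc_mod S M.
Proof. exact: loc_oppE. Qed.
Lemma lfrac0 : 0 = lfrac 0 (den1 S) :> loc_mod S M.
Proof. by []. Qed.
End LocalizedZmodule.

Section LocalizedRing.
Variables (R : comNzRingType) (S : mulset R).

Definition loc_ring : Type := loc_mod S R^o.
HB.instance Definition _ := GRing.Zmodule.on loc_ring.

Definition loc_one : loc_ring := lfrac (1 : R^o) (den1 S).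
Definition loc_mul : loc_ring -> loc_ring -> loc_ring :=
  loc_op (fun x y : R^o => (x * y : R^o)).

Lemma loc_mulE (x y : R^o) (s t : {s : R | s \in S}) :
  loc_mul (lfrac x s) (lfrac y t) = lfrac (x * y : R^o) (denM s t).
Proof. by apply: loc_opE => r a b; rewrite /GRing.scale /=; ring. Qed.

Fact loc_mulA : associative loc_mul.
Proof.
move=> z w v; have [x [s ->]] := lfracP z; have [y [t ->]] := lfracP w.
have [a [u ->]] := lfracP v.
rewrite (loc_mulE y a) (loc_mulE x y) 2!loc_mulE; apply: lfrac_eqW => /=.
by rewrite /GRing.scale /=; ring.
Qed.
Fact loc_mulC : commutative loc_mul.
Proof.
move=> z w; have [x [s ->]] := lfracP z; have [y [t ->]] := lfracP w.
by rewrite !loc_mulE; apply: lfrac_eqW => /=; rewrite /GRing.scale /=; ring.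
Qed.
Fact loc_mul1 : left_id loc_one loc_mul.
Proof.
move=> z; have [x [s ->]] := lfracP z; rewrite loc_mulE; apply: lfrac_eqW.
by rewrite /GRing.scale /=; ring.
Qed.
Fact loc_mulDl : left_distributive loc_mul +%R.
Proof.
move=> z w v; have [x [s ->]] := lfracP z; have [y [t ->]] := lfracP w.
have [a [u ->]] := lfracP v; rewrite lfracD !loc_mulE lfracD.
by apply: lfrac_eqW => /=; rewrite /GRing.scale /=; ring.
Qed.
Fact loc_one_neq0 : loc_one != 0.
Proof.
apply/eqP; rewrite lfrac0 => /lfrac_eq[u]; rewrite !scale1r scaler0.
rewrite /GRing.scale /= mulr1 => u0.
by have := mulset_proper S; rewrite -u0 (svalP u).
Qed.
HB.instance Definition _ := GRing.Zmodule_isComNzRing.Build loc_ring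
  loc_mulA loc_mulC loc_mul1 loc_mulDl loc_one_neq0.

Definition loc_map (r : R) : loc_ring := lfrac (r : R^o) (den1 S).

Fact loc_map_zmod : zmod_morphism loc_map.
Proof.
move=> r s; rewrite /loc_map /= (lfracN (s : R^o)) (lfracD (r : R^o)).
by apply: lfrac_eqW => /=; rewrite /GRing.scale /=; ring.
Qed.
Fact loc_map_monoid : monoid_morphism loc_map.
Proof.
split=> // r s; rewrite /loc_map [RHS](loc_mulE (r : R^o)).
by apply: lfrac_eqW => /=; rewrite /GRing.scale /=; ring.
Qed.
HB.instance Definition _ :=
  GRing.isZmodMorphism.Build R loc_ring loc_map loc_map_zmod.
HB.instance Definition _ :=
  GRing.isMonoidMorphism.Build R loc_ring loc_map loc_map_monoid.
End LocalizedRing.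

Section LocalizedScale.
Variables (R : comNzRingType) (S : mulset R) (M : lmodType R).

Definition loc_scale : loc_ring S -> loc_mod S M -> loc_mod S M :=
  loc_op (fun (a : R^o) (x : M) => (a : R) *: x).

Lemma loc_scaleE (a : R^o) (x : M) (s t : {s : R | s \in S}) :
  loc_scale (lfrac a s) (lfrac x t) = lfrac ((a : R) *: x) (denM s t).
Proof.
apply: loc_opE => r b y; first by rewrite scalerA.
by rewrite !scalerA [_ * r]mulrC.
Qed.

Fact loc_scaleA a b z : loc_scale a (loc_scale b z) = loc_scale (a * b) z.
Proof.
have [x [s ->]] := lfracP z; have [r [t ->]] := lfracP a.
have [q [u ->]] := lfracP b.
rewrite (loc_scaleE q x) [_ * _](loc_mulE r q) 2!loc_scaleE.
by apply: lfrac_eqW => /=; rewrite !scalerA; congr (_ *: _); ring.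
Qed.
Fact loc_scale1 : left_id 1 loc_scale.
Proof.
move=> z; have [x [s ->]] := lfracP z; rewrite loc_scaleE; apply: lfrac_eqW.
by rewrite /= scale1r mul1r.
Qed.
Fact loc_scaleDr : right_distributive loc_scale +%R.
Proof.
move=> a z w; have [x [s ->]] := lfracP z; have [r [t ->]] := lfracP a.
have [y [u ->]] := lfracP w; rewrite lfracD !loc_scaleE lfracD.
apply: lfrac_eqW => /=; rewrite !(scalerDr, scalerA).
by congr (_ *: _ + _ *: _); ring.
Qed.
Fact loc_scaleDl z : {morph loc_scale^~ z : a b / a + b}.
Proof.
move=> a b; have [x [s ->]] := lfracP z; have [r [t ->]] := lfracP a.
have [q [u ->]] := lfracP b.
rewrite (lfracD r) (loc_scaleE _ x) (loc_scaleE r) (loc_scaleE q) lfracD.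
apply: lfrac_eqW => /=; rewrite !(scalerDl, scalerDr, scalerA).
by rewrite -scalerDl; congr (_ *: _); rewrite /GRing.scale /=; ring.
Qed.
HB.instance Definition _ := GRing.Zmodule_isLmodule.Build (loc_ring S)
  (loc_mod S M) loc_scaleA loc_scale1 loc_scaleDr loc_scaleDl.
End LocalizedScale.

Section LocalizedAlgebra.
Variables (R : comNzRingType) (S : mulset R) (A : ralgebra R).

Definition loc_alg : Type := loc_mod S (alg_mod A).
HB.instance Definition _ := GRing.Zmodule.on loc_alg.

Local Notation den := {s : R | s \in S}.

Definition loc_alg_one : loc_alg := lfrac (1 : alg_mod A) (den1 S).
Definition loc_alg_mul : loc_alg -> loc_alg -> loc_alg :=
  loc_op (fun x y : alg_mod A => x * y).

Lemma loc_alg_mulE (x y : alg_mod A) (s t : den) :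
  loc_alg_mul (lfrac x s) (lfrac y t) = lfrac (x * y) (denM s t).
Proof.
by apply: loc_opE => r a b; [rewrite alg_scaleAl|rewrite alg_scaleAr].
Qed.

Fact loc_alg_mulA : associative loc_alg_mul.
Proof.
move=> z w v; have [x [s ->]] := lfracP z; have [y [t ->]] := lfracP w.
have [a [u ->]] := lfracP v.
rewrite (loc_alg_mulE y a) (loc_alg_mulE x y) 2!loc_alg_mulE.
by apply: lfrac_eqW => /=; rewrite !mulrA.
Qed.
Fact loc_alg_mul1 : left_id loc_alg_one loc_alg_mul.
Proof.
move=> z; have [x [s ->]] := lfracP z; rewrite loc_alg_mulE.
by apply: lfrac_eqW; rewrite /= !mul1r.
Qed.
Fact loc_alg_mulr1 : right_id loc_alg_one loc_alg_mul.
Proof.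
move=> z; have [x [s ->]] := lfracP z; rewrite loc_alg_mulE.
by apply: lfrac_eqW; rewrite /= !mulr1.
Qed.
Fact loc_alg_mulDl : left_distributive loc_alg_mul +%R.
Proof.
move=> z w v; have [x [s ->]] := lfracP z; have [y [t ->]] := lfracP w.
have [a [u ->]] := lfracP v; rewrite lfracD !loc_alg_mulE lfracD.
apply: lfrac_eqW => /=; rewrite mulrDl -!alg_scaleAl !(scalerDr, scalerA).
by congr (_ *: _ + _ *: _); ring.
Qed.
Fact loc_alg_mulDr : right_distributive loc_alg_mul +%R.
Proof.
move=> v z w; have [x [s ->]] := lfracP z; have [y [t ->]] := lfracP w.
have [a [u ->]] := lfracP v; rewrite lfracD !loc_alg_mulE lfracD.
apply: lfrac_eqW => /=; rewrite mulrDr -!alg_scaleAr !(scalerDr, scalerA).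
by congr (_ *: _ + _ *: _); ring.
Qed.
HB.instance Definition _ := GRing.Zmodule_isPzRing.Build loc_alg
  loc_alg_mulA loc_alg_mul1 loc_alg_mulr1 loc_alg_mulDl loc_alg_mulDr.
End LocalizedAlgebra.

Section Normalization.
Variable R : comNzRingType.

Definition nonzerodivisor : {pred R} :=
  [pred r | `[< forall x : R, r * x = 0 -> x = 0 >]].

Fact nonzerodivisor_closed : mulr_closed nonzerodivisor.
Proof.
split=> [|r s]; rewrite !inE; first by move=> x; rewrite mul1r.
by move=> r0 s0 x; rewrite -mulrA => /r0/s0.
Qed.
Fact nonzerodivisor_proper : 0 \notin nonzerodivisor.
Proof.
apply/negP; rewrite inE => /(_ 1); rewrite mul0r => /(_ erefl)/eqP.
by rewrite oner_eq0.
Qed.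

Definition total_quotient_ring : Type :=
  loc_ring (MulSet nonzerodivisor_closed nonzerodivisor_proper).
HB.instance Definition _ := GRing.ComNzRing.on total_quotient_ring.

Definition to_quotient : {rmorphism R -> total_quotient_ring} :=
  @loc_map R (MulSet nonzerodivisor_closed nonzerodivisor_proper).

Definition integral : {pred total_quotient_ring} :=
  [pred z | `[< integralOver to_quotient z >]].

Fact integral_subring : subring_closed integral.
Proof.
split=> [|x y|x y].
- exact/asboolP/integral1.
- move=> /asboolP ix /asboolP iy; apply/asboolP.
  exact: (integral_sub ix iy).
- move=> /asboolP ix /asboolP iy; apply/asboolP.
  exact: (integral_mul ix iy).
Qed.
HB.instance Definition _ :=
  GRing.isSubringClosed.Build total_quotient_ring integral integral_subring.

Record normalization_ring :=
  NormalizationRing { norm_val :> total_quotient_ring; _ : norm_val \in integral }.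

HB.instance Definition _ := [isSub for norm_val].
HB.instance Definition _ := [Choice of normalization_ring by <:].
HB.instance Definition _ := [SubChoice_isSubZmodule of normalization_ring by <:].
HB.instance Definition _ := GRing.SubZmodule_isSubPzRing.Build
  total_quotient_ring integral normalization_ring integral_subring.

Fact to_quotient_integral (r : R) : to_quotient r \in integral.
Proof. exact/asboolP/integral_id. Qed.

Definition norm_map (r : R) : normalization_ring :=
  NormalizationRing (to_quotient_integral r).

Fact norm_map_zmod : zmod_morphism norm_map.
Proof. by move=> r s; apply: val_inj; rewrite /= rmorphB. Qed.
Fact norm_map_monoid : monoid_morphism norm_map.
Proof. by split=> [|r s]; apply: val_inj; rewrite /= ?rmorph1 ?rmorphM. Qed.
HB.instance Definition _ :=
  GRing.isZmodMorphism.Build R normalization_ring norm_map norm_map_zmod.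
HB.instance Definition _ :=
  GRing.isMonoidMorphism.Build R normalization_ring norm_map norm_map_monoid.

Fact norm_mapC (r : R) (z : normalization_ring) : norm_map r * z = z * norm_map r.
Proof. by apply: val_inj; rewrite /= mulrC. Qed.

Definition normalization : ralgebra R := RAlgebra norm_mapC.
End Normalization.
Arguments nonzerodivisor R : clear implicits.

(* A dimension with values in nat + {oo}, None standing for oo, as the least n
   with P n: the least length of a resolution, or the least upper bound. *)
Definition least (P : nat -> Prop) : option nat :=
  if pselect (exists n, `[< P n >]) is left ex then Some (ex_minn ex) else None.

Definition surj (T U : Type) (f : T -> U) : Prop := forall y, exists x, f x = y.

Section Modules.
Variable A : pzRingType.
Implicit Types M N P : lmodType A.

Definition finitely_generated M : Prop :=
  exists (n : nat) (e : 'I_n -> M),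
    forall x : M, exists c : 'I_n -> A, x = \sum_i c i *: e i.

Definition simple_module M : Prop :=
  (exists x : M, x <> 0) /\
  forall N : {pred M}, GRing.submod_closed N ->
    (forall x, x \in N -> x = 0) \/ (forall x, x \in N).

Definition projective_module P : Prop :=
  forall (M N : lmodType A) (g : {linear M -> N}) (f : {linear P -> N}),
    surj g -> exists h : {linear P -> M}, forall x, g (h x) = f x.

Definition exact_at M N P (f : {linear M -> N}) (g : {linear N -> P}) : Prop :=
  forall y : N, g y = 0 <-> exists x : M, f x = y.

(* 0 -> P n -> ... -> P 0 -> M -> 0 *)
Definition has_projective_resolution M (n : nat) : Prop :=
  exists (P : nat -> lmodType A) (d : forall i, {linear P i.+1 -> P i})
         (e : {linear P 0 -> M}),
  [/\ forall i, projective_module (P i),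
      forall i, (n < i)%N -> forall x : P i, x = 0,
      surj e,
      exact_at (d 0) e
    & forall i, exact_at (d i.+1) (d i)].

Definition proj_dim M : option nat := least (has_projective_resolution M).
End Modules.

Definition global_dim (A : pzRingType) : option nat :=
  least (fun n => forall M : lmodType A, has_projective_resolution M n).

Definition left_noetherian (A : pzRingType) : Prop :=
  forall I : nat -> {pred A^o},
    (forall i, GRing.submod_closed (I i)) ->
    (forall i, {subset I i <= I i.+1}) ->
    exists n, forall i, (n <= i)%N -> I i =i I n.

Definition noetherian (A : pzRingType) : Prop :=
  left_noetherian A /\ left_noetherian A^c.

Definition reduced (R : pzRingType) : Prop :=
  forall (x : R) (n : nat), x ^+ n = 0 -> x = 0.

Section PrimeSpectrum.
Variable R : comNzRingType.
Implicit Types p q : prime_idealr R.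

Definition is_maximal (m : {pred R}) : Prop :=
  idealr_closed m /\
  forall I : {pred R}, idealr_closed I -> {subset m <= I} -> I =i m.

Definition prime_chain (k : nat) (c : nat -> prime_idealr R) : Prop :=
  forall i, (i < k)%N ->
    {subset c i <= c i.+1} /\ ~ {subset c i.+1 <= c i}.

Definition krull_dim : option nat :=
  least (fun n => forall k c, prime_chain k c -> (k <= n)%N).

Definition height p : option nat :=
  least (fun n => forall k c, prime_chain k c -> c k =i p -> (k <= n)%N).

Definition equicodimensional : Prop :=
  forall p q, is_maximal p -> is_maximal q -> height p = height q.

Definition prime_compl p : {pred R} := [pred x | x \notin p].

Fact prime_compl_closed p : mulr_closed (prime_compl p).
Proof.
split=> [|x y]; rewrite !inE; first by rewrite idealr1.
by rewrite prime_idealrM negb_or => -> ->.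
Qed.
Fact prime_compl_proper p : 0 \notin prime_compl p.
Proof. by rewrite inE negbK idealr0. Qed.

Definition at_prime p : mulset R :=
  MulSet (prime_compl_closed p) (prime_compl_proper p).

Definition supp (M : lmodType R) (p : prime_idealr R) : Prop :=
  exists x : loc_mod (at_prime p) M, x <> 0.

Definition torsion_free (M : lmodType R) : Prop :=
  forall (r : R) (x : M), r \in nonzerodivisor R -> r *: x = 0 -> x = 0.
End PrimeSpectrum.

Section Depth.
Variables (R : comNzRingType) (M : lmodType R).

(* y \in (r_1, ..., r_k) M *)
Definition in_ideal_mul (rs : seq R) (y : M) : Prop :=
  exists c : 'I_(size rs) -> M, y = \sum_(i < size rs) rs`_i *: c i.

Definition regular_sequence (rs : seq R) : Prop :=
  (forall i, (i < size rs)%N -> forall y : M,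
     in_ideal_mul (take i rs) (rs`_i *: y) -> in_ideal_mul (take i rs) y) /\
  exists y : M, ~ in_ideal_mul rs y.

Definition depth (I : {pred R}) : option nat :=
  least (fun n => forall rs : seq R,
    {subset rs <= I} -> regular_sequence rs -> (size rs <= n)%N).
End Depth.

Section MaximalCohenMacaulay.
Variable R : comNzRingType.

(* p R_p *)
Definition loc_maximal (p : prime_idealr R) : {pred loc_ring (at_prime p)} :=
  [pred z | `[< exists (a : R^o) (s : {s : R | s \in at_prime p}),
                 (a : R) \in p /\ z = lfrac a s >]].

Definition maximal_cohen_macaulay (M : lmodType R) : Prop :=
  finitely_generated M /\
  forall p : prime_idealr R, is_maximal p ->
    supp M p /\
    depth (loc_mod (at_prime p) M) (@loc_maximal p)
      = krull_dim (loc_ring (at_prime p)).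
End MaximalCohenMacaulay.

(* Two simple modules with the same annihilator in R share a projective
   dimension n in nat: were oo allowed, R itself would be homologically
   homogeneous whenever R is local, and the centre of End_R(R) = R need not be
   normal. *)
Definition homologically_homogeneous (R : comNzRingType) (A : ralgebra R) : Prop :=
  [/\ finitely_generated (alg_mod A : lmodType R),
      noetherian A
    & forall S T : lmodType A, simple_module S -> simple_module T ->
      (forall r : R, (forall x : S, alg_map A r *: x = 0) <->
                     (forall y : T, alg_map A r *: y = 0)) ->
      exists n : nat, proj_dim S = Some n /\ proj_dim T = Some n].

Definition nonsingular_order (R : comNzRingType) (A : ralgebra R) : Prop :=
  maximal_cohen_macaulay (alg_mod A : lmodType R) /\
  forall p : prime_idealr R,
    global_dim (loc_alg (at_prime p) A) = krull_dim (loc_ring (at_prime p)).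

Definition gives_NCCR (R : comNzRingType) (M : lmodType R) : Prop :=
  [/\ finitely_generated M, torsion_free M,
      forall p, supp M p <-> supp (R^o : lmodType R) p
    & nonsingular_order (End_alg M)].

(* Main.v *)
(* The centre of [A = End_R(M)] consists of the elements of the total quotient ring Q
   that map [M] to itself, and these are integral over [R] by Cayley-Hamilton.  Let
   conversely [w] in Q be integral over [R] and suppose that [w M] is not contained in
   [M].  Some [g] in [R[w]] outside [A] has a prime annihilator [p] in [R] modulo [A], and
   then [p] is associated to [A / c A] for a non-zero-divisor [c] with [c R[w]] in [R].

   Suppose that [A_p] has global dimension at most one, and let [I] be the left ideal
   generated by the conductor of [R[w]] in the centre.  Then [I_p] is projective, so it
   has a dual basis, and as [I] is generated by central elements and stable under [g],
   the dual basis expresses [g] as an element of [A_p]: a contradiction.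

   For the bound on the global dimension of [A_p], let [m] contain [p].  If [A] is
   homologically homogeneous, the common projective dimension [d] of the simple modules
   over [m] is both the global dimension of [A_m] and its depth over [R]; the depth yields
   a chain of [d] primes from [p] to [m], and the global dimension drops by at least one
   at each generization.  If [A] is a non-singular order, the depth of [A_m] is the
   dimension of [R_m], which leaves only height one for [p]. *)
Require Import Defs.
From HB Require Import structures.
From mathcomp Require Import all_boot all_algebra generic_quotient.
From mathcomp Require Import boolp ring.

Set Implicit Arguments.
Unset Strict Implicit.
Unset Printing Implicit Defensive.

Import GRing.Theory.
Local Open Scope ring_scope.
Local Open Scope quotient_scope.

(** * Submodules and quotients *)

Section Submodules.
Variables (B : pzRingType) (V : lmodType B).
Implicit Types (N : V -> Prop) (s : seq V).

Definition is_submod N : Prop :=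
  N 0 /\ forall a x y, N x -> N y -> N (a *: x + y).

Lemma submod0 N : is_submod N -> N 0. Proof. by case. Qed.
Lemma submodD N x y : is_submod N -> N x -> N y -> N (x + y).
Proof. by move=> [_ h] Nx Ny; rewrite -[x]scale1r; apply: h. Qed.
Lemma submodZ N a x : is_submod N -> N x -> N (a *: x).
Proof. by move=> [h0 h] Nx; rewrite -[_ *: _]addr0; apply: h. Qed.
Lemma submodN N x : is_submod N -> N x -> N (- x).
Proof. by move=> h Nx; rewrite -scaleN1r; apply: submodZ. Qed.
Lemma submodB N x y : is_submod N -> N x -> N y -> N (x - y).
Proof. by move=> h Nx Ny; apply: submodD => //; apply: submodN. Qed.
Lemma submod_sum N (I : Type) (r : seq I) (P : pred I) (F : I -> V) :
  is_submod N -> (forall i, P i -> N (F i)) -> N (\sum_(i <- r | P i) F i).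
Proof.
move=> h hF; apply: big_ind => //; first exact: submod0.
by move=> x y; apply: submodD.
Qed.
Lemma submod_addl N x y : is_submod N -> N x -> N (x + y) -> N y.
Proof. by move=> h Nx Nxy; rewrite -[y](addKr x); apply: submodD => //; apply: submodN. Qed.

Lemma submod_zero : is_submod (fun v => v = 0).
Proof. by split=> // a x y -> ->; rewrite scaler0 addr0. Qed.

Fixpoint lspan s (x : V) : Prop :=
  if s is e :: s' then exists r y, lspan s' y /\ x = r *: e + y else x = 0.

Lemma lspan_submod s : is_submod (lspan s).
Proof.
elim: s => [|e s [h0 h]] /=.
  exact: submod_zero.
split; first by exists 0, 0; split=> //; rewrite scale0r addr0.
move=> a x y [r [u [su ->]]] [r' [u' [su' ->]]].
exists (a * r + r'), (a *: u + u'); split; first exact: h.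
by rewrite scalerDr scalerA addrACA -scalerDl.
Qed.

Lemma lspan_mem s e : e \in s -> lspan s e.
Proof.
elim: s => //= f s IH; rewrite in_cons => /orP[/eqP ->|es].
  by exists 1, 0; split; [exact: submod0 (lspan_submod s)|rewrite scale1r addr0].
by exists 0, e; split; [exact: IH|rewrite scale0r add0r].
Qed.

Lemma lspan_min N s x : is_submod N -> (forall e, e \in s -> N e) -> lspan s x -> N x.
Proof.
move=> hN; elim: s x => [|e s IH] x hs /= => [->|[r [y [sy ->]]]].
  exact: submod0.
apply: submodD => //; first by apply: submodZ => //; apply: hs; rewrite mem_head.
by apply: IH => // f fs; apply: hs; rewrite in_cons fs orbT.
Qed.

Lemma lspan_sub s t x : {subset s <= t} -> lspan s x -> lspan t x.
Proof.
move=> st; apply: lspan_min; first exact: lspan_submod.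
by move=> e /st/lspan_mem.
Qed.

Lemma lspan_catP s t x : lspan (s ++ t) x <-> exists y z, [/\ lspan s y, lspan t z & x = y + z].
Proof.
elim: s x => [|e s IH] x /=; split.
- by move=> tx; exists 0, x; rewrite add0r.
- by move=> [y [z [-> tz ->]]]; rewrite add0r.
- move=> [r [y [/IH[u [v [su tv ->]]] ->]]]; exists (r *: e + u), v; split=> //.
    by exists r, u.
  by rewrite addrA.
- move=> [y [z [[r [u [su ->]]] tz ->]]]; exists r, (u + z); split.
    by apply/IH; exists u, z.
  by rewrite addrA.
Qed.

Lemma lspan_ordP s x :
  lspan s x <-> exists c : 'I_(size s) -> B, x = \sum_i c i *: s`_i.
Proof.
split; last first.
  move=> [c ->]; apply: submod_sum; first exact: lspan_submod.
  by move=> i _; apply: submodZ (lspan_submod s) _; apply/lspan_mem; exact: mem_nth.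
elim: s x => [|e s IH] x /= => [->|[r [y [/IH[c ->] ->]]]].
  by exists (fun _ => 0); rewrite big_ord0.
exists (fun i => if unlift ord0 i is Some j then c j else r).
rewrite big_ord_recl unlift_none /=; congr (_ + _); apply: eq_bigr => i _.
by rewrite liftK.
Qed.

Definition spanned N := exists s, forall x, N x <-> lspan s x.
Definition noetherian_module := forall N, is_submod N -> spanned N.
End Submodules.

Lemma finitely_generatedP (B : pzRingType) (V : lmodType B) :
  finitely_generated V <-> exists s : seq V, forall x, lspan s x.
Proof.
split=> [[n [e he]]|[s hs]].
  exists [seq e i | i <- enum 'I_n] => x; have [c ->] := he x.
  apply: submod_sum => [|i _]; first exact: lspan_submod.
  apply: submodZ; first exact: lspan_submod.
  by apply: lspan_mem; apply: map_f; rewrite mem_enum.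
exists (size s), (fun i => s`_i) => x.
by have /lspan_ordP := hs x.
Qed.

Definition lin (B : pzRingType) (V W : lmodType B) (f : V -> W) (hf : linear f) :
  {linear V -> W} :=
  HB.pack f (GRing.isLinear.Build B V W *:%R f hf).

Section SubQuotient.
Variables (B : pzRingType) (V : lmodType B) (N : V -> Prop).
Hypothesis hN : is_submod N.

Let inN : {pred V} := [pred x | `[< N x >]].

Fact inN_closed : GRing.submod_closed inN.
Proof.
split; first by apply/asboolP; exact: submod0.
move=> a x y /asboolP Nx /asboolP Ny; apply/asboolP.
exact: (proj2 hN).
Qed.

HB.instance Definition _ := GRing.isSubmodClosed.Build B V inN inN_closed.

Record submodule_type := SubmoduleType { submodule_val : V; _ : submodule_val \in inN }.
HB.instance Definition _ := [isSub for submodule_val].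
HB.instance Definition _ := [Choice of submodule_type by <:].
HB.instance Definition _ := [SubChoice_isSubZmodule of submodule_type by <:].
HB.instance Definition _ := [SubZmodule_isSubLmodule of submodule_type by <:].

Lemma sub_module_exists : exists (K : lmodType B) (f : {linear K -> V}),
  injective f /\ forall v, N v <-> exists k, f k = v.
Proof.
have hl : linear submodule_val by [].
exists (submodule_type : lmodType B), (lin hl); split; first exact: val_inj.
move=> v; split=> [Nv|[k <-]].
  by have h : v \in inN by [apply/asboolP]; exists (SubmoduleType h).
  by case: k => x hx; apply/asboolP.
Qed.

Let qeq (x y : V) : bool := `[< N (x - y) >].
Fact qeq_refl : reflexive qeq.
Proof. by move=> x; apply/asboolP; rewrite subrr; exact: submod0. Qed.
Fact qeq_sym : symmetric qeq.
Proof. by move=> x y; apply/asboolP/asboolP => /(submodN hN); rewrite opprB. Qed.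
Fact qeq_trans : transitive qeq.
Proof.
move=> y x z /asboolP h /asboolP h'; apply/asboolP.
by have := submodD hN h h'; rewrite addrA subrK.
Qed.
Canonical quotient_equiv := EquivRel qeq qeq_refl qeq_sym qeq_trans.

Definition quotient_module : Type := {eq_quot qeq}.
HB.instance Definition _ : EqQuotient _ qeq quotient_module :=
  EqQuotient.on quotient_module.
HB.instance Definition _ := Choice.on quotient_module.

Let pr (x : V) : quotient_module := \pi_quotient_module x.

Let prP x y : pr x = pr y <-> N (x - y).
Proof. by split=> [/eqmodP/asboolP//|h]; apply/eqmodP/asboolP. Qed.

Let qadd (x y : quotient_module) := pr (repr x + repr y).
Let qopp (x : quotient_module) := pr (- repr x).
Let qscale (a : B) (x : quotient_module) := pr (a *: repr x).

Let repr_pr x : N (repr (pr x) - x).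
Proof. by apply/prP; rewrite /pr reprK. Qed.

Let prD x y : qadd (pr x) (pr y) = pr (x + y).
Proof.
apply/prP; rewrite opprD addrACA.
by apply: submodD => //; exact: repr_pr.
Qed.
Let prN x : qopp (pr x) = pr (- x).
Proof. by apply/prP; rewrite -opprD; apply: submodN => //; exact: repr_pr. Qed.
Let prZ a x : qscale a (pr x) = pr (a *: x).
Proof. by apply/prP; rewrite -scalerBr; apply: submodZ => //; exact: repr_pr. Qed.

Let prE x : exists v, x = pr v.
Proof. by exists (repr x); rewrite /pr reprK. Qed.

Fact qaddA : associative qadd.
Proof.
move=> x y z; have [u ->] := prE x; have [v ->] := prE y; have [w ->] := prE z.
by rewrite !prD addrA.
Qed.
Fact qaddC : commutative qadd.
Proof. by move=> x y; have [u ->] := prE x; have [v ->] := prE y; rewrite !prD addrC. Qed.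
Fact qadd0 : left_id (pr 0) qadd.
Proof. by move=> x; have [u ->] := prE x; rewrite prD add0r. Qed.
Fact qaddN : left_inverse (pr 0) qopp qadd.
Proof. by move=> x; have [u ->] := prE x; rewrite prN prD addNr. Qed.
HB.instance Definition _ :=
  GRing.isZmodule.Build quotient_module qaddA qaddC qadd0 qaddN.

Let prDE x y : pr x + pr y = pr (x + y). Proof. exact: prD. Qed.

Fact qscaleA a b x : qscale a (qscale b x) = qscale (a * b) x.
Proof. by have [u ->] := prE x; rewrite !prZ scalerA. Qed.
Fact qscale1 : left_id 1 qscale.
Proof. by move=> x; have [u ->] := prE x; rewrite prZ scale1r. Qed.
Fact qscaleDr : right_distributive qscale +%R.
Proof.
move=> a x y; have [u ->] := prE x; have [v ->] := prE y.
by rewrite prDE !prZ prDE scalerDr.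
Qed.
Fact qscaleDl x : {morph qscale^~ x : a b / a + b}.
Proof.
move=> a b; have [u ->] := prE x.
by rewrite !prZ prDE scalerDl.
Qed.
HB.instance Definition _ := GRing.Zmodule_isLmodule.Build B quotient_module
  qscaleA qscale1 qscaleDr qscaleDl.

Lemma quotient_module_exists : exists (Q : lmodType B) (g : {linear V -> Q}),
  surj g /\ forall v, g v = 0 <-> N v.
Proof.
have hl : linear pr by move=> a x y; rewrite /GRing.scale /= prZ prDE.
exists (quotient_module : lmodType B), (lin hl); split.
  by move=> x; have [v ->] := prE x; exists v.
by move=> v; rewrite -[in X in _ <-> X](subr0 v); exact: prP.
Qed.
End SubQuotient.

(** * Projective dimension away from a multiplicative set *)

Section ExactSequences.
Variable B : pzRingType.
Implicit Types K L P V X : lmodType B.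

Lemma kernel_exists V X (g : {linear V -> X}) :
  exists (K : lmodType B) (f : {linear K -> V}), injective f /\ exact_at f g.
Proof.
have h : is_submod (fun v => g v = 0).
  by split=> [|a x y gx gy]; rewrite ?linear0 // linearP gx gy scaler0 addr0.
by have [K [f [fi fe]]] := sub_module_exists h; exists K, f.
Qed.

Lemma factor_surj V L X (g : {linear V -> L}) (k : {linear V -> X}) :
  surj g -> (forall v, g v = 0 -> k v = 0) ->
  exists k' : {linear L -> X}, forall v, k' (g v) = k v.
Proof.
move=> gs gk; have [u gu] := choice gs.
have kE v : k (u (g v)) = k v.
  by apply/eqP; rewrite -subr_eq0 -linearB; apply/eqP/gk; rewrite linearB gu subrr.
have hl : linear (fun x => k (u x)).
  move=> a x y; rewrite -linearP /=; apply/eqP; rewrite -subr_eq0 -linearB.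
  by apply/eqP/gk; rewrite linearB linearP !gu subrr.
by exists (lin hl).
Qed.

Lemma factor_inj K V X (f : {linear K -> V}) (k : {linear X -> V}) :
  injective f -> (forall x, exists y, f y = k x) ->
  exists k' : {linear X -> K}, forall x, f (k' x) = k x.
Proof.
move=> fi /choice[u fu].
have hl : linear u by move=> a x y; apply: fi; rewrite linearP !fu linearP.
by exists (lin hl).
Qed.

Definition short_exact K V L (f : {linear K -> V}) (g : {linear V -> L}) :=
  [/\ injective f, surj g & exact_at f g].

Lemma short_exact0 K V L (f : {linear K -> V}) (g : {linear V -> L}) x :
  short_exact f g -> g (f x) = 0.
Proof. by move=> [_ _ fg]; apply/fg; exists x. Qed.

Lemma submod_short_exact V (N : V -> Prop) : is_submod N ->
  exists (K L : lmodType B) (f : {linear K -> V}) (g : {linear V -> L}),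
    short_exact f g /\ forall v, N v <-> g v = 0.
Proof.
move=> hN; have [K [f [fi fe]]] := sub_module_exists hN.
have [L [g [gs ge]]] := quotient_module_exists hN.
exists K, L, f, g; split; last by move=> v; split=> /ge.
by split=> // v; split=> [/ge/fe|/fe/ge].
Qed.

Lemma surj_short_exact V L (g : {linear V -> L}) : surj g ->
  exists (K : lmodType B) (f : {linear K -> V}), short_exact f g.
Proof. by move=> gs; have [K [f [fi fe]]] := kernel_exists g; exists K, f. Qed.

(* [scaled_projective s P]: multiplication by [s] on [P] factors through a
   projective module; for central [s], this means that [s] kills Ext^1(P, -). *)
Definition scaled_projective (s : B) P : Prop :=
  forall (M N : lmodType B) (g : {linear M -> N}) (f : {linear P -> N}),
    surj g -> exists h : {linear P -> M}, forall x, g (h x) = s *: f x.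

Lemma projective_scaled P : projective_module P <-> scaled_projective 1 P.
Proof.
split=> hP M N g f gs; have [h gh] := hP M N g f gs; exists h => x.
  by rewrite gh scale1r.
by rewrite gh scale1r.
Qed.

Lemma scaled_projective_retract s t X P (f : {linear X -> P}) (g : {linear P -> X}) :
  (forall x, g (f x) = t *: x) -> scaled_projective s P ->
  scaled_projective (s * t) X.
Proof.
move=> gf hP M N c k cs; have [h ch] := hP M N c (k \o g) cs.
by exists (h \o f) => x /=; rewrite ch /= gf linearZ scalerA.
Qed.

Lemma projective_retract X P (f : {linear X -> P}) (g : {linear P -> X}) :
  (forall x, g (f x) = x) -> projective_module P -> projective_module X.
Proof.
move=> gf /projective_scaled hP; apply/projective_scaled.
rewrite -[1]mulr1; apply: (scaled_projective_retract (f := f) (g := g)) => // x.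
by rewrite scale1r.
Qed.

Lemma projective_prod P P' :
  projective_module P -> projective_module P' -> projective_module (P * P')%type.
Proof.
move=> hP hP' M N g f gs.
have l1 : linear (fun x : P => (x, 0) : P * P').
  by move=> a x y; congr (_, _); rewrite /= scaler0 addr0.
have l2 : linear (fun x : P' => (0, x) : P * P').
  by move=> a x y; congr (_, _); rewrite /= scaler0 addr0.
have [h1 gh1] := hP M N g (f \o lin l1) gs.
have [h2 gh2] := hP' M N g (f \o lin l2) gs.
have l3 : linear (fun x : P * P' => h1 x.1 + h2 x.2).
  by move=> a x y; rewrite !linearP /= ?linearP scalerDr addrACA.
exists (lin l3) => x /=; rewrite linearD gh1 gh2 /= -linearD; congr (f _).
by case: x => x y; congr (_, _); rewrite /= ?addr0 ?add0r.
Qed.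

Lemma projective0 P : (forall x : P, x = 0) -> projective_module P.
Proof.
move=> P0 M N g f gs.
have hl : linear (fun _ : P => 0 : M) by move=> a x y; rewrite scaler0 addr0.
by exists (lin hl) => x /=; rewrite linear0 (P0 x) linear0.
Qed.

Definition free_module (n : nat) : lmodType B := {ffun 'I_n -> B^o}.

Lemma free_module_lift n L (e : 'I_n -> L) :
  exists f : {linear free_module n -> L}, forall c, f c = \sum_i (c i : B) *: e i.
Proof.
have hl : linear (fun c : free_module n => \sum_i (c i : B) *: e i).
  move=> a x y; rewrite scaler_sumr -big_split /=; apply: eq_bigr => i _.
  by rewrite !ffunE scalerDl scalerA.
by exists (lin hl).
Qed.

Lemma free_module_projective n : projective_module (free_module n).
Proof.
move=> M N g f gs.
pose d i : free_module n := [ffun j => (i == j)%:R].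
have [u gu] := choice gs.
have [h hE] := free_module_lift (fun i => u (f (d i))).
exists h => x; rewrite hE linear_sum.
transitivity (f (\sum_i (x i : B) *: d i)).
  by rewrite linear_sum; apply: eq_bigr => i _; rewrite !linearZ /= gu.
congr (f _); apply/ffunP => j; rewrite sum_ffunE (bigD1 j) //= !ffunE eqxx.
rewrite big1 => [|i ij]; last by rewrite !ffunE (negPf ij) scaler0.
by rewrite addr0 /GRing.scale /= mulr1.
Qed.
End ExactSequences.

Section LocalProjectiveDimension.
Variables (B : pzRingType) (W : B -> Prop).
Hypotheses (W1 : W 1) (WM : forall s t, W s -> W t -> W (s * t)).
Hypothesis WC : forall s, W s -> forall b, s * b = b * s.
Implicit Types K L P V X : lmodType B.

Lemma scale_linear s V : W s -> linear (fun x : V => s *: x).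
Proof. by move=> /WC sC a x y; rewrite scalerDr !scalerA sC. Qed.

Definition locally_projective L := exists2 s, W s & scaled_projective s L.

Lemma projective_locally P : projective_module P -> locally_projective P.
Proof. by move=> /projective_scaled; exists 1. Qed.

Lemma scaled_projective_extension s t K V L (f : {linear K -> V}) (g : {linear V -> L}) :
  short_exact f g -> W s -> W t -> scaled_projective s K -> scaled_projective t L ->
  scaled_projective (s * t * t) V.
Proof.
move=> fg Ws Wt hK hL M N c k cs; have [fi gs fge] := fg.
have [h gh] := hL V L g idfun gs.
have l1 : linear (fun x => t *: x - h (g x)).
  by move=> a x y; rewrite (scale_linear Wt) !linearP scalerDr addrACA.
have [r fr] : exists r : {linear V -> K}, forall x, f (r x) = lin l1 x.
  apply: factor_inj => // x; apply/fge.
  by rewrite /= linearB linearZ gh subrr.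
have [k1 ck1] := hK M N c (k \o f) cs.
have [k2 ck2] := hL M N c (k \o h) cs.
have l2 : linear (fun x => t *: k1 (r x) + s *: k2 (g x)).
  move=> a x y.
  by rewrite !linearP (scale_linear Wt) (scale_linear Ws) scalerDr addrACA.
exists (lin l2) => x; rewrite /= linearD !linearZ /= ck1 ck2 /= fr /=.
rewrite linearB linearZ /= scalerA [t * s]WC // scalerBr !scalerA.
by rewrite subrK.
Qed.

(* For [W] the image of the complement of a prime, this is projective dimension
   after localization, expressed without forming any localized module. *)
Fixpoint local_pd n L : Prop :=
  if n is n'.+1 then
    exists (K P : lmodType B) (f : {linear K -> P}) (g : {linear P -> L}),
      [/\ short_exact f g, projective_module P & local_pd n' K]
  else locally_projective L.

Lemma local_pd_projective n P : projective_module P -> local_pd n P.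
Proof.
elim: n P => [|n IH] P hP /=; first exact: projective_locally.
have [K [f fg]] := @surj_short_exact B P P idfun (fun y => ex_intro _ y erefl).
exists K, P, f, idfun; split=> //; apply: IH; apply: projective0 => x.
by have [fi _ _] := fg; apply: fi; rewrite linear0; apply: short_exact0 fg.
Qed.

Lemma local_pd_extension n K V L (f : {linear K -> V}) (g : {linear V -> L}) :
  short_exact f g -> local_pd n K -> local_pd n L -> local_pd n V.
Proof.
elim: n K V L f g => [|n IH] K V L f g fg /=.
  move=> [s Ws hs] [t Wt ht]; exists (s * t * t); first by do !apply: WM.
  exact: scaled_projective_extension fg Ws Wt hs ht.
move=> [K1 [P1 [k1 [e1 [ex1 hP1 hK1]]]]] [K2 [P2 [k2 [e2 [ex2 hP2 hK2]]]]].
have [fi gs fge] := fg; have [l gl] := hP2 V L g e2 gs.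
have [k1i e1s ke1] := ex1; have [k2i e2s ke2] := ex2.
have le : linear (fun p : P1 * P2 => f (e1 p.1) + l p.2).
  by move=> a x y; rewrite !linearP /= ?linearP scalerDr addrACA.
have es : surj (lin le).
  move=> y; have [q eq2] := e2s (g y).
  have /fge[x fx] : g (y - l q) = 0 by rewrite linearB gl eq2 subrr.
  by have [p ep] := e1s x; exists (p, q); rewrite /= ep fx subrK.
have [K3 [k3 ex3]] := surj_short_exact es; have [k3i _ ke3] := ex3.
exists K3, (P1 * P2)%type, k3, (lin le); split=> //; first exact: projective_prod.
have lu : linear (fun x => (k1 x, 0) : P1 * P2).
  by move=> a x y; rewrite linearP; congr (_, _); rewrite /= scaler0 addr0.
have [u ku] : exists u : {linear K1 -> K3}, forall x, k3 (u x) = lin lu x.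
  apply: factor_inj => // x; apply/ke3; rewrite /= (short_exact0 x ex1).
  by rewrite !linear0 addr0.
have [v kv] : exists v : {linear K3 -> K2}, forall x, k2 (v x) = (snd \o k3) x.
  apply: factor_inj => // x; apply/ke2 => /=.
  have : lin le (k3 x) = 0 by apply/ke3; exists x.
  move=> /= /(congr1 g); rewrite linearD linear0 (short_exact0 _ fg) add0r gl.
  by [].
apply: (IH K1 K3 K2 u v) => //; split.
- by move=> x y /(congr1 k3); rewrite !ku => -[/k1i].
- move=> z; have /fge[x fx] : g (l (k2 z)) = 0.
    by rewrite gl (short_exact0 z ex2).
  have [p ep] := e1s x.
  have /ke3[y ky] : lin le (- p, k2 z) = 0.
    by rewrite /= linearN ep linearN fx addNr.
  by exists y; apply: k2i; rewrite kv /= ky.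
- move=> y; split=> [vy|[x <-]]; last first.
    by apply: k2i; rewrite kv /= ku linear0.
  have ky2 : (k3 y).2 = 0 by have := kv y; rewrite vy linear0.
  have : lin le (k3 y) = 0 by apply/ke3; exists y.
  rewrite /= ky2 linear0 addr0 -(linear0 f) => /fi /ke1[x kx].
  by exists x; apply: k3i; rewrite ku /= kx -ky2 -surjective_pairing.
Qed.

Lemma local_pd_split n X V P (f : {linear X -> V}) (g : {linear V -> P}) :
  short_exact f g -> projective_module P -> local_pd n V -> local_pd n X.
Proof.
move=> [fi gs fge] hP; have [h gh] := hP V P g idfun gs.
have l1 : linear (fun x => x - h (g x)).
  by move=> a x y; rewrite !linearP scalerDr addrACA.
have [r fr] : exists r : {linear V -> X}, forall x, f (r x) = lin l1 x.
  by apply: factor_inj => // x; apply/fge; rewrite /= linearB gh subrr.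
have rf x : r (f x) = x.
  apply: fi; rewrite fr /=.
  have -> : g (f x) = 0 by apply/fge; exists x.
  by rewrite linear0 subr0.
case: n => [|n] /=.
  move=> [s Ws hs]; exists s => //; rewrite -[s]mulr1.
  by apply: (scaled_projective_retract (f := f) (g := r)) hs => x; rewrite rf scale1r.
move=> [K1 [P1 [k1 [e1 [ex1 hP1 hK1]]]]]; have [k1i e1s ke1] := ex1.
have [P2 [i [ii ie]]] := kernel_exists (g \o e1).
have ge1s : surj (g \o e1).
  by move=> y; have [x <-] := gs y; have [z <-] := e1s x; exists z.
have [h' gh'] := hP P1 P (g \o e1) idfun ge1s.
have l2 : linear (fun x => x - h' (g (e1 x))).
  by move=> a x y; rewrite !linearP scalerDr addrACA.
have [r' ir'] : exists r' : {linear P1 -> P2}, forall x, i (r' x) = lin l2 x.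
  by apply: factor_inj => // x; apply/ie; rewrite linearB gh' subrr.
have hP2 : projective_module P2.
  apply: (projective_retract (f := i) (g := r')) hP1 => x.
  apply: ii; rewrite ir' /=.
  have /= -> : (g \o e1) (i x) = 0 by apply/ie; exists x.
  by rewrite linear0 subr0.
have [e2 fe2] : exists e2 : {linear P2 -> X}, forall x, f (e2 x) = (e1 \o i) x.
  by apply: factor_inj => // x; apply/fge; have := (ie (i x)).2; apply; exists x.
have [k2 ik2] : exists k2 : {linear K1 -> P2}, forall x, i (k2 x) = k1 x.
  by apply: factor_inj => // x; apply/ie; rewrite /= (short_exact0 x ex1) linear0.
exists K1, P2, k2, e2; split=> //; split.
- by move=> x y /(congr1 i); rewrite !ik2 => /k1i.
- move=> x; have [p ep] := e1s (f x).
  have /ie[q iq] : (g \o e1) p = 0 by rewrite /= ep; apply/fge; exists x.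
  by exists q; apply: fi; rewrite fe2 /= iq.
- move=> y; split=> [ey|[x <-]].
    have /ke1[x kx] : e1 (i y) = 0 by rewrite -[e1 _]fe2 ey linear0.
    by exists x; apply: ii; rewrite ik2.
  by apply: fi; rewrite fe2 /= ik2 (short_exact0 x ex1) linear0.
Qed.

Lemma local_pd_sub n K V L (f : {linear K -> V}) (g : {linear V -> L}) :
  short_exact f g -> local_pd n V -> local_pd n.+1 L -> local_pd n K.
Proof.
move=> fg hV [K1 [P1 [k1 [e1 [ex1 hP1 hK1]]]]].
have [fi gs fge] := fg; have [k1i e1s ke1] := ex1.
have ld : linear (fun p : V * P1 => g p.1 - e1 p.2).
  by move=> a x y; rewrite !linearP /= ?linearP scalerDr addrACA.
have [E [i [ii ie]]] := kernel_exists (lin ld).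
have iE y : g (i y).1 = e1 (i y).2.
  by apply/eqP; rewrite -subr_eq0; apply/eqP/ie; exists y.
have l1 : linear (fun x => (0, k1 x) : V * P1).
  by move=> a x y; rewrite linearP; congr (_, _); rewrite /= scaler0 addr0.
have l2 : linear (fun x => (f x, 0) : V * P1).
  by move=> a x y; rewrite linearP; congr (_, _); rewrite /= scaler0 addr0.
have [u iu] : exists u : {linear K1 -> E}, forall x, i (u x) = lin l1 x.
  by apply: factor_inj => // x; apply/ie; rewrite /= (short_exact0 x ex1) linear0 subr0.
have [v iv] : exists v : {linear K -> E}, forall x, i (v x) = lin l2 x.
  by apply: factor_inj => // x; apply/ie; rewrite /= (short_exact0 x fg) linear0 subr0.
have exu : short_exact u (fst \o i).
  split.
  - by move=> x y /(congr1 i); rewrite !iu => -[/k1i].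
  - move=> x; have [p ep] := e1s (g x).
    have /ie[y iy] : lin ld (x, p) = 0 by rewrite /= ep subrr.
    by exists y; rewrite /= iy.
  - move=> y; split=> [/= y1|[x <-]]; last by rewrite /= iu.
    have /ke1[x kx] : e1 (i y).2 = 0 by rewrite -iE y1 linear0.
    by exists x; apply: ii; rewrite iu /= kx -y1 -surjective_pairing.
have exv : short_exact v (snd \o i).
  split.
  - by move=> x y /(congr1 i); rewrite !iv => -[/fi].
  - move=> p; have [x ex] := gs (e1 p).
    have /ie[y iy] : lin ld (x, p) = 0 by rewrite /= ex subrr.
    by exists y; rewrite /= iy.
  - move=> y; split=> [/= y2|[x <-]]; last by rewrite /= iv.
    have /fge[x fx] : g (i y).1 = 0 by rewrite iE y2 linear0.
    by exists x; apply: ii; rewrite iv /= fx -y2 -surjective_pairing.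
apply: local_pd_split exv hP1 _.
exact: local_pd_extension exu hK1 hV.
Qed.

Lemma local_pd_quotient n K V L (f : {linear K -> V}) (g : {linear V -> L}) :
  short_exact f g -> local_pd n K -> local_pd n.+1 V -> local_pd n.+1 L.
Proof.
move=> fg hK [K1 [P1 [k1 [e1 [ex1 hP1 hK1]]]]].
have [fi gs fge] := fg; have [k1i e1s ke1] := ex1.
have es : surj (g \o e1).
  by move=> y; have [x <-] := gs y; have [z <-] := e1s x; exists z.
have [K2 [k2 ex2]] := surj_short_exact es; have [k2i _ ke2] := ex2.
exists K2, P1, k2, (g \o e1); split=> //.
have [u ku] : exists u : {linear K1 -> K2}, forall x, k2 (u x) = k1 x.
  by apply: factor_inj => // x; apply/ke2; rewrite /= (short_exact0 x ex1) linear0.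
have [v fv] : exists v : {linear K2 -> K}, forall x, f (v x) = (e1 \o k2) x.
  by apply: factor_inj => // x; apply/fge; have := (ke2 (k2 x)).2; apply; exists x.
apply: (local_pd_extension (f := u) (g := v)) => //; split.
- by move=> x y /(congr1 k2); rewrite !ku => /k1i.
- move=> x; have [p ep] := e1s (f x).
  have /ke2[q kq] : (g \o e1) p = 0 by rewrite /= ep (short_exact0 x fg).
  by exists q; apply: fi; rewrite fv /= kq.
- move=> y; split=> [vy|[x <-]].
    have /ke1[x kx] : e1 (k2 y) = 0 by rewrite -[e1 _]fv vy linear0.
    by exists x; apply: k2i; rewrite ku.
  by apply: fi; rewrite fv /= ku (short_exact0 x ex1) linear0.
Qed.

Lemma local_pd_syzygy n K P L (f : {linear K -> P}) (g : {linear P -> L}) :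
  short_exact f g -> projective_module P -> local_pd n.+1 L -> local_pd n K.
Proof. by move=> fg hP; apply: local_pd_sub fg _; apply: local_pd_projective. Qed.

Lemma scaled_projective_syzygy s K P L (f : {linear K -> P}) (g : {linear P -> L}) :
  short_exact f g -> projective_module P -> (forall b, s * b = b * s) ->
  scaled_projective s L -> scaled_projective s K.
Proof.
move=> fg /projective_scaled hP sC hL; have [fi gs fge] := fg.
have [h gh] := hL P L g idfun gs.
have l1 : linear (fun x => s *: x - h (g x)).
  move=> a x y.
  by rewrite !linearP (scalerDr s) scalerA sC -scalerA scalerDr addrACA.
have [r fr] : exists r : {linear P -> K}, forall x, f (r x) = lin l1 x.
  by apply: factor_inj => // x; apply/fge; rewrite /= linearB linearZ gh subrr.
rewrite -[s]mul1r; apply: (scaled_projective_retract (f := f) (g := r)) hP => x.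
by apply: fi; rewrite fr /= (short_exact0 x fg) linear0 subr0 linearZ.
Qed.
End LocalProjectiveDimension.

Lemma local_pd_sub_set (B : pzRingType) (W W' : B -> Prop) n (L : lmodType B) :
  (forall s, W s -> W' s) -> local_pd W n L -> local_pd W' n L.
Proof.
move=> WW; elim: n L => [|n IH] L /=; first by move=> [s /WW Ws hs]; exists s.
by move=> [K [P [f [g [fg hP hK]]]]]; exists K, P, f, g; split=> //; apply: IH.
Qed.

(** * Noetherian modules, associated primes and the Nakayama lemma *)

Section NoetherianModules.
Variables (B : pzRingType) (V : lmodType B).

Lemma noetherian_module_max (F : (V -> Prop) -> Prop) :
  noetherian_module V -> (exists N, F N) -> (forall N, F N -> is_submod N) ->
  exists2 N, F N & forall N', F N' -> (forall x, N x -> N' x) -> forall x, N' x -> N x.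
Proof.
move=> hV [N0 F0] hF; apply: contrapT => hno.
have step (N : {N | F N}) : exists N' : {N | F N},
    (forall x, sval N x -> sval N' x) /\ exists2 x, sval N' x & ~ sval N x.
  case: N => N FN /=; apply: contrapT => h; apply: hno; exists N => // N' FN' NN' x N'x.
  apply: contrapT => Nx; apply: h; exists (exist _ N' FN'); split=> //=.
  by exists x.
have [f hf] := choice step.
pose N k := iter k f (exist _ N0 F0).
have NS k x : sval (N k) x -> sval (N k.+1) x by case: (hf (N k)) => h _; exact: h.
have Nle k l x : (k <= l)%N -> sval (N k) x -> sval (N l) x.
  by move=> /subnK <-; elim: (l - k)%N => //= j IH /IH; exact: NS.
have hU : is_submod (fun x => exists k, sval (N k) x).
  split; first by exists 0%N; exact: submod0 (hF _ F0).
  move=> a x y [k Nx] [l Ny]; exists (maxn k l).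
  apply: (proj2 (hF _ (svalP (N (maxn k l))))).
    exact: Nle (leq_maxl k l) Nx.
  exact: Nle (leq_maxr k l) Ny.
have [s hs] := hV _ hU.
have [k hk] : exists k, forall e, e \in s -> sval (N k) e.
  have : forall e, e \in s -> exists k, sval (N k) e.
    by move=> e /lspan_mem/hs.
  elim: {hs} s => [|e s IH] h; first by exists 0.
  have [k hk] := IH (fun e' h' => h e' (mem_behead (s := e :: s) h')).
  have [l hl] := h e (mem_head _ _); exists (maxn k l) => e'.
  rewrite in_cons => /orP[/eqP ->|/hk]; first exact: Nle (leq_maxr k l) hl.
  exact: Nle (leq_maxl k l).
have [_ [x Nx nNx]] := hf (N k); apply: nNx.
apply: (lspan_min _ hk); first exact: hF (svalP _).
by apply/hs; exists k.+1.
Qed.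
End NoetherianModules.

Lemma left_noetherianP (B : pzRingType) :
  left_noetherian B -> noetherian_module (B^o : lmodType B).
Proof.
move=> hB N hN; apply: contrapT => hno.
have step (s : {s : seq B^o | forall x, x \in s -> N x}) :
    exists x, N x /\ ~ lspan (sval s) x.
  case: s => s hs /=; apply: contrapT => h; apply: hno; exists s => x; split.
    by move=> Nx; apply: contrapT => nx; apply: h; exists x.
  exact: lspan_min.
have [f hf] := choice step.
have hcons (s : {s : seq B^o | forall x, x \in s -> N x}) :
    forall x, x \in f s :: sval s -> N x.
  by move=> x; rewrite in_cons => /orP[/eqP ->|/(svalP s)//]; case: (hf s).
have s0 : {s : seq B^o | forall x, x \in s -> N x} by exists [::].
pose s k := iter k (fun s => exist _ (f s :: sval s) (hcons s)) s0.
have [||n hn] := hB (fun k => [pred x | `[< lspan (sval (s k)) x >]]).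
- move=> i; split; first by apply/asboolP; exact: submod0 (lspan_submod _).
  move=> a x y /asboolP hx /asboolP hy; apply/asboolP.
  exact: (proj2 (lspan_submod _)).
- move=> i x /asboolP hx; apply/asboolP; exists 0, x.
  by rewrite scale0r add0r.
have [_] := hf (s n); apply.
suff /asboolP : f (s n) \in [pred x | `[< lspan (sval (s n)) x >]] by [].
rewrite -(hn n.+1) //; apply/asboolP; apply: lspan_mem.
exact: mem_head.
Qed.

Section FinitelyGenerated.
Variables (R : comNzRingType).
Hypothesis noeR : noetherian_module (R^o : lmodType R).
Variable V : lmodType R.
Implicit Types N : V -> Prop.

Lemma spanned_submod_noetherian (s : seq V) N :
  is_submod N -> (forall x, N x -> lspan s x) -> spanned N.
Proof.
elim: s N => [|e s IH] N hN Ns.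
  exists [::] => x; split=> [/Ns//|->]; exact: submod0.
have hI : is_submod (fun r : R^o => exists2 y, lspan s y & N (r *: e + y)).
  split.
    exists 0; first by exact: submod0 (lspan_submod _).
    by rewrite scale0r addr0; apply: submod0.
  move=> a r r' [y sy Ny] [z sz Nz]; exists (a *: y + z).
    by apply: (proj2 (lspan_submod s)).
  have -> : (a *: r + r') *: e + (a *: y + z) = a *: ((r : R) *: e + y) + ((r' : R) *: e + z).
    by rewrite scalerDl scalerDr scalerA addrACA.
  exact: (proj2 hN).
have [t ht] := noeR hI.
have hN' : is_submod (fun x => N x /\ lspan s x).
  split; first by split; [exact: submod0 hN|exact: submod0 (lspan_submod _)].
  move=> a x y [Nx sx] [Ny sy]; split; first exact: (proj2 hN).
  exact: (proj2 (lspan_submod s)).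
have [|u hu] := IH _ hN'; first by move=> x [].
have hy (r : R) : exists y, lspan t r -> lspan s y /\ N (r *: e + y).
  case: (pselect (lspan t (r : R^o))) => [/ht[y sy Ny]|h]; last by exists 0.
  by exists y.
have [y hy'] := choice hy.
pose g := [seq (r : R) *: e + y r | r <- t].
have gP r : r \in t -> lspan s (y r) /\ N (r *: e + y r).
  by move=> rt; apply: hy'; exact: lspan_mem.
have gN w : lspan g w -> N w.
  by apply: lspan_min => // w' /mapP[r /gP[_ h] ->].
exists (g ++ u) => x; split; last first.
  move=> /lspan_catP[w [z [/gN Nw /hu[Nz _] ->]]]; exact: submodD.
move=> Nx; have [r [z [sz xE]]] := Ns x Nx.
have [w gw [w' sw' wE]] : exists2 w, lspan g w & exists2 w', lspan s w' & w = r *: e + w'.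
  have : lspan t (r : R^o) by apply/ht; exists z => //; rewrite -xE.
  apply: (lspan_min (N := fun r : R^o => exists2 w, lspan g w &
      exists2 w', lspan s w' & w = (r : R) *: e + w')).
    split.
      exists 0; first exact: submod0 (lspan_submod _).
      by exists 0; rewrite ?scale0r ?addr0 //; exact: submod0 (lspan_submod _).
    move=> a r1 r2 [w1 gw1 [w1' sw1 w1E]] [w2 gw2 [w2' sw2 w2E]].
    exists (a *: w1 + w2); first exact: (proj2 (lspan_submod _)).
    exists (a *: w1' + w2'); first exact: (proj2 (lspan_submod _)).
    by rewrite w1E w2E scalerDl !scalerDr scalerA addrACA.
  move=> a ta; have [say Nay] := gP a ta.
  exists (a *: e + y a); first by apply/lspan_mem/map_f.
  by exists (y a).
apply/lspan_catP; exists w, (x - w); split; rewrite ?[w + _]addrC ?subrK //.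
apply/hu; split; first by apply: submodB => //; exact: gN.
rewrite xE wE opprD addrACA subrr add0r.
by apply: submodB => //; exact: lspan_submod.
Qed.

Lemma finitely_generated_noetherian : finitely_generated V -> noetherian_module V.
Proof.
by move=> /finitely_generatedP[s hs] N hN; apply: (spanned_submod_noetherian hN).
Qed.
End FinitelyGenerated.

Section CommutativeAlgebra.
Variable R : comNzRingType.
Implicit Types (I P W : R -> Prop) (V : lmodType R).

Definition mult_set W := W 1 /\ forall s t, W s -> W t -> W (s * t).
Definition is_ideal I := is_submod (I : R^o -> Prop).
Definition is_prime P :=
  [/\ is_ideal P, ~ P 1 & forall a b, P (a * b) -> P a \/ P b].

Lemma ideal0 I : is_ideal I -> I 0. Proof. exact: submod0. Qed.
Lemma idealD I x y : is_ideal I -> I x -> I y -> I (x + y).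
Proof. exact: (@submodD _ (R^o : lmodType R)). Qed.
Lemma ideal_mull I a x : is_ideal I -> I x -> I (a * x).
Proof. exact: (@submodZ _ (R^o : lmodType R)). Qed.
Lemma ideal_mulr I a x : is_ideal I -> I x -> I (x * a).
Proof. by rewrite mulrC; exact: ideal_mull. Qed.
Lemma ideal_addl I x y : is_ideal I -> I x -> I (x + y) -> I y.
Proof. exact: (@submod_addl _ (R^o : lmodType R)). Qed.

Lemma principal_ideal x : is_ideal (fun y => exists r, y = r * x).
Proof.
split; first by exists 0; rewrite mul0r.
by move=> a _ _ [r ->] [r' ->]; exists (a * r + r'); rewrite mulrDl -mulrA.
Qed.

Lemma prime_mult_set P : is_prime P -> mult_set (fun x => ~ P x).
Proof. by move=> [_ P1 PM]; split=> // s t Ps Pt /PM[]. Qed.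

Lemma prime_exp P x n : is_prime P -> P (x ^+ n) -> P x.
Proof.
move=> [_ P1 PM]; elim: n => [|n IH]; first by rewrite expr0.
by rewrite exprS => /PM[].
Qed.

Lemma mult_set_common W V (s : seq V) (Q : R -> V -> Prop) : mult_set W ->
  (forall v a b, Q a v -> Q (a * b) v) ->
  (forall v, v \in s -> exists2 w, W w & Q w v) ->
  exists2 w, W w & forall v, v \in s -> Q w v.
Proof.
move=> [W1 WM] hQ; elim: s => [|v s IH] h; first by exists 1.
have [w Ww hw] := IH (fun u hu => h u (mem_behead (s := v :: s) hu)).
have [w' Ww' hw'] := h v (mem_head _ _).
exists (w' * w); first exact: WM.
move=> u; rewrite in_cons => /orP[/eqP ->|/hw]; first exact: hQ.
by rewrite mulrC; exact: hQ.
Qed.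

Lemma ann_ideal V (u : V) : is_ideal (fun a => a *: u = 0).
Proof.
split; first by rewrite scale0r.
by move=> a x y hx hy; rewrite scalerDl -scalerA hx hy scaler0 addr0.
Qed.

Lemma ann_submod V I : is_submod (fun v : V => forall a, I a -> a *: v = 0).
Proof.
split=> [a _|b x y hx hy a Ia]; first by rewrite scaler0.
by rewrite scalerDr scalerA mulrC -scalerA hx // hy // scaler0 addr0.
Qed.

Lemma submod_add V (N N' : V -> Prop) : is_submod N -> is_submod N' ->
  is_submod (fun v => exists2 u, N u & N' (v - u)).
Proof.
move=> hN hN'; split.
  by exists 0; [exact: submod0 hN|rewrite subr0; exact: submod0 hN'].
move=> b x y [u Nu Nxu] [v Nv Nyv]; exists (b *: u + v); first exact: (proj2 hN).
have -> : b *: x + y - (b *: u + v) = b *: (x - u) + (y - v).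
  by rewrite scalerBr opprD addrACA.
exact: (proj2 hN').
Qed.

Fixpoint ideal_span I V (J : V -> Prop) (s : seq V) (x : V) : Prop :=
  if s is e :: s' then exists r y, [/\ I r, ideal_span I J s' y & x = r *: e + y]
  else J x.

Lemma ideal_span_submod I V (J : V -> Prop) s :
  is_ideal I -> is_submod J -> is_submod (ideal_span I J s).
Proof.
move=> hI hJ; elim: s => [|e s [h0 h]] //=; split.
  exists 0, 0; split=> //; first exact: ideal0.
  by rewrite scale0r addr0.
move=> a x y [r [u [Ir su ->]]] [r' [u' [Ir' su' ->]]].
exists (a * r + r'), (a *: u + u'); split; [exact: (proj2 hI)|exact: h|].
by rewrite scalerDr scalerA addrACA -scalerDl.
Qed.

(* The generators are eliminated one at a time, instead of taking a determinant. *)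
Lemma nakayama W I V (J : V -> Prop) (s : seq V) :
  mult_set W -> is_ideal I -> is_submod J ->
  (forall w i, W w -> I i -> W (w - i)) ->
  (forall e, e \in s -> exists2 w, W w & ideal_span I J s (w *: e)) ->
  exists2 w, W w & forall e, e \in s -> J (w *: e).
Proof.
move=> mW hI hJ WI; have [W1 WM] := mW; elim: s => [|e s IH] hs; first by exists 1.
have hS := ideal_span_submod s hI hJ.
have [w0 Ww0 /= [r [y [Ir sy ey]]]] := hs e (mem_head _ _).
have Ww := WI _ _ Ww0 Ir; set w := w0 - r in Ww.
have we : ideal_span I J s (w *: e) by rewrite scalerBl ey addrAC subrr add0r.
have [f|w' Ww' hw'] := IH.
  move=> fs; have [w1 Ww1 /= [r1 [y1 [Ir1 sy1 ey1]]]] := hs f (mem_behead (s := e :: s) fs).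
  exists (w * w1); first exact: WM.
  rewrite -scalerA ey1 scalerDr scalerA mulrC -scalerA.
  by apply: submodD => //; apply: submodZ.
have hJs : forall x, ideal_span I J s x -> J (w' *: x).
  elim: (s) hw' => [|f t IHt] hw' x /=; first exact: submodZ.
  move=> [a [z [_ tz ->]]]; rewrite scalerDr scalerA mulrC -scalerA.
  apply: submodD => //; first by apply: submodZ => //; apply: hw'; rewrite mem_head.
  by apply: IHt tz => g gt; apply: hw'; rewrite in_cons gt orbT.
exists (w' * w); first exact: WM.
move=> f; rewrite in_cons => /orP[/eqP ->|fs].
  by rewrite -scalerA; exact: hJs.
by rewrite mulrC -scalerA; apply: submodZ => //; exact: hw'.
Qed.

Lemma monic_relation V (f : {linear V -> V}) : finitely_generated V ->
  exists n (r : nat -> R), forall v, iter n f v = \sum_(i < n) r i *: iter i f v.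
Proof.
move=> [n [e he]].
pose e' (i : 'I_n.+1) := if unlift ord0 i is Some j then e j else 0.
have he' x : exists c : 'I_n.+1 -> R, x = \sum_i c i *: e' i.
  have [c ->] := he x; exists (fun i => if unlift ord0 i is Some j then c j else 0).
  rewrite big_ord_recl /e' unlift_none scaler0 add0r; apply: eq_bigr => i _.
  by rewrite liftK.
have [c hc] := choice (fun i => he' (f (e' i))).
pose A : 'M[R]_n.+1 := \matrix_(i, j) c i j.
have iterD k (I : finType) (a : I -> R) (x : I -> V) :
    iter k f (\sum_i a i *: x i) = \sum_i a i *: iter k f (x i).
  elim: k a x => //= k IH a x; rewrite IH linear_sum.
  by apply: eq_bigr => i _; rewrite linearZ.
have iterA k i : iter k f (e' i) = \sum_j (A ^+ k) i j *: e' j.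
  elim: k i => [|k IH] i /=.
    rewrite (bigD1 i) //= big1 => [|j ij]; rewrite expr0 !mxE ?eqxx ?scale1r ?addr0 //.
    by rewrite eq_sym (negPf ij) scale0r.
  rewrite IH linear_sum /=.
  under eq_bigr => j _ do rewrite linearZ /= hc scaler_sumr.
  rewrite exchange_big /=; apply: eq_bigr => l _; rewrite exprSr mxE scaler_suml.
  by apply: eq_bigr => j _; rewrite scalerA !mxE.
pose p := char_poly A; have sp : size p = n.+2 by rewrite size_char_poly.
have mp : p`_n.+1 = 1.
  by have /monicP := char_poly_monic A; rewrite lead_coefE sp.
have rel i : \sum_(k < n.+2) p`_k *: iter k f (e' i) = 0.
  under eq_bigr => k _ do rewrite iterA scaler_sumr.
  rewrite exchange_big /= big1 // => j _.
  under eq_bigr => k _ do rewrite scalerA.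
  rewrite -scaler_suml.
  have := congr1 (fun M : 'M[R]_n.+1 => M i j) (Cayley_Hamilton A).
  rewrite -/p (_ : horner_mx A p = \sum_(k < n.+2) p`_k *: A ^+ k); last first.
    rewrite -[in LHS](coefK p) sp poly_def rmorph_sum /=.
    apply: eq_bigr => k _; rewrite -mul_polyC rmorphM rmorphXn /=.
    by rewrite horner_mx_C horner_mx_X -mulmxE mul_scalar_mx.
  rewrite summxE mxE => h; rewrite [X in X *: _](_ : _ = 0) ?scale0r // -[RHS]h.
  by apply: eq_bigr => k _; rewrite mxE.
exists n.+1, (fun k => - p`_k) => v.
have [a ->] := he' v; rewrite iterD.
under [RHS]eq_bigr => k _ do rewrite iterD scaler_sumr.
rewrite exchange_big /=; apply: eq_bigr => i _.
have := rel i; rewrite big_ord_recr /= mp scale1r => /eqP.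
rewrite addrC addr_eq0 => /eqP ->; rewrite -sumrN scaler_sumr.
by apply: eq_bigr => k _; rewrite scaleNr scalerN !scalerA mulrC.
Qed.
End CommutativeAlgebra.

Section AssociatedPrimes.
Variable R : comNzRingType.
Hypothesis noeR : noetherian_module (R^o : lmodType R).
Implicit Types (I P W : R -> Prop) (V : lmodType R).

Lemma maximal_ideal_exists I : is_ideal I -> ~ I 1 ->
  exists P, [/\ is_ideal P, ~ P 1, forall x, I x -> P x &
    forall J, is_ideal J -> ~ J 1 -> (forall x, P x -> J x) -> forall x, J x -> P x].
Proof.
move=> hI I1.
pose F (J : R^o -> Prop) := [/\ is_ideal J, ~ J 1 & forall x, I x -> J x].
have [||P [hP P1 IP] hmax] := @noetherian_module_max _ _ F noeR.
- by exists I.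
- by move=> N [].
exists P; split=> // J hJ J1 PJ; apply: hmax => //.
by split=> // x /IP/PJ.
Qed.

Lemma associated_prime W V (u : V) : mult_set W ->
  (forall w, W w -> w *: u <> 0) ->
  exists r, is_prime (fun a => a *: (r *: u) = 0) /\ forall w, W w -> w *: (r *: u) <> 0.
Proof.
move=> [W1 WM] hu.
pose ann (v : V) (a : R) := exists2 w, W w & w *: (a *: v) = 0.
have hann v : is_ideal (ann v).
  split; first by exists 1 => //; rewrite scale0r scaler0.
  move=> a x y [w Ww hw] [w' Ww' hw']; exists (w * w'); first exact: WM.
  rewrite scalerDl scalerDr.
  have -> : (w * w') *: ((a *: x : R^o) *: v) = (w' * a) *: (w *: (x *: v)).
    by rewrite !scalerA; congr (_ *: _); rewrite /GRing.scale /=; ring.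
  have -> : (w * w') *: (y *: v) = w *: (w' *: (y *: v)) by rewrite scalerA.
  by rewrite hw hw' !scaler0 addr0.
pose F (J : R^o -> Prop) :=
  exists r, (forall w, W w -> w *: (r *: u) <> 0) /\ J = ann (r *: u).
have [||P [r [hr PE]] hmax] := @noetherian_module_max _ _ F noeR.
- by exists (ann (1 *: u)), 1; split=> // w /hu; rewrite scale1r.
- by move=> N [r [_ ->]]; exact: hann.
pose v := r *: u.
have annP a b : ann v (a * b) -> ~ ann v b -> ann v a.
  move=> [w Ww hw] nb; rewrite /v -PE; apply: (hmax (ann (b *: v))).
  - exists (b * r); split=> [w' Ww' h|]; last by rewrite /v scalerA.
    by apply: nb; exists w' => //; rewrite [b *: v]scalerA.
  - rewrite PE => x [w' Ww' hw']; exists w' => //.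
    have -> : w' *: (x *: (b *: v)) = b *: (w' *: (x *: v)).
      by rewrite !scalerA; congr (_ *: _); ring.
    by rewrite hw' scaler0.
  - by exists w => //; rewrite [_ *: (b *: v)]scalerA.
have [s hs] := noeR (hann v).
have [||w Ww hw] := @mult_set_common _ W (R^o : lmodType R) s
    (fun w a => w *: ((a : R) *: v) = 0) (conj W1 WM) _ _.
- move=> a x b h; have -> : (x * b) *: ((a : R) *: v) = b *: (x *: ((a : R) *: v)).
    by rewrite !scalerA; congr (_ *: _); ring.
  by rewrite h scaler0.
- by move=> a /lspan_mem/hs[w Ww hw]; exists w.
have annE a : ann v a <-> a *: (w *: v) = 0.
  split=> [/hs|h]; last by exists w => //; rewrite scalerA mulrC -scalerA.
  have hK : is_submod (fun a : R^o => (a : R) *: (w *: v) = 0) := ann_ideal (w *: v).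
  apply: (lspan_min hK) => b bs; rewrite scalerA mulrC -scalerA; exact: hw.
have wv1 (w' : R) : W w' -> w' *: (w *: v) <> 0.
  by move=> Ww'; rewrite scalerA; apply: hr; exact: WM.
exists (w * r); rewrite -scalerA -/v; split; last exact: wv1.
split.
- exact: ann_ideal.
- by rewrite scale1r => h; apply: (wv1 1 W1); rewrite scale1r.
- move=> a b /annE h; case: (pselect (ann v b)) => [/annE|/(annP a b h)/annE]; tauto.
Qed.

Lemma associated_prime0 V (u : V) : u <> 0 ->
  exists r, is_prime (fun a => a *: (r *: u) = 0).
Proof.
move=> hu; have [| |r [hr _]] := @associated_prime (eq 1) V u _ _.
- by split=> // s t <- <-; rewrite mulr1.
- by move=> w <-; rewrite scale1r.
- by exists r.
Qed.

Lemma prime_avoidance n (P : nat -> R -> Prop) I : is_ideal I ->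
  (forall i, (i < n)%N -> is_prime (P i) /\ exists2 x, I x & ~ P i x) ->
  exists2 x, I x & forall i, (i < n)%N -> ~ P i x.
Proof.
move=> hI; elim: n P => [|n IH] P hP; first by exists 0; first exact: ideal0.
have hx j : exists x, (j < n.+1)%N ->
    I x /\ forall i, (i < n.+1)%N -> i <> j -> ~ P i x.
  case: (ltnP j n.+1) => jn; last by exists 0.
  have [i hi|x Ix hx] := IH (fun i => P (bump j i)).
    by apply: hP; rewrite /bump; case: (j <= i)%N => //=; rewrite add0n ltnS ltnW.
  exists x => _; split=> // i iln /eqP ij.
  have := hx (unbump j i); rewrite unbumpKcond (negPf ij) /=; apply.
  rewrite /unbump; case: (ltnP j i) => /= ji.
    by case: i iln ij ji => //= i; rewrite subn1.
  rewrite subn0; have ltij : (i < j)%N by rewrite ltn_neqAle ij ji.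
  exact: leq_trans ltij jn.
have [x {}hx] := choice hx.
case: (pselect (exists2 j, (j < n.+1)%N & ~ P j (x j))) => [[j jn Pj]|hno].
  have [Ixj hxj] := hx j jn; exists (x j) => // i iln.
  by case: (pselect (i = j)) => [->|/(hxj i iln)].
have hxx j : (j < n.+1)%N -> P j (x j).
  by move=> jn; apply: contrapT => h; apply: hno; exists j.
case: n => [|n] in IH hP hx hno hxx *.
  by have [_ [y Iy hy]] := hP 0%N isT; exists y => // -[].
exists (x n.+1 + \prod_(i < n.+1) x i).
  apply: idealD => //; first by case: (hx n.+1 (leqnn _)).
  by rewrite big_ord_recl; apply: ideal_mulr => //; case: (hx 0%N isT).
move=> i; rewrite ltnS leq_eqVlt => /orP[/eqP ->|iln].
  have [[hPn Pn1 PnM] _] := hP n.+1 (leqnn _).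
  move=> /(ideal_addl hPn (hxx n.+1 (leqnn _))).
  apply: (big_ind (fun y => ~ P n.+1 y)) => // [y z hy hz /PnM[]//|j _].
  have [_ hj] := hx j (ltnW (ltn_ord j)); apply: hj => // e.
  by have := ltn_ord j; rewrite -e ltnn.
have [hPi _ _] := (hP i (ltnW iln)).1.
have [_ hn] := hx n.+1 (leqnn _); move=> h; apply: (hn i (ltnW iln)).
  by move=> e; rewrite e ltnn in iln.
apply: (ideal_addl hPi (x := \prod_(i < n.+1) x i)); last by rewrite addrC.
by rewrite (bigD1 (Ordinal iln)) //=; apply: ideal_mulr => //; apply: hxx; exact: ltnW.
Qed.

Lemma subfamily (T : Type) n (P : nat -> T) (Q : T -> Prop) :
  exists n' (P' : nat -> T), (forall i, (i < n')%N -> Q (P' i)) /\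
    forall i, (i < n)%N -> Q (P i) -> exists2 j, (j < n')%N & P' j = P i.
Proof.
elim: n => [|n [n' [P' [h1 h2]]]]; first by exists 0%N, P.
case: (pselect (Q (P n))) => hn.
  exists n'.+1, (fun i => if i == n' then P n else P' i); split=> i.
    rewrite ltnS leq_eqVlt => /orP[/eqP ->|h]; first by rewrite eqxx.
    by case: eqP => // _; exact: h1.
  rewrite ltnS leq_eqVlt => /orP[/eqP -> _|h Qi].
    by exists n'; rewrite ?eqxx.
  have [j jn' <-] := h2 i h Qi; exists j; first exact: ltnW.
  by case: eqP => // e; rewrite e ltnn in jn'.
exists n', P'; split=> // i.
rewrite ltnS leq_eqVlt => /orP[/eqP ->//|]; exact: h2.
Qed.

Lemma finite_associated_primes V : noetherian_module V ->
  exists n (P : nat -> R -> Prop), forall u : V, is_prime (fun a => a *: u = 0) ->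
    exists2 i, (i < n)%N & forall a, P i a <-> a *: u = 0.
Proof.
move=> noeV.
pose good (N : V -> Prop) := exists n (P : nat -> R -> Prop), forall u : V, N u ->
  is_prime (fun a => a *: u = 0) -> exists2 i, (i < n)%N & forall a, P i a <-> a *: u = 0.
pose F N := is_submod N /\ good N.
have [||N [hN [n [P hP]]] hmax] := @noetherian_module_max _ _ F noeV.
- exists (fun u => u = 0); split.
    exact: submod_zero.
  by exists 0%N, (fun _ _ => True) => u -> [_ h _]; case: h; rewrite scaler0.
- by move=> N [].
suff hall v : N v by exists n, P => u; apply: hP.
apply: contrapT => Nv.
pose Nann (v : V) (a : R) := N (a *: v).
have hNann w : is_ideal (Nann w).
  split; rewrite /Nann; first by rewrite scale0r; exact: submod0.
  by move=> a x y hx hy; rewrite scalerDl -scalerA; apply: (proj2 hN).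
have [||Q [w [Nw QE]] Qmax] := @noetherian_module_max _ _ (fun J : R^o -> Prop =>
    exists w, ~ N w /\ J = Nann w) noeR.
- by exists (Nann v), v.
- by move=> J [w [_ ->]]; exact: hNann.
have Qprime a b : Nann w (a * b) -> ~ Nann w b -> Nann w a.
  move=> hab hb; rewrite -QE; apply: (Qmax (Nann (b *: w))).
  - by exists (b *: w).
  - rewrite QE => x hx; rewrite /Nann scalerA mulrC -scalerA.
    exact: submodZ.
  - by rewrite /Nann scalerA.
pose N' x := exists2 u, N u & (exists r, x - u = r *: w).
have hw : is_submod (fun x => exists r, x = r *: w).
  split; first by exists 0; rewrite scale0r.
  by move=> a x y [r ->] [r' ->]; exists (a * r + r'); rewrite scalerDl scalerA.
have hN' : is_submod N' := submod_add hN hw.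
apply: Nw; apply: (hmax N').
- split=> //; exists n.+1, (fun i => if i == n then Nann w else P i) => u N'u up.
  case: (pselect (exists2 r, r *: u <> 0 & N (r *: u))) => [[r ru0 Nru]|hno].
    have annE a : a *: (r *: u) = 0 <-> a *: u = 0.
      split=> h; last by rewrite scalerA mulrC -scalerA h scaler0.
      by have [_ _ /(_ a r)] := up; rewrite -scalerA => /(_ h)[].
    have [|i iln hi] := hP _ Nru.
      have [[u0 uD] u1 uM] := up; split.
      + exact: ann_ideal.
      + by move=> /annE.
      + by move=> a b /annE/uM[/annE|/annE]; [left|right].
    exists i; first exact: ltnW.
    by case: eqP => [e|_ a]; [rewrite e ltnn in iln|rewrite -annE].
  exists n => //; rewrite eqxx => a.
  have NU b : N (b *: u) -> b *: u = 0.
    by move=> h; apply: contrapT => h'; apply: hno; exists b.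
  have [y Ny [r uE]] := N'u.
  have {}uE : u = y + r *: w by rewrite -uE addrC subrK.
  have Nr : ~ Nann w r.
    move=> h; have [_ u1 _] := up; apply: u1; apply: NU; rewrite scale1r uE.
    exact: submodD.
  have E b : N (b *: u) <-> Nann w (b * r).
    rewrite uE scalerDr scalerA; split.
      by apply: submod_addl => //; exact: submodZ.
    by apply: submodD => //; exact: submodZ.
  split=> h.
    by apply: NU; apply/E; rewrite /Nann mulrC -scalerA; exact: submodZ.
  apply: (Qprime a r) Nr; apply/E; rewrite h; exact: submod0.
- by move=> x Nx; exists x => //; exists 0; rewrite subrr scale0r.
- by exists 0; [exact: submod0|exists 1; rewrite subr0 scale1r].
Qed.

Lemma regular_element2 V1 V2 I : noetherian_module V1 -> noetherian_module V2 ->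
  is_ideal I ->
  (forall u : V1, is_prime (fun a => a *: u = 0) -> exists2 x, I x & x *: u <> 0) ->
  (forall u : V2, is_prime (fun a => a *: u = 0) -> exists2 x, I x & x *: u <> 0) ->
  exists x, [/\ I x, forall u : V1, x *: u = 0 -> u = 0 & forall u : V2, x *: u = 0 -> u = 0].
Proof.
move=> noe1 noe2 hI hI1 hI2.
have [n1 [P1 hP1]] := finite_associated_primes noe1.
have [n2 [P2 hP2]] := finite_associated_primes noe2.
pose Q (J : R -> Prop) := is_prime J /\ exists2 x, I x & ~ J x.
have [n [P [h1 h2]]] := subfamily (n1 + n2) (fun i => if (i < n1)%N then P1 i else P2 (i - n1)%N) Q.
have [x Ix hx] := @prime_avoidance n P I hI h1.
have regular_on V (hIV : forall u : V, is_prime (fun a => a *: u = 0) -> exists2 x, I x & x *: u <> 0)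
    (hPV : forall u : V, is_prime (fun a => a *: u = 0) -> exists2 i, (i < n1 + n2)%N &
      forall a, (if (i < n1)%N then P1 i else P2 (i - n1)%N) a <-> a *: u = 0) (u : V) :
    x *: u = 0 -> u = 0.
  move=> xu; apply: contrapT => u0; have [r rp] := associated_prime0 u0.
  have [i iln iE] := hPV _ rp; have [y Iy yu] := hIV _ rp.
  have [|j jn jE] := h2 i iln.
    rewrite (_ : (if _ then _ else _) = fun a => a *: (r *: u) = 0).
      by split=> //; exists y.
    by apply/funext => a; apply/propext.
  by apply: (hx j jn); rewrite jE iE scalerA mulrC -scalerA xu scaler0.
exists x; split=> //; apply: regular_on => // u /[dup] up.
  by move=> /hP1[i iln iE]; exists i; [exact: ltn_addr|rewrite iln].
move=> /hP2[i iln iE]; exists (n1 + i)%N; first by rewrite ltn_add2l.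
by rewrite ltnNge leq_addr /= addKn.
Qed.

Lemma regular_element V I : noetherian_module V -> is_ideal I ->
  (forall u : V, is_prime (fun a => a *: u = 0) -> exists2 x, I x & x *: u <> 0) ->
  exists2 x, I x & forall u : V, x *: u = 0 -> u = 0.
Proof.
move=> noeV hI hIu; have [x [Ix hx _]] := regular_element2 noeV noeV hI hIu hIu.
by exists x.
Qed.
End AssociatedPrimes.

(** * Algebras finite over a noetherian ring *)

Section RestrictionOfScalars.
Variables (R : comNzRingType) (A : ralgebra R) (L : lmodType A).

Definition restr : Type := L.
HB.instance Definition _ := GRing.Zmodule.on restr.

Definition restr_scale (r : R) (x : restr) : restr := alg_map A r *: (x : L).

Fact restr_scaleA r s x : restr_scale r (restr_scale s x) = restr_scale (r * s) x.
Proof. by rewrite /restr_scale scalerA rmorphM. Qed.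
Fact restr_scale1 : left_id 1 restr_scale.
Proof. by move=> x; rewrite /restr_scale rmorph1 scale1r. Qed.
Fact restr_scaleDr : right_distributive restr_scale +%R.
Proof. by move=> r x y; rewrite /restr_scale scalerDr. Qed.
Fact restr_scaleDl x : {morph restr_scale^~ x : r s / r + s}.
Proof. by move=> r s; rewrite /restr_scale rmorphD scalerDl. Qed.
HB.instance Definition _ := GRing.Zmodule_isLmodule.Build R restr
  restr_scaleA restr_scale1 restr_scaleDr restr_scaleDl.

Lemma restrZ (r : R) (x : restr) : r *: x = alg_map A r *: (x : L).
Proof. by []. Qed.
End RestrictionOfScalars.

Section AlgebraModules.
Variables (R : comNzRingType) (A : ralgebra R).
Hypothesis noeR : noetherian_module (R^o : lmodType R).
Hypothesis fgA : finitely_generated (alg_mod A : lmodType R).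
Implicit Types (K L V F E : lmodType A) (q : R -> Prop).

Local Notation rr L := (restr L : lmodType R).
Local Notation "r ** x" := (alg_map A r *: x) (at level 40).

Definition fg L := finitely_generated (rr L).

Lemma restr_submod L (N : L -> Prop) : is_submod N -> is_submod (N : rr L -> Prop).
Proof. by move=> hN; split=> [|a x y Nx Ny]; [exact: (submod0 hN)|exact: (proj2 hN)]. Qed.

Lemma restr_linear K L (f : {linear K -> L}) : linear (f : rr K -> rr L).
Proof. by move=> a x y; rewrite !restrZ linearP. Qed.

Lemma fg_noetherian L : fg L -> noetherian_module (rr L).
Proof. exact: finitely_generated_noetherian. Qed.

Lemma fg_surj V L (g : {linear V -> L}) : surj g -> fg V -> fg L.
Proof.
move=> gs [n [e he]]; exists n, (fun i => g (e i)) => y.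
have [x <-] := gs y; have [c ->] := he x; exists c.
pose g' : {linear rr V -> rr L} := lin (restr_linear g).
change (g' (\sum_i c i *: e i) = \sum_i c i *: g' (e i)).
by rewrite linear_sum; apply: eq_bigr => i _; rewrite linearZ.
Qed.

Lemma fg_inj K V (f : {linear K -> V}) : injective f -> fg V -> fg K.
Proof.
move=> fi /fg_noetherian noeV; apply/finitely_generatedP.
have hN : is_submod (fun v : rr V => exists x, f x = v).
  split; first by exists 0; exact: linear0.
  by move=> a _ _ [x <-] [y <-]; exists (alg_map A a *: x + y); rewrite linearP.
have [s hs] := noeV _ hN.
have [t tE] : exists t, s = map f t.
  have : forall v, v \in s -> exists x, f x = v by move=> v /lspan_mem/hs.
  elim: {hs} s => [|v s IH] h; first by exists [::].
  have [t ->] := IH (fun v' h' => h v' (mem_behead (s := v :: s) h')).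
  by have [x <-] := h v (mem_head _ _); exists (x :: t).
exists t => x.
have : lspan s (f x : rr V) by apply/hs; exists x.
rewrite {}tE; elim: t x {hs} => [|y t IH] x /=.
  by rewrite -(linear0 f) => /fi.
move=> [r [z [tz xE]]].
have fz : f (x - r ** y) = z by rewrite linearB linearZ /= xE addrC addKr.
exists r, (x - r ** y); split; last by rewrite addrC subrK.
by apply: IH; rewrite fz.
Qed.

Lemma fg_regular : fg (A^o : lmodType A).
Proof.
have [n [e he]] := fgA; exists n, e => x; have [c ->] := he x; exists c.
by [].
Qed.

Lemma fg_free n : fg (free_module A n).
Proof.
have [m [e he]] := fgA; have [c hc] := choice he.
pose g (p : 'I_n * 'I_m) : rr (free_module A n) := [ffun k => if k == p.1 then e p.2 else 0].
apply/finitely_generatedP; exists (map g (enum {: 'I_n * 'I_m})) => x.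
have -> : x = \sum_p c (x p.1) p.2 *: g p.
  rewrite -(pair_bigA _ (fun i j => c (x i) j *: g (i, j))) /=.
  apply/ffunP => k; rewrite sum_ffunE (bigD1 k) //= [X in _ + X]big1 => [|i ik].
    rewrite addr0 [LHS](hc (x k)) sum_ffunE; apply: eq_bigr => j _.
    by rewrite !ffunE eqxx.
  rewrite sum_ffunE big1 // => j _.
  by rewrite !ffunE eq_sym (negPf ik) scaler0.
apply: submod_sum => [|p _]; first exact: lspan_submod.
by apply: (submodZ _ (lspan_submod _)); apply/lspan_mem/map_f; rewrite mem_enum.
Qed.

Lemma fg_cover L : fg L -> exists (K F : lmodType A) (f : {linear K -> F}) (g : {linear F -> L}),
  [/\ short_exact f g, projective_module F, fg F & fg K].
Proof.
move=> [n [e he]]; have [g gE] := free_module_lift (e : 'I_n -> L).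
have gs : surj g.
  move=> y; have [c ->] := he y; exists [ffun i => alg_map A (c i)]; rewrite gE.
  by apply: eq_bigr => i _; rewrite ffunE.
have [K [f fge]] := surj_short_exact gs.
exists K, (free_module A n), f, g; split=> //.
- exact: free_module_projective.
- exact: fg_free.
- by have [fi _ _] := fge; apply: fg_inj fi (fg_free n).
Qed.

Definition away q (b : A) : Prop := exists2 s, ~ q s & b = alg_map A s.

Lemma away1 q : is_prime q -> away q 1.
Proof. by move=> [_ q1 _]; exists 1; rewrite ?rmorph1. Qed.
Lemma awayM q : is_prime q -> forall s t, away q s -> away q t -> away q (s * t).
Proof.
by move=> [_ _ qM] _ _ [s qs ->] [t qt ->]; exists (s * t); rewrite ?rmorphM // => /qM[].
Qed.
Lemma awayC q s : away q s -> forall b, s * b = b * s.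
Proof. by move=> [t _ ->] b; exact: alg_mapC. Qed.

Definition pd_at q n L := local_pd (away q) n L.

Lemma pd_at_mono q n L : is_prime q -> fg L -> pd_at q n L -> pd_at q n.+1 L.
Proof.
move=> qp; elim: n L => [|n IH] L fL.
  move=> [s qs hs]; have [K [F [f [g [fge hF _ _]]]]] := fg_cover fL.
  exists K, F, f, g; split=> //; exists s => //.
  by apply: scaled_projective_syzygy fge hF _ hs; exact: awayC qs.
move=> h; have [K [F [f [g [fge hF _ fK]]]]] := fg_cover fL.
exists K, F, f, g; split=> //; apply: IH => //.
exact: (local_pd_syzygy (away1 qp) (awayM qp) (@awayC q)) fge hF h.
Qed.

Lemma pd_at_le q n n' L : is_prime q -> fg L -> (n <= n')%N -> pd_at q n L -> pd_at q n' L.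
Proof.
move=> qp fL /subnK <-; elim: (n' - n)%N => //= k IH /IH; exact: pd_at_mono.
Qed.

Lemma pd_at_annihilated q s n L : is_prime q -> fg L -> ~ q s ->
  (forall x : L, s ** x = 0) -> pd_at q n L.
Proof.
move=> qp fL qs sL; apply: (@pd_at_le q 0) => //.
exists (alg_map A s); first by exists s.
move=> M N g f gs; exists \0 => x.
by rewrite linear0 -linearZ sL linear0.
Qed.

Lemma scale_alg_linear (x : R) L : linear (fun l : L => x ** l).
Proof. by move=> a y z; rewrite scalerDr !scalerA alg_mapC. Qed.

(* A Nakayama lemma for projective dimension: [E] is the pullback of the presentation
   [g] along multiplication by [x], so that its class in Ext^1(L, K) is [x] times
   that of [F].  For [n = 0], splitting [E] up to [s] extends [s - x phi] from [K] to
   [F] for some endomorphism [phi] of [K]; as [phi] is integral over [R], so does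
   some [s'] congruent to a power of [s] modulo [x]. *)
Lemma pd_at_pullback q (x : R) n K F L E (f : {linear K -> F}) (g : {linear F -> L})
    (i : {linear E -> (F * L)%type}) :
  is_prime q -> q x -> short_exact f g -> projective_module F -> fg F ->
  injective i -> (forall p, (exists y, i y = p) <-> g p.1 = x ** p.2) ->
  pd_at q n E -> pd_at q n L.
Proof.
move=> qp qx; elim: n K F L E f g i => [|n IH] K F L E f g i fge hF fgF ii ie.
  move=> [_ [s qs ->] hE]; have [fi gs fg0] := fge.
  have fK : fg K := fg_inj fi fgF.
  have [t gt] := hE F L g (snd \o i) gs.
  have l1 : linear (fun k => (f k, 0) : F * L).
    by move=> a k k'; rewrite linearP; congr (_, _); rewrite /= scaler0 addr0.
  have [j ij] : exists j : {linear K -> E}, forall k, i (j k) = lin l1 k.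
    apply: factor_inj => // k; apply/ie => /=.
    by rewrite (short_exact0 k fge) scaler0.
  have [phi fphi] : exists phi : {linear K -> K}, forall k, f (phi k) = (t \o j) k.
    by apply: factor_inj => // k; apply/fg0; rewrite /= gt /= ij scaler0.
  have l2 : linear (fun p => (x ** p, g p) : F * L).
    by move=> a p p'; rewrite linearP (scale_alg_linear x a p p').
  have [v iv] : exists v : {linear F -> E}, forall p, i (v p) = lin l2 p.
    by apply: factor_inj => // p; apply/ie; rewrite /= linearZ.
  have l3 : linear (fun p => s ** p - t (v p)).
    by move=> a p p'; rewrite (scale_alg_linear s a p p') !linearP scalerDr addrACA.
  have [u fu] : exists u : {linear F -> K}, forall p, f (u p) = lin l3 p.
    by apply: factor_inj => // p; apply/fg0; rewrite /= linearB linearZ gt /= iv subrr.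
  have uf k : u (f k) = s ** k - x ** phi k.
    have vf : v (f k) = x ** j k.
      apply: ii; rewrite iv linearZ /= ij /= (short_exact0 k fge).
      by congr (_, _); rewrite /= scaler0.
    by apply: fi; rewrite fu /= vf linearB !linearZ fphi.
  have [n [r hr]] := monic_relation (lin (restr_linear phi)) fK.
  have iterl m : exists psi : {linear K -> K}, forall k, psi k = iter m phi k.
    elim: m => [|m [psi hpsi]]; first by exists idfun.
    by exists (phi \o psi) => k /=; rewrite hpsi.
  have ext m : exists w : {linear F -> K}, forall k,
      w (f k) = (s ^+ m) ** k - (x ^+ m) ** iter m phi k.
    elim: m => [|m [w hw]]; first by exists \0 => k /=; rewrite !expr0 subrr.
    have [psi hpsi] := iterl m.
    have l4 : linear (fun p => s ** w p + (x ^+ m) ** psi (u p)).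
      move=> a p p'; rewrite !linearP (scale_alg_linear s a) (scale_alg_linear (x ^+ m) a).
      by rewrite scalerDr addrACA.
    have psiu k : psi (u (f k)) = s ** iter m phi k - x ** iter m.+1 phi k.
      by rewrite uf linearB linearZ linearZ /= !hpsi -iterSr.
    exists (lin l4) => k; rewrite /= hw psiu !scalerBr !scalerA -!rmorphM.
    by rewrite -exprS -exprSr [x ^+ m * s]mulrC addrA subrK.
  have [w hw] := choice ext.
  have lincomb (c : nat -> R) m : exists psi : {linear F -> K}, forall p,
      psi p = \sum_(a < m) c a ** w a p.
    elim: m => [|m [psi hpsi]]; first by exists \0 => p; rewrite big_ord0.
    have l5 : linear (fun p => psi p + c m ** w m p).
      move=> a p p'; rewrite !linearP (scale_alg_linear (c m) a).
      by rewrite scalerDr addrACA.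
    by exists (lin l5) => p; rewrite big_ord_recr /= hpsi.
  pose c (a : nat) := r a * x ^+ (n - a).
  have [psi hpsi] := lincomb c n.
  pose s' := s ^+ n - \sum_(a < n) c a * s ^+ a.
  have qs' : ~ q s'.
    move=> h; apply: qs; apply: (prime_exp (n := n) qp); have [qi _ _] := qp.
    rewrite -[s ^+ n](subrK (\sum_(a < n) c a * s ^+ a)); apply: idealD => //.
    apply: (@submod_sum _ (R^o : lmodType R)) => // a _.
    apply: ideal_mulr => //; apply: ideal_mull => //.
    have := ltn_ord a; rewrite -subn_gt0; case: (n - a)%N => // m _.
    by rewrite exprS; apply: ideal_mulr.
  pose wd : {linear F -> K} := w n \- psi.
  have wf k : wd (f k) = s' ** k.
    rewrite /= hw hpsi /s' rmorphB scalerBl -addrA; congr (_ + _).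
    under eq_bigr => a _ do rewrite hw scalerBr.
    rewrite sumrB opprB addrA addrC -[RHS]addr0; congr (_ + _).
      rewrite rmorph_sum /= scaler_suml; congr (- _); apply: eq_bigr => a _.
      by rewrite scalerA -rmorphM.
    have := hr k; rewrite /= => ->; rewrite scaler_sumr; apply/eqP.
    rewrite addrC subr_eq0; apply/eqP; apply: eq_bigr => a _.
    rewrite restrZ !scalerA -!rmorphM /c; congr (alg_map A _ *: _).
    by rewrite -mulrA -exprD subnK 1?mulrC // ltnW.
  have l6 : linear (fun p => s' ** p - f (wd p)).
    by move=> a p p'; rewrite (scale_alg_linear s' a) !linearP scalerDr addrACA.
  have hfk p : g p = 0 -> lin l6 p = 0.
    by move=> /fg0[k <-]; rewrite /= -[w n _ - _]/(wd (f k)) wf linearZ subrr.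
  have [h hg] := factor_surj gs hfk.
  exists (alg_map A s'); first by exists s'.
  rewrite -[alg_map A s']mul1r.
  apply: (scaled_projective_retract (f := h) (g := g)); last exact/projective_scaled.
  move=> l; have [p <-] := gs l.
  by rewrite hg /= linearB linearZ (short_exact0 _ fge) subr0.
move=> hE; have [fi gs fg0] := fge; have fK : fg K := fg_inj fi fgF.
have [K1 [F1 [f1 [g1 [fge1 hF1 fgF1 _]]]]] := fg_cover fK; have [f1i g1s fg1] := fge1.
have l1 : linear (fun p => (x ** p.2 - f (g1 p.1), g p.2) : F * L).
  move=> a p p'; rewrite !linearP /= (scale_alg_linear x a p.2 p'.2) ?linearP.
  by congr (_, _); rewrite /= scalerDr addrACA.
have [e ie'] : exists e : {linear (F1 * F)%type -> E}, forall p, i (e p) = lin l1 p.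
  by apply: factor_inj => // p; apply/ie; rewrite /= linearB linearZ (short_exact0 _ fge) subr0.
have es : surj e.
  move=> y; have iy : g (i y).1 = x ** (i y).2 by apply/ie; exists y.
  have [p gp] := gs (i y).2.
  have /fg0[k fk] : g (x ** p - (i y).1) = 0 by rewrite linearB linearZ iy gp subrr.
  have [a ga] := g1s k; exists (a, p); apply: ii.
  by rewrite ie' /= ga fk gp opprB addrC subrK -surjective_pairing.
have [E1 [i1 ei1]] := surj_short_exact es; have [i1i _ ei10] := ei1.
have pE1 : pd_at q n E1.
  apply: (local_pd_syzygy (away1 qp) (awayM qp) (@awayC q)) ei1 _ hE.
  exact: projective_prod.
have i1E p : (exists y, i1 y = p) <-> x ** p.2 = f (g1 p.1) /\ g p.2 = 0.
  split=> [/ei10 e0|[h1 h2]].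
    have : lin l1 p = 0 by rewrite -ie' e0 linear0.
    by case=> /eqP; rewrite subr_eq0 => /eqP.
  by apply/ei10/ii; rewrite ie' linear0 /= h1 h2 subrr.
have [k fk] : exists k : {linear E1 -> K}, forall y, f (k y) = (snd \o i1) y.
  by apply: factor_inj => // y; apply/fg0; have [|_] := (i1E (i1 y)).1; first by exists y.
have l2 : linear (fun y => ((i1 y).1, k y) : F1 * K).
  by move=> a y y'; rewrite !linearP.
have hK : pd_at q n K.
  apply: (IH K1 F1 K E1 f1 g1 (lin l2)) => //.
    move=> y y' [h1 h2]; apply: i1i; rewrite [LHS]surjective_pairing [RHS]surjective_pairing.
    by rewrite h1; congr (_, _); rewrite -[LHS]fk -[RHS]fk h2.
  move=> [a c]; split=> [[y [<- <-]]|/= gac].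
    apply: fi; rewrite linearZ fk /=.
    by have [|->] := (i1E (i1 y)).1; first by exists y.
  have [|y iy] := (i1E (a, f c)).2.
    by rewrite /= gac linearZ (short_exact0 _ fge).
  by exists y; congr (_, _); [rewrite iy|apply: fi; rewrite fk /= iy].
by exists K, F, f, g.
Qed.

Lemma pd_at_regular_quotient q (x : R) n L (Q : lmodType A) (g : {linear L -> Q}) :
  is_prime q -> q x -> fg L -> (forall u : L, x ** u = 0 -> u = 0) ->
  surj g -> (forall v, g v = 0 <-> exists u, v = x ** u) ->
  pd_at q n.+1 Q -> pd_at q n L.
Proof.
move=> qp qx fL xL gs gE hQ.
have [K [F [f [pi [fpi hF fF _]]]]] := fg_cover fL; have [_ pis _] := fpi.
have gpis : surj (g \o pi).
  by move=> y; have [u <-] := gs y; have [z <-] := pis u; exists z.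
have [E [i0 Ei0]] := surj_short_exact gpis; have [i0i _ i0E] := Ei0.
have xi : injective (lin (scale_alg_linear x (L := L))).
  by move=> u v /= /eqP; rewrite -subr_eq0 -scalerBr => /eqP/xL/eqP; rewrite subr_eq0 => /eqP.
have [l xl] : exists l : {linear E -> L}, forall y,
    lin (scale_alg_linear x (L := L)) (l y) = (pi \o i0) y.
  apply: factor_inj => // y.
  have /gE[u e] : g (pi (i0 y)) = 0 by have := (i0E (i0 y)).2; apply; exists y.
  by exists u; rewrite /= e.
have l1 : linear (fun y => (i0 y, l y) : F * L) by move=> a y y'; rewrite !linearP.
apply: (pd_at_pullback (i := lin l1) qp qx fpi hF fF); last 1 first.
- exact: (local_pd_syzygy (away1 qp) (awayM qp) (@awayC q)) Ei0 hF hQ.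
- by move=> y y' [/i0i].
- move=> [p u]; split=> [[y [<- <-]]|/= pu]; first by have := xl y.
  have /i0E[y iy] : (g \o pi) p = 0 by rewrite /= pu; apply/gE; exists u.
  exists y; congr (_, _) => //; apply: xi; rewrite xl /= iy; exact: pu.
Qed.
End AlgebraModules.

Section FiniteLength.
Variables (R : comNzRingType) (m : R -> Prop) (V : lmodType R).
Hypotheses (hm : is_ideal m) (m1 : ~ m 1).
Hypothesis mmax : forall x, ~ m x -> exists r, m (1 - r * x).
Hypothesis mV : forall a (v : V), m a -> a *: v = 0.

Lemma submod_dimension (s : seq V) (N : V -> Prop) :
  is_submod N -> (forall v, N v -> lspan s v) ->
  exists t, [/\ forall v, N v <-> lspan t v, (size t <= size s)%N &
    (size t < size s)%N \/ forall v, lspan s v -> N v].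
Proof.
elim: s N => [|e s IH] N hN Ns.
  exists [::]; split=> // [v|]; last by right=> v ->; exact: submod0.
  by split=> [/Ns//|->]; exact: submod0.
have hN' : is_submod (fun v => N v /\ lspan s v).
  split; first by split; [exact: submod0|exact: submod0 (lspan_submod _)].
  move=> a x y [Nx sx] [Ny sy]; split; first exact: (proj2 hN).
  exact: (proj2 (lspan_submod s)).
have [|t [tE ts tlt]] := IH _ hN'; first by move=> v [].
case: (pselect (exists2 u, N u & ~ lspan s u)) => [[u Nu su]|hno]; last first.
  have hNs v : N v -> lspan s v by move=> Nv; apply: contrapT => h; apply: hno; exists v.
  exists t; split; [move=> v|exact: leqW|by left].
  by rewrite -tE; split=> [Nv|[]//]; split=> //; exact: hNs.
have [r [y [sy uE]]] := Ns u Nu.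
have mr : ~ m r by move=> h; apply: su; rewrite uE mV // add0r.
have [r' hr'] := mmax mr.
pose u' := r' *: u.
have u'E : u' = e + r' *: y.
  rewrite /u' uE scalerDr scalerA; congr (_ + _); apply/eqP.
  by rewrite -subr_eq0 -opprB oppr_eq0 -[X in X - _]scale1r -scalerBl mV.
have Nu' : N u' by exact: submodZ.
exists (u' :: t); split=> [v|//|]; last first.
  case: tlt => [tlt|h]; [by left|right=> v /= [a [z [sz ->]]]].
  have -> : a *: e + z = a *: u' + (z - (a * r') *: y).
    by rewrite u'E scalerDr scalerA -addrA [_ *: y + _]addrC subrK.
  apply: submodD => //; first exact: submodZ.
  apply: (h _ _).1; apply: submodB => //; first exact: lspan_submod.
  by apply: submodZ => //; exact: lspan_submod.
split=> [Nv|/= [a [z [/tE[Nz _] ->]]]]; last by apply: submodD => //; exact: submodZ.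
have [a [z [sz vE]]] := Ns v Nv.
exists a, (v - a *: u'); split; last by rewrite addrC subrK.
apply/tE; split; first by apply: submodB => //; exact: submodZ.
have -> : v - a *: u' = z - (a * r') *: y.
  by rewrite vE u'E scalerDr scalerA opprD addrACA subrr add0r.
by apply: submodB; [exact: lspan_submod|exact: sz|apply: submodZ; [exact: lspan_submod|]].
Qed.
End FiniteLength.

Lemma maximal_inverse (R : comNzRingType) (m : R -> Prop) : is_ideal m ->
  (forall J, is_ideal J -> ~ J 1 -> (forall x, m x -> J x) -> forall x, J x -> m x) ->
  forall x, ~ m x -> exists r, m (1 - r * x).
Proof.
move=> hm mmax x mx; apply: contrapT => hno.
have hx := principal_ideal x.
have hJ : is_ideal _ := submod_add hx hm.
apply: mx; apply: mmax hJ _ _ _ _ => [[_ [r ->] h]|y my|].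
- by apply: hno; exists r.
- exists 0; last by rewrite subr0.
  by exists 0; rewrite mul0r.
- by exists x; rewrite ?subrr; [exists 1; rewrite mul1r|exact: ideal0].
Qed.

Lemma maximal_ideal_prime (R : comNzRingType) (m : R -> Prop) : is_ideal m -> ~ m 1 ->
  (forall x, ~ m x -> exists r, m (1 - r * x)) -> is_prime m.
Proof.
move=> mi m1 mmax; split=> // a b mab.
apply: contrapT => /not_orP[/mmax[r hr] mb]; apply: mb.
have -> : b = (1 - r * a) * b + r * (a * b) by ring.
by apply: idealD => //; [exact: ideal_mulr|exact: ideal_mull].
Qed.

Section Resolutions.
Variables (B : pzRingType).
Implicit Types K L : lmodType B.

Lemma resolution_local_pd (W : B -> Prop) n L : W 1 ->
  has_projective_resolution L n -> local_pd W n L.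
Proof.
move=> W1; elim: n L => [|n IH] L [P [d [e [hP P0 es ed dd]]]].
  apply: (projective_locally W1).
  have [es' ei] : surj e /\ injective e.
    split=> // x y /eqP; rewrite -subr_eq0 -linearB => /eqP/ed[z dz].
    by apply/eqP; rewrite -subr_eq0 -dz (P0 1%N isT z) linear0.
  have [h he] : exists h : {linear L -> P 0%N}, forall x, e (h x) = idfun x.
    by apply: factor_inj => // x; exact: es.
  exact: (projective_retract (f := h) (g := e)) (hP 0%N).
have [K [f fe]] := surj_short_exact es; have [fi _ fE] := fe.
exists K, (P 0%N), f, e; split=> //; apply: IH.
have [e' fe'] : exists e' : {linear P 1%N -> K}, forall x, f (e' x) = d 0%N x.
  by apply: factor_inj => // x; apply/fE/ed; exists x.
exists (fun i => P i.+1), (fun i => d i.+1), e'; split=> //.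
- by move=> i ni; apply: P0.
- move=> k; have /ed[x dx] : e (f k) = 0 by exact: short_exact0 fe.
  by exists x; apply: fi; rewrite fe'.
- move=> y; rewrite -(dd 0%N y) -fe'; split=> [->|h]; first exact: linear0.
  by apply: fi; rewrite h linear0.
Qed.

Lemma local_pd_resolution n L :
  local_pd (fun b => b = 1) n L -> has_projective_resolution L n.
Proof.
elim: n L => [|n IH] L.
  move=> [_ -> /projective_scaled hL].
  have h0 (x : free_module B 0) : x = 0 by apply/ffunP => -[].
  exists (fun i => if i is _.+1 then free_module B 0 else L), (fun i => \0), idfun; split=> //.
  - by case=> // _; exact: free_module_projective.
  - by case=> // i _ x; exact: h0.
  - by move=> x; exists x.
  - by move=> y /=; split=> [->|[_ <-]] //; exists 0.
  - by move=> i y; split=> // _; exists 0; rewrite [y]h0.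
move=> [K [P0 [f [g [[fi gs fg] hP0 /IH[P [d [e [hP Pn es ed dd]]]]]]]]].
pose P' i : lmodType B := if i is j.+1 then P j else P0.
pose d' i : {linear P' i.+1 -> P' i} :=
  match i return {linear P' i.+1 -> P' i} with 0 => f \o e | j.+1 => d j end.
exists P', d', g; split=> //.
- by case.
- by case=> // i; rewrite ltnS; exact: Pn.
- move=> y /=; rewrite (fg y); split=> [[x <-]|[x <-]]; last by exists (e x).
  by have [z <-] := es x; exists z.
- case=> [|i] y /=; last exact: dd.
  by rewrite -(ed y); split=> [h|->]; [apply: fi; rewrite h|]; rewrite linear0.
Qed.
End Resolutions.

Section LocalGlobalDimension.
Variables (R : comNzRingType) (A : ralgebra R).
Hypothesis noeR : noetherian_module (R^o : lmodType R).
Hypothesis fgA : finitely_generated (alg_mod A : lmodType R).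
Implicit Types (K L V F E S : lmodType A) (q : R -> Prop).

Local Notation rr L := (restr L : lmodType R).
Local Notation "r ** x" := (alg_map A r *: x) (at level 40).

Lemma away_extension q n K V L (f : {linear K -> V}) (g : {linear V -> L}) :
  is_prime q -> short_exact f g -> pd_at q n K -> pd_at q n L -> pd_at q n V.
Proof. move=> qp; exact: (local_pd_extension (awayM qp) (@awayC _ _ q)). Qed.

Lemma away_subset q q' n L : (forall x, q x -> q' x) -> pd_at q' n L -> pd_at q n L.
Proof.
move=> qq; apply: local_pd_sub_set => _ [s hs ->]; exists s => // /qq.
exact: hs.
Qed.

Definition gldim_at q n := forall L, fg L -> pd_at q n L.

Lemma alg_torsion_submod q L : is_prime q ->
  is_submod (fun u : L => exists2 s, ~ q s & s ** u = 0).
Proof.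
move=> qp; have [mq1 mqM] := prime_mult_set qp; split.
  by exists 1; rewrite ?scaler0.
move=> a x y [s qs sx] [t qt ty]; exists (s * t); first exact: mqM.
rewrite rmorphM scalerDr -!scalerA ty scaler0 addr0.
have -> : alg_map A s *: (alg_map A t *: (a *: x)) = (alg_map A t * a) *: (s ** x).
  rewrite !scalerA; congr (_ *: _).
  by rewrite -!mulrA -[a * _]alg_mapC mulrA alg_mapC !mulrA.
by rewrite sx scaler0.
Qed.

Lemma torsion_reduction q L : is_prime q -> fg L ->
  exists (K Q : lmodType A) (f : {linear K -> L}) (g : {linear L -> Q}) s,
  [/\ short_exact f g, ~ q s, forall x : K, s ** x = 0 &
      forall t (x : Q), ~ q t -> t ** x = 0 -> x = 0].
Proof.
move=> qp fL; have hT := alg_torsion_submod L qp.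
have [K [Q [f [g [fge TE]]]]] := submod_short_exact hT.
have [fi gs fg0] := fge; have fK : fg K := fg_inj noeR fi fL.
have [gen hgen] := (finitely_generatedP _).1 fK.
have [||s qs hs] := @mult_set_common R (fun s => ~ q s) (rr K) gen
  (fun s x => s *: x = 0) (prime_mult_set qp).
- by move=> x a b h; rewrite mulrC -scalerA h scaler0.
- move=> x _; have /TE[s qs sx] : g (f x) = 0 := @short_exact0 A K L Q f g x fge.
  by exists s => //; apply: fi; rewrite linear0 -sx linearZ.
exists K, Q, f, g, s; split=> //.
  move=> x; apply: (@lspan_min _ (rr K) (fun x => s *: x = 0) gen) => //.
  split; first exact: scaler0.
  move=> a y z hy hz; rewrite scalerDr scalerA mulrC -scalerA hy hz scaler0.
  exact: addr0.
move=> t x qt; have [u <-] := gs x; rewrite -linearZ => /TE[s' qs' h].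
have [_ mqM] := prime_mult_set qp; apply/TE; exists (s' * t); first exact: mqM.
by rewrite rmorphM -scalerA.
Qed.

Lemma regular_quotient_exists (x : R) L : exists (Q : lmodType A) (g : {linear L -> Q}),
  surj g /\ forall v, g v = 0 <-> exists u, v = x ** u.
Proof.
apply: quotient_module_exists; split; first by exists 0; rewrite scaler0.
move=> a _ _ [u ->] [v ->]; exists (a *: u + v).
by rewrite (scale_alg_linear x a u v).
Qed.

Lemma gldim_at_generization q q' n : is_prime q -> is_prime q' ->
  (forall x, q x -> q' x) -> (exists2 x, q' x & ~ q x) ->
  gldim_at q' n.+1 -> gldim_at q n.
Proof.
move=> qp qp' qq [x q'x qx] hG L fL.
have [K [Q [f [g [s [fge qs sK Qt]]]]]] := torsion_reduction qp fL.
have [fi gs _] := fge.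
apply: (away_extension qp fge).
  exact: (pd_at_annihilated noeR fgA n qp (fg_inj noeR fi fL) qs sK).
have fQ : fg Q := fg_surj gs fL.
apply: (away_subset qq).
have [Q' [g' [gs' g'E]]] := regular_quotient_exists x Q.
apply: (pd_at_regular_quotient noeR fgA qp' q'x fQ _ gs' g'E).
  by move=> u; exact: Qt.
by apply: hG; exact: fg_surj gs' fQ.
Qed.
End LocalGlobalDimension.

Section HomologicallyHomogeneous.
Variables (R : comNzRingType) (A : ralgebra R).
Hypothesis noeR : noetherian_module (R^o : lmodType R).
Hypothesis fgA : finitely_generated (alg_mod A : lmodType R).
Implicit Types (K L V F E S Q Y : lmodType A) (q : R -> Prop).

Local Notation rr L := (restr L : lmodType R).
Local Notation "r ** x" := (alg_map A r *: x) (at level 40).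

Variable m : R -> Prop.
Hypotheses (mp : is_prime m) (mmax : forall x, ~ m x -> exists r, m (1 - r * x)).

Lemma simple_submodule L : fg L -> (forall a, m a -> forall x : L, a ** x = 0) ->
  (exists x : L, x <> 0) ->
  exists S (j : {linear S -> L}), injective j /\ simple_module S.
Proof.
move=> fL mL [x0 hx0].
pose hasgen k := `[< exists N : L -> Prop, [/\ is_submod N, exists2 x, N x & x <> 0 &
   exists2 t : seq (rr L), (forall x, N x <-> lspan t x) & size t = k] >].
have exQ : exists k, hasgen k.
  have /finitely_generatedP[t ht] := fL.
  exists (size t); apply/asboolP; exists (fun _ => True); split=> //; first by exists x0.
  by exists t.
have [k /asboolP[N [hN [x Nx x0'] [t tE tk]]] kmin] := ex_minnP exQ.
have [S [j [ji jE]]] := sub_module_exists hN; exists S, j; split=> //; split.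
  by have /jE[y yx] := Nx; exists y => y0; apply: x0'; rewrite -yx y0 linear0.
move=> N' [N'0 hN']; case: (pselect (exists2 y, y \in N' & y <> 0)) => [[y N'y y0]|hno]; last first.
  by left=> y N'y; apply: contrapT => h; apply: hno; exists y.
right=> z.
pose M (v : L) := exists2 w, w \in N' & j w = v.
have hM : is_submod M.
  split; first by exists 0; rewrite ?linear0.
  by move=> a _ _ [v N'v <-] [w N'w <-]; exists (a *: v + w); rewrite ?hN' ?linearP.
have [|t' [t'E _ alt]] := submod_dimension (V := rr L) mmax (fun a v ma => mL a ma v)
  (s := t) (restr_submod hM).
  by move=> _ [w _ <-]; apply/tE/jE; exists w.
case: alt => [lt|h].
  have /kmin : hasgen (size t').
    apply/asboolP; exists M; split=> //; last by exists t'.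
    by exists (j y); [exists y|move=> h; apply: y0; apply: ji; rewrite h linear0].
  by rewrite -tk leqNgt lt.
have [|w N'w /ji <- //] := h (j z).
by apply/tE/jE; exists z.
Qed.

(* Devissage: an ideal maximal among those killing a counterexample [L] is a prime
   [P], and [L] may be taken torsion-free over [R / P].  If [P] is not [m], dividing by
   an element of [m] outside [P] kills more; otherwise [L] has finite length. *)
Lemma gldim_at_maximal d :
  (forall S, simple_module S -> (forall a, m a -> forall x : S, a ** x = 0) -> pd_at m d S) ->
  gldim_at A m d.
Proof.
move=> hS; apply: contrapT => hno.
have [mi m1 mM] := mp.
pose killed (J : R -> Prop) L := forall a, J a -> forall x : L, a ** x = 0.
pose F (J : R^o -> Prop) := is_ideal J /\ exists L, [/\ fg L, killed J L & ~ pd_at m d L].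
have [||P [hP [L [fL PL bad]]] Pmax] := @noetherian_module_max _ _ F noeR.
- exists (fun a => a = 0); split.
    exact: submod_zero.
  apply: contrapT => h; apply: hno => L fL; apply: contrapT => bad; apply: h.
  by exists L; split=> // a -> x; rewrite rmorph0 scale0r.
- by move=> J [].
have good (b : R) L' : ~ P b -> fg L' -> killed P L' -> (forall x : L', b ** x = 0) -> pd_at m d L'.
  move=> Pb fL' PL' bL'; apply: contrapT => bad'; apply: Pb.
  have hb := principal_ideal b.
  have hJ : is_ideal _ := submod_add hb hP.
  apply: (Pmax _ (conj hJ _)).
  - exists L'; split=> // a [_ [r ->] Pa] x.
    rewrite -[a](subrK (r * b)) rmorphD scalerDl PL' // add0r rmorphM -scalerA.
    by rewrite bL' scaler0.
  - by move=> x Px; exists 0; rewrite ?subr0 //; exists 0; rewrite mul0r.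
  - by exists b; [exists 1; rewrite mul1r|rewrite subrr; exact: ideal0].
have killed_sub K V J (f : {linear K -> V}) : injective f -> killed J V -> killed J K.
  by move=> fi JV a Ja x; apply: fi; rewrite linearZ /= JV // linear0.
have killed_quo V Q J (g : {linear V -> Q}) : surj g -> killed J V -> killed J Q.
  by move=> gs JV a Ja y; have [x <-] := gs y; rewrite -linearZ /= JV // linear0.
have P1 : ~ P 1.
  move=> P1; apply: bad; apply: (pd_at_annihilated noeR fgA d mp fL m1) => x.
  exact: PL.
have Pp : is_prime P.
  split=> // a b Pab; apply: contrapT => /not_orP[Pa Pb]; apply: bad.
  have [Q [g [gs gE]]] := regular_quotient_exists a L.
  have [K [f fge]] := surj_short_exact gs; have [fi _ fg0] := fge.
  apply: (away_extension mp fge).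
    apply: (good b) => //; [exact: (fg_inj noeR fi fL)|exact: (killed_sub _ _ _ _ fi PL)|].
    move=> x; have /gE[u fx] : g (f x) = 0 by exact: short_exact0 fge.
    by apply: fi; rewrite linearZ linear0 /= fx scalerA -rmorphM mulrC PL.
  apply: (good a) => //; [exact: (fg_surj gs fL)|exact: (killed_quo _ _ _ _ gs PL)|].
  by move=> x; have [u <-] := gs x; rewrite -linearZ; apply/gE; exists u.
case: (pselect (forall x, P x -> m x)) => [Pm|/existsNP[s /not_implyP[Ps ms]]]; last first.
  by apply: bad; apply: (pd_at_annihilated noeR fgA d mp fL ms) => x; exact: PL.
case: (pselect (forall x, m x -> P x)) => [mP|/existsNP[x /not_implyP[mx Px]]]; last first.
  apply: bad; have [K [Q [f [g [s [fge Ps sK Qt]]]]]] := torsion_reduction noeR Pp fL.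
  have [fi gs _] := fge; apply: (away_extension mp fge).
    apply: (good s) => //; [exact: (fg_inj noeR fi fL)|exact: (killed_sub _ _ _ _ fi PL)].
  have fQ : fg Q := fg_surj gs fL.
  have [Q' [g' [gs' gE']]] := regular_quotient_exists x Q.
  apply: (pd_at_regular_quotient noeR fgA mp mx fQ _ gs' gE').
    by move=> u; exact: Qt.
  have fQ' := fg_surj gs' fQ.
  apply: (pd_at_mono noeR fgA mp fQ'); apply: (good x) => //.
    by apply: (killed_quo _ _ _ _ gs'); exact: (killed_quo _ _ _ _ gs).
  by move=> y; have [u <-] := gs' y; rewrite -linearZ; apply/gE'; exists u.
have mL : killed m L by move=> a /mP; exact: PL.
pose G (N : rr L -> Prop) := is_submod (N : L -> Prop) /\
  exists K (f : {linear K -> L}), [/\ injective f, forall v, N v <-> exists k, f k = v & pd_at m d K].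
have zero_pd K : (forall x : K, x = 0) -> pd_at m d K.
  move=> K0; apply: (local_pd_projective (@away1 _ A _ mp)).
  exact: projective0.
have [||N [hN [K [f [fi fE pK]]]] Nmax] := @noetherian_module_max _ _ G (fg_noetherian noeR fL).
- exists (fun v => v = 0); split.
    exact: submod_zero.
  have h0 := @submod_zero _ (L).
  have [K [f [fi fE]]] := sub_module_exists h0; exists K, f; split=> //.
  by apply: zero_pd => x; apply: fi; rewrite linear0; apply/fE; exists x.
- by move=> N [hN _]; exact: restr_submod.
have [Q [g [gs gE]]] := quotient_module_exists hN.
have fge : short_exact f g by split=> // v; rewrite gE fE.
case: (pselect (exists x : Q, x <> 0)) => [Q0|hQ]; last first.
  apply: bad; apply: (away_extension mp fge pK); apply: zero_pd => x.
  by apply: contrapT => h; apply: hQ; exists x.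
have [S [j [ji Ss]]] := simple_submodule (fg_surj gs fL) (killed_quo _ _ _ _ gs mL) Q0.
have pS : pd_at m d S.
  apply: hS => //; apply: (killed_sub _ _ _ _ ji); exact: (killed_quo _ _ _ _ gs).
have hN' : is_submod (fun v : L => exists z, j z = g v).
  split; first by exists 0; rewrite !linear0.
  by move=> a x y [z hz] [z' hz']; exists (a *: z + z'); rewrite !linearP hz hz'.
have [K' [f' [fi' fE']]] := sub_module_exists hN'.
have NN' v : N v -> exists z, j z = g v.
  by move=> /gE ->; exists 0; rewrite linear0.
have [u fu] : exists u : {linear K -> K'}, forall x, f' (u x) = f x.
  by apply: factor_inj => // x; apply/fE'/NN'/fE; exists x.
have [w jw] : exists w : {linear K' -> S}, forall x, j (w x) = (g \o f') x.
  by apply: factor_inj => // x; apply/fE'; exists x.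
have ses' : short_exact u w.
  split.
  - by move=> x y /(congr1 f'); rewrite !fu => /fi.
  - move=> z; have [v gv] := gs (j z).
    have /fE'[k kv] : exists z, j z = g v by exists z.
    by exists k; apply: ji; rewrite jw /= kv.
  - move=> y; split=> [wy|[x <-]].
      have /gE/fE[x fx] : g (f' y) = 0 by have := jw y; rewrite wy linear0.
      by exists x; apply: fi'; rewrite fu.
    by apply: ji; rewrite jw /= fu (short_exact0 x fge) linear0.
have hN'N : forall v, (exists z, j z = g v) -> N v.
  apply: (Nmax (fun v => exists z, j z = g v)) => //; split=> //.
  exists K', f'; split=> //; exact: (away_extension mp ses').
have [[z z0] _] := Ss; apply: z0; apply: ji; rewrite linear0.
by have [v gv] := gs (j z); rewrite -gv; apply/gE/hN'N; exists z.
Qed.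

Lemma scaled_projective_ideal L : is_ideal (fun a => scaled_projective (alg_map A a) L).
Proof.
split.
  by move=> M N g f gs; exists \0 => x /=; rewrite rmorph0 scale0r linear0.
move=> a x y hx hy M N g f gs; have [h gh] := hx M N g f gs; have [k gk] := hy M N g f gs.
have l : linear (fun z => a ** h z + k z).
  move=> b z z'; rewrite !linearP (scale_alg_linear a b) scalerDr addrACA.
  by [].
exists (lin l) => z /=; rewrite linearD linearZ /= gh gk scalerA -rmorphM -scalerDl.
by rewrite -rmorphD.
Qed.

Lemma pd_at_global n S : fg S -> (forall a, m a -> scaled_projective (alg_map A a) S) ->
  pd_at m n S -> local_pd (fun b => b = 1) n S.
Proof.
elim: n S => [|n IH] S fS mS.
  move=> [_ [s ms ->] hs]; have [r hr] := mmax ms.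
  exists 1 => //; rewrite -(rmorph1 (alg_map A)).
  rewrite -(subrK (r * s) 1); have hI := scaled_projective_ideal S.
  exact: (idealD hI (mS _ hr) (ideal_mull r hI hs)).
move=> h; have [K [F [f [g [fge hF _ fK]]]]] := fg_cover noeR fgA fS.
exists K, F, f, g; split=> //; apply: IH => //.
  move=> a ma; apply: scaled_projective_syzygy fge hF _ (mS a ma).
  by move=> b; exact: alg_mapC.
exact: (local_pd_syzygy (@away1 _ A _ mp) (@awayM _ A _ mp) (@awayC _ A m)) fge hF h.
Qed.

Variable d : nat.
Hypothesis simple_pd : forall S, simple_module S ->
  (forall a, m a -> forall x : S, a ** x = 0) ->
  has_projective_resolution S d /\ forall n, has_projective_resolution S n -> (d <= n)%N.

Lemma homogeneous_gldim : gldim_at A m d.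
Proof.
apply: gldim_at_maximal => S Ss mS; have [h _] := simple_pd Ss mS.
exact: (resolution_local_pd (@away1 _ A _ mp) h).
Qed.

Lemma socle_pd Y (u : Y) k : fg Y -> u <> 0 -> (forall a, m a -> a ** u = 0) ->
  pd_at m k Y -> (d <= k)%N.
Proof.
move=> fY u0 mu pY; rewrite leqNgt; apply/negP => kd.
case: (d) kd simple_pd homogeneous_gldim => // d' kd simple_pd' hG.
have hU : is_submod (fun v : Y => forall a, m a -> a ** v = 0).
  split=> [a _|b x y hx hy a ma]; first by rewrite scaler0.
  by rewrite (scale_alg_linear a b) hx // hy // scaler0 addr0.
have [K [f [fi fE]]] := sub_module_exists hU.
have mK a : m a -> forall x : K, a ** x = 0.
  move=> ma x; apply: fi; rewrite linearZ linear0.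
  exact: ((fE (f x)).2 (ex_intro _ x erefl) a ma).
have [|S [j [ji Ss]]] := simple_submodule (fg_inj noeR fi fY) mK.
  by have /fE[x xu] := mu; exists x => x0; apply: u0; rewrite -xu x0 linear0.
have mS a : m a -> forall x : S, a ** x = 0.
  by move=> ma x; apply: ji; rewrite linearZ /= mK // linear0.
have fji : injective (f \o j) by move=> x y /fi/ji.
have hS : is_submod (fun v : Y => exists x, (f \o j) x = v).
  split; first by exists 0; rewrite linear0.
  by move=> a _ _ [x <-] [y <-]; exists (a *: x + y); rewrite linearP.
have [Q [g [gs gE]]] := quotient_module_exists hS.
have ses : short_exact (f \o j) g by [].
have fS : fg S := fg_inj noeR fji fY.
have pS : pd_at m d' S.
  apply: (local_pd_sub (@awayM _ A _ mp) (@awayC _ A m) ses _ (hG Q (fg_surj gs fY))).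
  exact: (@pd_at_le _ A noeR fgA m k d' Y mp fY kd pY).
have rS : has_projective_resolution S d'.
  apply/local_pd_resolution/pd_at_global => // a ma M N c h cs.
  by exists \0 => x; rewrite linear0 -linearZ mS // linear0.
by have [_ /(_ d' rS)] := simple_pd' S Ss mS; rewrite ltnn.
Qed.

(* Dividing [Y] by a regular element of [m] enlarges both the projective dimension
   bound and the associated prime.  This stops, by [socle_pd], once [d <= k], and each
   strict generization on the way back to [q] lowers the global dimension by one. *)
Lemma associated_gldim q Y (u : Y) k : fg Y -> is_prime q -> (forall x, q x -> m x) ->
  (forall a, q a <-> a ** u = 0) -> pd_at m k Y -> gldim_at A q k.
Proof.
have [n] := ubnP (d - k)%N; elim: n k q Y u => // n IH k q Y u dk fY qp qm qu pY.
have [dlek|kd] := leqP d k.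
  move=> L fL; apply: (away_subset qm); apply: (pd_at_le noeR fgA mp fL dlek).
  exact: homogeneous_gldim.
have [_ m1 mM] := mp; have [qi q1 qM] := qp.
have [y my yreg] : exists2 y, m y & forall v : rr Y, y *: v = 0 -> v = 0.
  apply: (regular_element noeR (fg_noetherian noeR fY)); first by case: mp.
  move=> v vp; apply: contrapT => hno.
  have v0 : (v : Y) <> 0.
    by move=> e; have [_ h _] := vp; apply: h; rewrite e scaler0.
  suff : (d <= k)%N by rewrite leqNgt kd.
  apply: (socle_pd fY v0) pY => a ma.
  by apply: contrapT => h; apply: hno; exists a.
have [Q [g [gs gE]]] := regular_quotient_exists y Y.
have pQ : pd_at m k.+1 Q.
  have yi : injective (lin (scale_alg_linear y (L := Y))).
    move=> v w /= /eqP; rewrite -subr_eq0 -scalerBr => /eqP/yreg/eqP.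
    by rewrite subr_eq0 => /eqP.
  have ses : short_exact (lin (scale_alg_linear y (L := Y))) g.
    by split=> // v; rewrite gE; split=> -[w e]; exists w.
  apply: (local_pd_quotient (@awayM _ A _ mp) (@awayC _ A m) ses pY).
  exact: (pd_at_mono noeR fgA mp fY).
have fQ : fg Q := fg_surj gs fY.
(* Otherwise [U = (0 :_Y q)] satisfies [U = y U] locally at [m], and Nakayama kills [u]. *)
have [v qv yv] : exists2 v : Y, forall a, q a -> a ** v = 0 &
    forall s, ~ m s -> forall w, s ** v <> y ** w.
  apply: contrapT => hno.
  have hU : is_submod (fun v : rr Y => forall a, q a -> a *: v = 0).
    exact: (@ann_submod R (rr Y) q).
  have [t tE] := fg_noetherian noeR fY hU.
  have h0 := @submod_zero _ (rr Y).
  have hy := principal_ideal y.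
  have [|e /lspan_mem/tE qe|s ms hs] := @nakayama R (fun s => ~ m s)
      (fun x => exists r, x = r * y) (rr Y) (fun v => v = 0) t (prime_mult_set mp) hy h0.
  - move=> w _ mw [r ->] h; apply: mw; have [mi _ _] := mp.
    by rewrite -[w](subrK (r * y)); apply: idealD => //; exact: ideal_mull.
  - apply: contrapT => hno'; apply: hno; exists e => // s ms w sw; apply: hno'.
    exists s => //.
    have : lspan t (w : rr Y).
      apply/tE => a qa; apply: yreg; rewrite scalerA mulrC -scalerA.
      have -> : y *: (w : rr Y) = s *: (e : rr Y) by rewrite [RHS]sw.
      by rewrite scalerA mulrC -scalerA qe // scaler0.
    have -> : s *: (e : rr Y) = y *: (w : rr Y) by exact: sw.
    elim: (t) (w : rr Y) => [|f t' IHt] z /=; first by move=> ->; exact: scaler0.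
    move=> [r [z' [/IHt h ->]]]; exists (r * y), (y *: z'); split=> //; first by exists r.
    by rewrite scalerDr scalerA mulrC.
  have : (s ** u : rr Y) = 0.
    have ut : lspan t (u : rr Y) by apply/tE => a /qu.
    have hK : is_submod (fun v : rr Y => s *: v = 0).
      split; first exact: scaler0.
      by move=> a x z hx hz; rewrite scalerDr scalerA mulrC -scalerA hx hz scaler0 addr0.
    exact: (lspan_min hK hs ut).
  by move=> /qu/qm.
have [s ms|r [rp rm]] := @associated_prime R noeR (fun s => ~ m s) (rr Q) (g v) (prime_mult_set mp).
  move=> h; have /gE[w e] : g (s ** v) = 0 by rewrite linearZ; exact: h.
  exact: (yv s ms w e).
pose q' a := a *: (r *: (g v : rr Q)) = 0.
have qq' x : q x -> q' x.
  move=> qx; rewrite /q' scalerA mulrC -scalerA.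
  have -> : x *: (g v : rr Q) = 0 by rewrite restrZ -linearZ qv // linear0.
  exact: scaler0.
have q'y : q' y.
  rewrite /q' scalerA mulrC -scalerA.
  have -> : y *: (g v : rr Q) = 0 by rewrite restrZ -linearZ; apply/gE; exists v.
  exact: scaler0.
have qy : ~ q y.
  move=> /qu h; apply: q1; apply/qu; rewrite (yreg u h); exact: scaler0.
apply: (gldim_at_generization noeR fgA qp rp qq'); first by exists y.
apply: (IH k.+1 q' Q (r *: (g v : rr Q))) => //.
- by rewrite subnS; move: kd dk; rewrite -subn_gt0; case: (d - k)%N.
- by move=> x q'x; apply: contrapT => /rm.
Qed.
End HomologicallyHomogeneous.

(** * The centre of the endomorphism ring *)

Section PrimeIdeals.
Variable R : comNzRingType.

Lemma prime_idealr_prime (p : prime_idealr R) : is_prime (fun x => x \in p).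
Proof.
split; last by move=> a b; rewrite prime_idealrM => /orP.
  split; first exact: idealr0.
  by move=> a x y xp yp; apply: rpredD => //; exact: idealMr.
by rewrite idealr1.
Qed.

Lemma prime_idealr_exists (P : R -> Prop) : is_prime P ->
  exists p : prime_idealr R, forall x, x \in p <-> P x.
Proof.
move=> [[P0 PD] P1 PM]; pose S (x : R) := `[< P x >].
have hS : idealr_closed S.
  split; [exact/asboolP|by apply/negP => /asboolP|].
  by move=> a u v /asboolP Pu /asboolP Pv; apply/asboolP; exact: PD.
have hP : prime_idealr_closed S.
  by move=> u v /asboolP /PM[h|h]; apply/orP; [left|right]; apply/asboolP.
pose p : prime_idealr R :=
  HB.pack S (isIdealr.Build R S hS) (isPrimeIdealrClosed.Build R S hP).
by exists p => x; split=> [/asboolP|h] //; apply/asboolP.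
Qed.
End PrimeIdeals.

Section Center.
Variables (R : comNzRingType) (M : lmodType R).
Hypothesis noeR : noetherian_module (R^o : lmodType R).
Hypothesis Rred : reduced R.
Hypothesis fgM : finitely_generated M.
Hypothesis Mtf : torsion_free M.
Hypothesis Msupp : forall p, supp M p <-> supp (R^o : lmodType R) p.

Definition regular (r : R) := forall x, r * x = 0 -> x = 0.

Lemma regularP r : r \in nonzerodivisor R <-> regular r.
Proof. by split=> [/asboolP|h]; [|apply/asboolP]. Qed.

Lemma regularM r s : regular r -> regular s -> regular (r * s).
Proof. by move=> hr hs x; rewrite -mulrA => /hr/hs. Qed.

Lemma regular1 : regular 1.
Proof. by move=> x; rewrite mul1r. Qed.

Lemma regular_cancel r (x y : M) : regular r -> r *: x = r *: y -> x = y.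
Proof.
move=> /regularP hr /eqP; rewrite -subr_eq0 -scalerBr => /eqP/(Mtf hr)/eqP.
by rewrite subr_eq0 => /eqP.
Qed.

Lemma supported P : is_prime P -> exists m : M, forall s, ~ P s -> s *: m <> 0.
Proof.
move=> /prime_idealr_exists[p pE].
have /Msupp[x x0] : supp (R^o : lmodType R) p.
  by exists (loc_one (at_prime p)); apply/eqP; exact: loc_one_neq0.
have [m [s xE]] := lfracP x; exists m => t Pt tm; apply: x0; rewrite xE lfrac0.
have tp : t \in at_prime p by apply/negP => /pE.
by apply/lfrac_eq; exists (exist _ t tp); rewrite /= scale1r tm !scaler0.
Qed.

Lemma faithful r : (forall m : M, r *: m = 0) -> r = 0.
Proof.
move=> rM; apply: contrapT => r0.
have [r' hP] := @associated_prime0 R noeR (R^o : lmodType R) r r0.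
have [m hm] := supported hP; apply: (hm (r' * r)); last by rewrite -scalerA rM scaler0.
move=> h; have [_ P1 _] := hP; apply: P1.
have e : (r' * r) ^+ 2 = 0 by rewrite expr2; exact: h.
by rewrite scale1r; exact: (Rred e).
Qed.

(* A coordinate function for a set of generators of [M] that is maximal among those
   independent modulo torsion over the domain [R / P], [P = ann t]; multiplying it by
   [t] makes it well defined with values in [R]. *)
Lemma functional_exists (t : R) : is_prime (fun a => a * t = 0) ->
  exists (phi : {linear M -> (R^o : lmodType R)}) (m : M), (phi m : R) * t <> 0.
Proof.
set P := fun a => a * t = 0 => hP; have [Pi P1 PM] := hP; have mP := prime_mult_set hP.
have Pt : ~ P t.
  move=> h; apply: P1; rewrite /P mul1r; apply: (Rred (n := 2)).
  by rewrite expr2.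
pose tors (x : M) := exists2 s, ~ P s & s *: x = 0.
have htors : is_submod tors.
  have [mP1 mPM] := mP; split; first by exists 1; rewrite ?scaler0.
  move=> a x y [s Ps sx] [s' Ps' sy]; exists (s * s'); first exact: mPM.
  rewrite scalerDr -[_ *: y]scalerA sy scaler0 addr0 scalerA.
  by rewrite (_ : s * s' * a = (s' * a) * s) ?[(s' * a * s) *: _]scalerA -?scalerA ?sx ?scaler0 //; ring.
have [n [e he]] := fgM.
pose indep (I : {set 'I_n}) := forall r : 'I_n -> R,
  tors (\sum_(i in I) r i *: e i) -> forall i, i \in I -> P (r i).
have [I /maxsetP[/asboolP Iind Imax]] :
    {I : {set 'I_n} | maxset (fun I => `[< indep I >]) I}.
  by apply: ex_maxset; exists finset.set0; apply/asboolP => r _ i; rewrite inE.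
have Ptors a (x : M) : P a -> tors (a *: x).
  by move=> Pa; exists t; rewrite // scalerA mulrC Pa scale0r.
have hdep j : exists2 s, ~ P s & exists r : 'I_n -> R, tors (s *: e j - \sum_(i in I) r i *: e i).
  have [jI|jI] := boolP (j \in I).
    exists 1 => //; exists (fun i => (i == j)%:R).
    rewrite (bigD1 j) //= eqxx big1 => [|i /andP[_ /negPf ->]]; last by rewrite scale0r.
    by rewrite addr0 subrr; exact: submod0.
  have : ~ indep (j |: I).
    move=> h; have := Imax _ _ (subsetUr [set j] I); rewrite -/(is_true _).
    move=> /(_ (asboolT h)) e'; move: jI; rewrite -e' !inE eqxx //.
  move=> /existsNP[r /not_implyP[]]; rewrite big_setU1 //= => hr /existsNP[k /not_implyP[kI Pk]].
  have Prj : ~ P (r j).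
    move=> Prj; apply: Pk; have := Ptors _ (e j) Prj => /submod_addl/(_ hr) h.
    move: kI; rewrite !inE => /orP[/eqP ->//|]; apply: Iind; exact: h.
  exists (r j) => //; exists (fun i => - r i).
  rewrite -sumrN; under eq_bigr => i _ do rewrite scaleNr opprK.
  exact: hr.
have [s Ps hs] : exists2 s, ~ P s & forall x : M, exists r : 'I_n -> R,
    tors (s *: x - \sum_(i in I) r i *: e i).
  have [||s Ps hs] := @mult_set_common R (fun s => ~ P s) M [seq e i | i <- enum 'I_n]
     (fun s x => exists r : 'I_n -> R, tors (s *: x - \sum_(i in I) r i *: e i)) mP.
  - move=> x a b [r h]; exists (fun i => b * r i).
    have -> : (a * b) *: x - \sum_(i in I) (b * r i) *: e i
        = b *: (a *: x - \sum_(i in I) r i *: e i).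
      rewrite scalerBr scalerA [b * a]mulrC scaler_sumr; congr (_ - _).
      by apply: eq_bigr => i _; rewrite scalerA.
    exact: submodZ.
  - by move=> _ /mapP[i _ ->].
  exists s => // x; have [c ->] := he x.
  have [r hr] := choice (fun i => hs (e i) (map_f _ (mem_enum 'I_n i))).
  exists (fun i => \sum_j c j * r j i).
  have -> : s *: (\sum_i c i *: e i) - \sum_(i in I) (\sum_j c j * r j i) *: e i
     = \sum_j c j *: (s *: e j - \sum_(i in I) r j i *: e i).
    rewrite scaler_sumr.
    under [in RHS]eq_bigr => j _ do rewrite scalerBr scaler_sumr.
    rewrite sumrB; congr (_ - _).
      by apply: eq_bigr => j _; rewrite !scalerA mulrC.
    rewrite exchange_big /=; apply: eq_bigr => i _; rewrite scaler_suml.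
    by apply: eq_bigr => j _; rewrite scalerA.
  by apply: submod_sum => // j _; exact: submodZ.
have [r hr] := choice hs.
have runiq x (r' : 'I_n -> R) i : i \in I -> tors (s *: x - \sum_(i in I) r' i *: e i) ->
    t * r x i = t * r' i.
  move=> iI h; have := submodB htors (hr x) h.
  rewrite opprB addrC addrA subrK -sumrB.
  under eq_bigr => j _ do rewrite -scalerBl.
  move=> /Iind/(_ i iI) h'; apply/eqP; rewrite eq_sym -subr_eq0 -mulrBr mulrC.
  exact/eqP.
case: (set_0Vmem I) => [I0|[i iI]].
  have [m hm] := supported hP; have [a Pa sa] : tors m.
    have := hr m; rewrite I0 big_set0 subr0 => -[a Pa h]; exists (a * s).
      by case: mP => _; apply.
    by rewrite -scalerA.
  by have := hm a Pa sa.
have hl : linear (fun x => t * r x i : R^o).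
  move=> a x y; rewrite (runiq (a *: x + y) (fun i => a * r x i + r y i) i iI).
    by rewrite mulrDr /GRing.scale /=; ring.
  have -> : s *: (a *: x + y) - \sum_(i in I) (a * r x i + r y i) *: e i =
     a *: (s *: x - \sum_(i in I) r x i *: e i) + (s *: y - \sum_(i in I) r y i *: e i).
    rewrite scalerDr scalerBr addrACA -opprD scalerA [s * a]mulrC -scalerA; congr (_ - _).
    rewrite scaler_sumr -big_split /=; apply: eq_bigr => j _.
    by rewrite scalerDl scalerA.
  exact: (proj2 htors).
exists (lin hl), (e i) => /=.
rewrite (runiq (e i) (fun j => if j == i then s else 0) i iI) ?eqxx.
  by move=> h; have := PM t s; rewrite /P h => /(_ erefl)[].
rewrite (bigD1 i) //= eqxx big1 => [|j /andP[_ /negPf ->]]; last by rewrite scale0r.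
by rewrite addr0 subrr; exact: submod0.
Qed.

(* For [J] with zero annihilator, choose [b] in [J] with [ann (ann b)] maximal;
   if some [c] in [J] were nonzero and killed by [b], then [b + c] would beat [b]. *)
Lemma regular_in_ideal (J : R -> Prop) : is_ideal J ->
  (forall r, (forall j, J j -> r * j = 0) -> r = 0) -> exists2 b, J b & regular b.
Proof.
move=> hJ Jann.
pose ann2 b (x : R) := forall y, y * b = 0 -> x * y = 0.
have hann b : is_ideal (ann2 b).
  split; first by move=> y _; rewrite mul0r.
  move=> a x y hx hy z zb; rewrite mulrDl hy // addr0 -mulrA hx // mulr0 //.
pose F (K : R^o -> Prop) := exists2 b, J b & K = ann2 b.
have [||_ [b Jb ->] bmax] := @noetherian_module_max _ _ F noeR.
- by exists (ann2 0), 0; first exact: (ideal0 hJ).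
- by move=> K [b _ KE]; rewrite KE; exact: hann.
exists b => // r br; apply: contrapT => r0.
have [j Jj rj] : exists2 j, J j & r * j <> 0.
  apply: contrapT => h; apply: r0; apply: Jann => j Jj.
  by apply: contrapT => h'; apply: h; exists j.
pose c := r * j.
have bc : b * c = 0 by rewrite /c mulrA br mul0r.
have sq (x : R) : x * x = 0 -> x = 0 by move=> h; apply: (Rred (n := 2)); rewrite expr2.
have annD (x : R) : x * (b + c) = 0 -> x * b = 0 /\ x * c = 0.
  move=> h; have xb : x * b = 0.
    apply: sq; have -> : x * b * (x * b) = x * b * (x * (b + c)) - x * x * (b * c) by ring.
    by rewrite h bc !mulr0 subr0.
  by move: h; rewrite mulrDr xb add0r.
have h : ann2 b c.
  apply: (bmax (ann2 (b + c))).
  - by exists (b + c) => //; apply: idealD => //; exact: ideal_mull.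
  - by move=> x hx y /annD[yb _]; exact: hx.
  - by move=> y /annD[_]; rewrite mulrC.
by apply: rj; rewrite -/c; apply: sq; apply: h; rewrite mulrC.
Qed.
End Center.

Section TotalQuotientRing.
Variable R : comNzRingType.

Local Notation Q := (total_quotient_ring R).
Local Notation io := (@to_quotient R).
Local Notation den := {s : R | s \in MulSet (nonzerodivisor_closed R) (nonzerodivisor_proper R)}.

Definition qfrac (c : R) (b : den) : Q := lfrac (c : R^o) b.

Lemma qfracP (w : Q) : exists c b, w = qfrac c b.
Proof.
have [c [b wE]] := @lfracP R (MulSet (nonzerodivisor_closed R) (nonzerodivisor_proper R)) R^o w.
by exists c, b; rewrite wE.
Qed.

Lemma den_regular (b : den) : regular (sval b).
Proof. by case: b => b /= /regularP. Qed.

Lemma regular_den (b : R) : regular b -> exists b' : den, sval b' = b.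
Proof. by move=> /regularP hb; exists (exist _ b hb). Qed.

Lemma qfrac_eq c c' b b' : qfrac c b = qfrac c' b' <-> sval b' * c = sval b * c'.
Proof.
split=> [/lfrac_eq[u e]|e]; last exact: lfrac_eqW.
apply/eqP; rewrite -subr_eq0; apply/eqP; apply: (den_regular (b := u)).
by rewrite mulrBr; apply/eqP; rewrite subr_eq0; apply/eqP.
Qed.

Lemma qfracM c c' b b' : qfrac c b * qfrac c' b' = qfrac (c * c') (denM b b').
Proof. exact: loc_mulE. Qed.

Lemma ioE r : io r = qfrac r (den1 _).
Proof. by []. Qed.

Lemma io_qfrac c b : io (sval b) * qfrac c b = io c.
Proof. by rewrite !ioE qfracM; apply/qfrac_eq; rewrite /=; ring. Qed.

Lemma io_unit b : regular b -> exists v : Q, v * io b = 1.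
Proof.
move=> /regular_den[b' <-]; exists (qfrac 1 b').
by rewrite mulrC io_qfrac rmorph1.
Qed.

Lemma io_cancel b (v w : Q) : regular b -> io b * v = io b * w -> v = w.
Proof.
move=> /io_unit[u ub] e; rewrite -[v]mul1r -[w]mul1r -ub -!mulrA.
by rewrite e.
Qed.

Lemma io_eq_qfrac w b c : io (sval b) * w = io c -> w = qfrac c b.
Proof.
by move=> e; apply: (io_cancel (@den_regular b)); rewrite e io_qfrac.
Qed.

Lemma common_denominator n (u : 'I_n -> Q) :
  exists2 b, regular b & forall i, exists a, io b * u i = io a.
Proof.
elim: n u => [|n IH] u; first by exists 1; [exact: regular1|case].
have [b hb hu] := IH (fun i => u (lift ord0 i)).
have [c [b0 u0]] := qfracP (u ord0); exists (b * sval b0).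
  by apply: regularM => //; exact: den_regular.
move=> i; case: (unliftP ord0 i) => [j|] ->.
  have [a ha] := hu j; exists (a * sval b0).
  by rewrite !rmorphM mulrAC ha.
by exists (b * c); rewrite u0 !rmorphM -mulrA io_qfrac.
Qed.
End TotalQuotientRing.

Section CenterNormalization.
Variables (R : comNzRingType) (M : lmodType R).
Hypothesis noeR : noetherian_module (R^o : lmodType R).
Hypothesis Rred : reduced R.
Hypothesis fgM : finitely_generated M.
Hypothesis Mtf : torsion_free M.
Hypothesis Msupp : forall p, supp M p <-> supp (R^o : lmodType R) p.

Local Notation Q := (total_quotient_ring R).
Local Notation io := (@to_quotient R).
Local Notation A := (End_alg M).
Implicit Types (f g : A) (v w : Q).

Definition acts_as f w := forall c b, w = qfrac c b -> forall m : M, sval b *: (f : End_ring M) m = c *: m.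

Lemma alg_mapE (r : R) (m : M) : (alg_map A r : End_ring M) m = r *: m.
Proof. by []. Qed.

Lemma acts_asE f c b : acts_as f (qfrac c b) <-> forall m : M, sval b *: (f : End_ring M) m = c *: m.
Proof.
split=> [h|h c' b' /qfrac_eq e] m; first exact: h.
apply: (regular_cancel Mtf (@den_regular _ b)).
by rewrite scalerA mulrC -scalerA h !scalerA e mulrC.
Qed.

Lemma acts_as_io r : acts_as (alg_map A r) (io r).
Proof. by rewrite ioE; apply/acts_asE => m; rewrite alg_mapE scale1r. Qed.

Lemma acts_asM f g v w : acts_as f v -> acts_as g w -> acts_as (f * g) (v * w).
Proof.
have [c [b ->]] := qfracP v; have [c' [b' ->]] := qfracP w.
move=> /acts_asE hf /acts_asE hg; rewrite qfracM; apply/acts_asE => m.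
change ((sval b * sval b') *: (f : End_ring M) ((g : End_ring M) m) = (c * c') *: m).
rewrite [sval b * _]mulrC -[(_ * sval b) *: _]scalerA hf scalerA [sval b' * _]mulrC.
by rewrite -[in LHS]scalerA hg scalerA.
Qed.

Lemma acts_asB f g v w : acts_as f v -> acts_as g w -> acts_as (f - g) (v - w).
Proof.
have [c [b ->]] := qfracP v; have [c' [b' ->]] := qfracP w.
move=> /acts_asE hf /acts_asE hg.
have -> : qfrac c b - qfrac c' b' = qfrac (sval b' * c - sval b * c') (denM b b').
  apply: io_eq_qfrac; rewrite /= mulrBr !rmorphB !rmorphM.
  by rewrite mulrAC io_qfrac -mulrA io_qfrac [io c * _]mulrC.
apply/acts_asE => m.
change ((sval b * sval b') *: ((f : End_ring M) m - (g : End_ring M) m)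
  = (sval b' * c - sval b * c') *: m).
rewrite scalerBr scalerBl; congr (_ - _); last by rewrite -!scalerA hg.
by rewrite mulrC -!scalerA hf.
Qed.

Lemma acts_as_inj f g w : acts_as f w -> acts_as g w -> f = g.
Proof.
have [c [b ->]] := qfracP w => /acts_asE hf /acts_asE hg.
apply: End_ringP => m; apply: (regular_cancel Mtf (@den_regular _ b)).
by rewrite hf hg.
Qed.

Lemma acts_as_uniq f v w : acts_as f v -> acts_as f w -> v = w.
Proof.
have [c [b ->]] := qfracP v; have [c' [b' ->]] := qfracP w.
move=> /acts_asE hf /acts_asE hg; apply/qfrac_eq/eqP; rewrite -subr_eq0; apply/eqP.
apply: (faithful noeR Rred Msupp) => m; rewrite scalerBl -!scalerA -hf -hg !scalerA.
by rewrite mulrC subrr.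
Qed.

Lemma acts_as_central f w : acts_as f w -> f \in @central R A.
Proof.
have [c [b ->]] := qfracP w => /acts_asE hf; apply/asboolP => g.
apply: End_ringP => m; apply: (regular_cancel Mtf (@den_regular _ b)).
change (sval b *: (f : End_ring M) ((g : End_ring M) m)
  = sval b *: (g : End_ring M) ((f : End_ring M) m)).
have gZ a x : (g : End_ring M) (a *: x) = a *: (g : End_ring M) x by exact: linearZ.
by rewrite hf -[RHS]gZ hf gZ.
Qed.

Lemma acts_as_cancel c f g v : regular c -> alg_map A c * f = g ->
  acts_as g (io c * v) -> acts_as f v.
Proof.
move=> hc; have [a [b ->]] := qfracP v => <-; rewrite ioE qfracM.
move=> /acts_asE h; apply/acts_asE => m; apply: (regular_cancel Mtf hc).
have := h m; rewrite /= mul1r -scalerA => <-.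
by rewrite scalerA mulrC -scalerA.
Qed.

Lemma central_acts_as f : f \in @central R A -> exists w, acts_as f w.
Proof.
move=> /asboolP fC.
pose J (b : R) := exists c, forall m : M, b *: (f : End_ring M) m = c *: m.
have hJ : is_ideal J.
  split; first by exists 0 => m; rewrite !scale0r.
  move=> a x y [c hc] [d hd]; exists (a * c + d) => m.
  by rewrite !scalerDl -!scalerA hc hd.
have hphi (phi : {linear M -> (R^o : lmodType R)}) m : J (phi m).
  exists (phi ((f : End_ring M) m)) => m'.
  have hl : linear (fun x => (phi x : R) *: m').
    by move=> a x y; rewrite linearP scalerDl scalerA.
  pose g : End_ring M := lin hl.
  have : (f : End_ring M) (g m) = g ((f : End_ring M) m).
    exact: (congr1 (fun h : End_ring M => (h : {linear M -> M}) m) (fC g)).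
  by rewrite /= linearZ.
have [|b [c hc] /regular_den[b' bE]] := regular_in_ideal noeR Rred hJ.
  move=> r rJ; apply: contrapT => r0.
  have [r' hP] := @associated_prime0 R noeR (R^o : lmodType R) r r0.
  have [phi [m pm]] := functional_exists Rred fgM Msupp hP; apply: pm.
  have -> : (phi m : R) * (r' *: (r : R^o)) = r' * (r * phi m) by rewrite /GRing.scale /=; ring.
  by rewrite rJ ?mulr0.
by exists (qfrac c b'); apply/acts_asE => m; rewrite bE hc.
Qed.

Lemma acts_asX f w n : acts_as f w -> acts_as (f ^+ n) (w ^+ n).
Proof.
move=> h; elim: n => [|n IH]; last by rewrite !exprS; exact: acts_asM.
by rewrite !expr0 -(rmorph1 io) -(rmorph1 (alg_map A)); exact: acts_as_io.
Qed.

Lemma acts_as_sum n (F : 'I_n -> A) (W : 'I_n -> Q) :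
  (forall i, acts_as (F i) (W i)) -> acts_as (\sum_i F i) (\sum_i W i).
Proof.
have h0 : acts_as 0 0 by rewrite -(rmorph0 io) -(rmorph0 (alg_map A)); exact: acts_as_io.
move=> h; apply: (big_ind2 acts_as) => // f v g w hf hg.
have -> : f + g = f - (0 - g) by rewrite sub0r opprK.
have -> : v + w = v - (0 - w) by rewrite sub0r opprK.
by apply: acts_asB => //; exact: acts_asB.
Qed.

Lemma acts_as_integral f w : acts_as f w -> w \in @integral R.
Proof.
move=> fw; have [n [r hr]] := monic_relation (f : End_ring M) fgM.
have fX k (m : M) : (f ^+ k : End_ring M) m = iter k (f : End_ring M) m.
  by elim: k => [|k IH]; rewrite ?expr0 // exprS /= -IH.
have e : f ^+ n = \sum_(i < n) alg_map A (r i) * f ^+ i.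
  apply: End_ringP => m; rewrite fX hr.
  have -> : forall F : 'I_n -> A, (\sum_i F i : End_ring M) m = \sum_i (F i : End_ring M) m.
    move=> F; elim/big_rec2: _ => // i x y _ <-; by [].
  by apply: eq_bigr => i _; rewrite -fX.
have we : w ^+ n = \sum_(i < n) io (r i) * w ^+ i.
  apply: (acts_as_uniq (f := f ^+ n)); first exact: acts_asX.
  rewrite e; apply: acts_as_sum => i; apply: acts_asM; [exact: acts_as_io|exact: acts_asX].
apply/asboolP; exists ('X^n - \poly_(i < n) r i).
  rewrite monicE lead_coefDl ?lead_coefXn // size_polyN size_polyXn ltnS.
  exact: size_poly.
rewrite rootE rmorphB /= map_polyXn hornerD hornerN hornerXn we.
rewrite poly_def rmorph_sum /= horner_sum -sumrB big1 // => i _.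
by rewrite map_polyZ /= map_polyXn hornerZ hornerXn subrr.
Qed.
End CenterNormalization.

(* Dual bases: if [i : K -> B] is the left ideal generated by the central [es], and
   [h] is the coordinate map of an [s]-splitting, then [h] commutes with the
   multiplication by [e' e = e * (e0 / c0)]. *)
Lemma scaled_projective_cancel (B : pzRingType) (K : lmodType B)
    (i : {linear K -> (B^o : lmodType B)}) (es : seq B^o) (e' : B -> B) (s c0 e0 : B) :
  injective i -> (forall b : B^o, lspan es b <-> exists k, i k = b) ->
  scaled_projective s K -> (forall b, c0 * b = b * c0) -> (forall b, e0 * b = b * e0) ->
  (forall b, s * b = b * s) -> lspan es c0 ->
  (forall e, e \in es -> [/\ forall b, e * b = b * e, forall b, e' e * b = b * e' e,
     lspan es (e' e) & c0 * e' e = e * e0]) ->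
  exists a, c0 * c0 * a = s * c0 * e0.
Proof.
move=> ii iE hK c0C e0C sC /iE[k0 ik0] hes.
pose e j : B := es`_j; have ej (j : 'I_(size es)) : e j \in es by exact: mem_nth.
have /choice[k ik] : forall j : 'I_(size es), exists x, i x = e j.
  by move=> j; apply/iE/lspan_mem.
have /choice[k' ik'] : forall j : 'I_(size es), exists x, i x = e' (e j).
  by move=> j; apply/iE; case: (hes _ (ej j)).
have [p pE] := free_module_lift k.
have ip c : i (p c) = \sum_j (c j : B) * e j.
  by rewrite pE linear_sum; apply: eq_bigr => j _; rewrite linearZ /= ik.
have ps : surj p.
  move=> x; have /iE/lspan_ordP[c xE] : exists y, i y = i x by exists x.
  by exists [ffun j => c j]; apply: ii; rewrite ip xE; apply: eq_bigr => j _; rewrite ffunE.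
have [h ph] := hK _ _ p idfun ps.
have ih y : \sum_j (h y j : B) * e j = s * i y by rewrite -ip ph linearZ.
exists (\sum_j (h (k' j) j : B)); rewrite -mulrA mulr_sumr mulr_sumr.
have hc j : c0 * (h (k' j) j : B) = e' (e j) * (h k0 j : B).
  have : c0 *: k' j = e' (e j) *: k0.
    apply: ii; rewrite !linearZ /= ik' ik0; exact: c0C.
  by move=> /(congr1 h); rewrite !linearZ => /ffunP/(_ j); rewrite !ffunE.
transitivity (\sum_j (h k0 j : B) * e j * e0).
  apply: eq_bigr => j _; rewrite hc mulrA.
  have [eC _ _ ->] := hes _ (ej j).
  by rewrite -[LHS]mulrA e0C mulrA eC.
by rewrite -mulr_suml ih ik0.
Qed.

(* Read [c0] as an element of a left ideal generated by central [es], and [e' e] as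
   [e * g] for the central fraction [g = e0 / c0]: the ideal is then stable under [g],
   and the conclusion says that [s g] lies in [A]. *)
Definition central_cancellation (R : comNzRingType) (A : ralgebra R) (p : R -> Prop) :=
  forall (es : seq (A : pzRingType)^o) (e' : A -> A) (c0 e0 : A),
    (forall b, c0 * b = b * c0) -> (forall b, e0 * b = b * e0) -> lspan es c0 ->
    (forall e, e \in es -> [/\ forall b, e * b = b * e, forall b, e' e * b = b * e' e,
       lspan es (e' e) & c0 * e' e = e * e0]) ->
    exists2 s, ~ p s & exists a, c0 * c0 * a = alg_map A s * c0 * e0.

Section Integral.
Variables (R : comNzRingType) (M : lmodType R).
Hypothesis noeR : noetherian_module (R^o : lmodType R).
Hypothesis Rred : reduced R.
Hypothesis fgM : finitely_generated M.
Hypothesis Mtf : torsion_free M.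
Hypothesis Msupp : forall p, supp M p <-> supp (R^o : lmodType R) p.
Local Notation A := (End_alg M).
Hypothesis fgA : finitely_generated (alg_mod A : lmodType R).

Local Notation Q := (total_quotient_ring R).
Local Notation io := (@to_quotient R).

Lemma integral_denominator (w : Q) : w \in @integral R ->
  exists2 b, regular b & forall q : {poly R}, exists a, io b * (map_poly io q).[w] = io a.
Proof.
move=> /asboolP[p pm /eqP pw].
have [b hb hw] := common_denominator (fun i : 'I_(size p).-1 => w ^+ i).
exists b => // q.
pose r := Pdiv.CommonRing.rmodp q p.
have -> : (map_poly io q).[w] = (map_poly io r).[w].
  rewrite [in LHS](Pdiv.RingMonic.rdivp_eq pm q) rmorphD rmorphM hornerD hornerM.
  by rewrite pw mulr0 add0r.
have [a ha] := choice hw.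
exists (\sum_(i < (size p).-1) r`_i * a i).
have rs : (size r <= (size p).-1)%N.
  have p0 : p != 0 by exact: monic_neq0.
  by have := Pdiv.CommonRing.ltn_rmodpN0 q p0; rewrite -/r; case: (size p).
rewrite (horner_coef_wide _ (n := (size p).-1)); last first.
  by apply: leq_trans rs; exact: size_poly.
rewrite rmorph_sum mulr_sumr; apply: eq_bigr => i _.
by rewrite coef_map rmorphM mulrCA ha.
Qed.

(* Among the elements of [R[w]] not acting on [M], some [g] has a prime annihilator
   [p] modulo those that do; the cancellation is applied to the conductor of [R[w]]. *)
Lemma integral_acts :
  (forall p c0 (e0 : A), is_prime p -> regular c0 ->
     (forall r, p r <-> exists a, alg_map A r * e0 = alg_map A c0 * a) ->
     central_cancellation A p) ->
  forall w : Q, w \in @integral R -> exists f : A, acts_as f w.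
Proof.
move=> hcancel w wi; have [b0 b0reg b0w] := integral_denominator wi.
pose D (v : Q) := exists f : A, acts_as f v.
have /choice[fD fDE] : forall v : Q, exists f : A, D v -> acts_as f v.
  move=> v; case: (pselect (D v)) => [[f fv]|h]; first by exists f.
  by exists 0.
have Dio r : D (io r) by exists (alg_map A r); exact: acts_as_io.
have DM v v' : D v -> D v' -> D (v * v') by move=> [f hf] [g hg]; exists (f * g); exact: acts_asM.
have DB v v' : D v -> D v' -> D (v - v') by move=> [f hf] [g hg]; exists (f - g); exact: acts_asB.
pose C (v : Q) := exists q : {poly R}, v = (map_poly io q).[w].
have CM v v' : C v -> C v' -> C (v * v').
  by move=> [q ->] [q' ->]; exists (q * q'); rewrite rmorphM hornerM.
have Cio r : C (io r) by exists r%:P; rewrite map_polyC hornerC.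
have b0C v : C v -> D (io b0 * v) by move=> [q ->]; have [a ->] := b0w q.
suff CD v : C v -> D v by apply: CD; exists 'X; rewrite map_polyX hornerX.
move=> Cv; apply: contrapT => Dv.
pose ann v r := D (io r * v).
have hann v' : is_ideal (ann v').
  rewrite /ann; split; first by rewrite rmorph0 mul0r -(rmorph0 io).
  move=> a x y hx hy.
  have -> : io (a *: x + y) * v' = io a * (io x * v') - (io 0 - io y * v').
    by rewrite rmorphD rmorphM rmorph0 sub0r opprK mulrDl mulrA.
  by apply: (DB) => //; [apply: DM|apply: DB].
pose F (J : R^o -> Prop) := exists v', [/\ C v', ~ D v' & J = ann v'].
have [||_ [g [Cg Dg ->]] gmax] := @noetherian_module_max _ _ F noeR.
- by exists (ann v), v.
- by move=> J [v' [_ _ ->]]; exact: hann.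
set p := ann g in gmax.
have pp : is_prime p.
  split; [exact: hann|by rewrite /p /ann rmorph1 mul1r|move=> a b hab].
  case: (pselect (p b)) => [|pb]; [by right|left].
  apply: (gmax (ann (io b * g))).
  - by exists (io b * g); split=> //; apply: CM.
  - move=> x px; rewrite /ann mulrCA; exact: DM.
  - by rewrite /ann mulrA -rmorphM.
pose cc (c : Q) := forall u, C u -> D (c * u).
have ccD c : cc c -> D c by move=> /(_ 1); rewrite mulr1; apply; rewrite -(rmorph1 io).
have ccC c u : cc c -> C u -> cc (c * u) by move=> hc Cu u' Cu'; rewrite -mulrA; apply/hc/CM.
have ccb0 : cc (io b0) by [].
pose G (N : restr (A^o : lmodType A) -> Prop) :=
  exists cs : seq Q, (forall c, c \in cs -> cc c) /\ N = lspan [seq fD c : A^o | c <- cs].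
have [||_ [cs [hcs ->]] csmax] := @noetherian_module_max _ _ G (fg_noetherian noeR (fg_regular fgA)).
- by exists (lspan [seq fD c : A^o | c <- [::]]), [::].
- by move=> N [cs [_ ->]]; apply: restr_submod; exact: lspan_submod.
set es := [seq fD c : A^o | c <- cs] in csmax.
have hes c : cc c -> lspan es (fD c).
  move=> hc; apply: (csmax (lspan [seq fD c : A^o | c <- c :: cs])).
  - by exists (c :: cs); split=> // c'; rewrite in_cons => /orP[/eqP ->|/hcs].
  - by move=> x; apply: lspan_sub => y hy; rewrite in_cons hy orbT.
  - by apply: lspan_mem; exact: mem_head.
have inj := acts_as_inj Mtf.
have /choice[e' e'E] : forall e : A, exists f : A,
    forall v, acts_as e v -> cc v -> acts_as f (v * g).
  move=> e; case: (pselect (exists2 v, acts_as e v & cc v)) => [[v' ev' cv']|h].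
    exists (fD (v' * g)) => v'' ev'' _.
    by rewrite -(acts_as_uniq noeR Rred Mtf Msupp ev' ev''); apply/fDE/cv'.
  by exists 0 => v' ev' cv'; case: h; exists v'.
have central_of f u : acts_as f u -> forall b : A, f * b = b * f.
  by move=> /(acts_as_central Mtf)/asboolP.
pose c0 := alg_map A b0; pose e0 := fD (io b0 * g).
have e0E : acts_as e0 (io b0 * g) by apply: fDE; exact: b0C.
have c0E : acts_as c0 (io b0) by exact: acts_as_io.
have [] := hcancel p b0 e0 pp b0reg _ es e' c0 e0 _ _ _ _.
- move=> r; split.
    move=> [f rf]; exists f; apply: (inj _ _ (io r * (io b0 * g))).
      by apply: acts_asM => //; exact: acts_as_io.
    by rewrite mulrCA; exact: acts_asM.
  move=> [a ha]; exists a; apply: (acts_as_cancel Mtf b0reg (esym ha)).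
  by rewrite mulrCA; apply: acts_asM => //; exact: acts_as_io.
- exact: central_of c0E.
- exact: central_of e0E.
- rewrite (_ : c0 = fD (io b0)); first exact: hes.
  by apply: (inj _ _ (io b0)) => //; exact: fDE.
- move=> _ /mapP[c ccs ->]; have hc := hcs c ccs.
  have fc := fDE _ (ccD _ hc); have e'c := e'E _ _ fc hc.
  split; [exact: central_of fc|exact: central_of e'c| |].
    rewrite (_ : e' (fD c) = fD (c * g)); first by apply: hes; exact: ccC.
    by apply: (inj _ _ (c * g)) => //; apply: fDE; exact: hc.
  apply: (inj _ _ (io b0 * (c * g))); first exact: acts_asM.
  by rewrite mulrCA; exact: acts_asM.
move=> s ps [a ha]; apply: ps; exists a.
apply: (acts_as_cancel Mtf b0reg erefl).
apply: (acts_as_cancel Mtf b0reg (esym _)); last first.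
  have : acts_as (alg_map A s * c0 * e0) (io s * io b0 * (io b0 * g)).
    apply: acts_asM => //; apply: acts_asM => //; exact: acts_as_io.
  have -> : io s * io b0 * (io b0 * g) = io b0 * (io b0 * (io s * g)).
    by rewrite [io s * _]mulrC -mulrA [io s * _]mulrCA.
  exact.
by rewrite -ha mulrA.
Qed.
End Integral.

Lemma regular_module_projective (B : pzRingType) : projective_module (B^o : lmodType B).
Proof.
move=> M N g f gs; have [x gx] := gs (f 1).
have hl : linear (fun b : B^o => (b : B) *: x).
  by move=> a b c; rewrite scalerDl scalerA.
by exists (lin hl) => b; rewrite /= linearZ /= gx -linearZ /GRing.scale /= mulr1.
Qed.

Lemma leastP (P : nat -> Prop) n :
  least P = Some n -> P n /\ forall k, P k -> (n <= k)%N.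
Proof.
rewrite /least; case: pselect => // ex [<-].
by case: ex_minnP => k /asboolP Pk kmin; split=> // l Pl; apply/kmin/asboolP.
Qed.

Lemma leastE (P : nat -> Prop) n : P n -> (forall k, P k -> (n <= k)%N) -> least P = Some n.
Proof.
move=> Pn nmin; rewrite /least; case: pselect => [ex|[]]; last by exists n; apply/asboolP.
congr Some; case: ex_minnP => k /asboolP Pk kmin; apply/eqP.
by rewrite eqn_leq nmin // kmin //; apply/asboolP.
Qed.

Section Homogeneous.
Variables (R : comNzRingType) (A : ralgebra R).
Hypothesis noeR : noetherian_module (R^o : lmodType R).
Hypothesis fgA : finitely_generated (alg_mod A : lmodType R).

Lemma gldim_at_cancellation p : is_prime p -> gldim_at A p 1%N -> central_cancellation A p.
Proof.
move=> pp hG es e' c0 e0 c0C e0C hc0 hes.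
have hI := lspan_submod es.
have [K [Q [f [g [ses gE]]]]] := submod_short_exact hI.
have [fi gs fge] := ses.
have fQ : fg Q := fg_surj gs (fg_regular fgA).
have [_ [s ps ->] hs] : pd_at p 0%N K.
  exact: (local_pd_syzygy (n := 0) (@away1 _ A _ pp) (@awayM _ A _ pp) (@awayC _ A p) ses
    (@regular_module_projective A) (hG Q fQ)).
exists s => //; apply: (scaled_projective_cancel (i := f) (es := es) (e' := e')) => //.
- by move=> b; rewrite gE; exact: fge.
- by move=> b; rewrite alg_mapC.
Qed.

Lemma homogeneous_gldim_at p c0 (e0 : A) : homologically_homogeneous A -> is_prime p ->
  (forall a : A, alg_map A c0 * a = 0 -> a = 0) ->
  (forall r, p r <-> exists a, alg_map A r * e0 = alg_map A c0 * a) -> gldim_at A p 1%N.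
Proof.
move=> [_ _ hh] pp c0reg pE; have [pi p1 pM] := pp.
have [m [mi m1 pm mmax]] := maximal_ideal_exists noeR pi p1.
have {}mmax := maximal_inverse mi mmax.
have mp := maximal_ideal_prime mi m1 mmax.
pose killed (S : lmodType A) := forall a, m a -> forall x : S, alg_map A a *: x = 0.
have annE (S : lmodType A) : simple_module S -> killed S ->
    forall r, (forall x : S, alg_map A r *: x = 0) <-> m r.
  move=> [[x x0] _] mS r; split=> [rS|]; last exact: mS.
  apply: contrapT => /mmax[r' hr]; apply: x0; have := mS _ hr x.
  by rewrite rmorphB scalerBl rmorphM -scalerA rS scaler0 subr0 rmorph1 scale1r.
have [d hd] : exists d, forall S : lmodType A, simple_module S -> killed S ->
    has_projective_resolution S d /\ forall n, has_projective_resolution S n -> (d <= n)%N.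
  case: (pselect (exists2 S : lmodType A, simple_module S & killed S)) => [[S Ss mS]|hno]; last first.
    by exists 0%N => S Ss mS; case: hno; exists S.
  have [d [/leastP hS _]] := hh S S Ss Ss (fun r => iff_refl _).
  exists d => T Ts mT; have [|n [/leastP[Sn nmin] /leastP hT]] := hh S T Ss Ts.
    by move=> r; rewrite annE // annE.
  have -> : d = n; last exact: hT.
  by apply/eqP; rewrite eqn_leq (proj2 hS n Sn) nmin //; case: hS.
have [Q [g [gs gE]]] := regular_quotient_exists c0 (A^o : lmodType A).
apply: (associated_gldim noeR fgA mp mmax hd (Y := Q) (u := g e0)) => //.
- exact: fg_surj gs (fg_regular fgA).
- by move=> r; rewrite pE -linearZ gE.
have c0i : injective (lin (scale_alg_linear c0 (L := (A^o : lmodType A)))).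
  move=> x y /= /eqP; rewrite -subr_eq0 -scalerBr => /eqP/c0reg/eqP.
  by rewrite subr_eq0 => /eqP.
have ses : short_exact (lin (scale_alg_linear c0 (L := (A^o : lmodType A)))) g.
  by split=> // v; rewrite gE; split=> -[w e]; exists w.
apply: (local_pd_quotient (@awayM _ A _ mp) (@awayC _ A m) ses);
  exact: (local_pd_projective (@away1 _ A _ mp) _ (@regular_module_projective A)).
Qed.
End Homogeneous.

Section Isomorphism.
Variables (R : comNzRingType) (M : lmodType R).
Hypothesis noeR : noetherian_module (R^o : lmodType R).
Hypothesis Rred : reduced R.
Hypothesis fgM : finitely_generated M.
Hypothesis Mtf : torsion_free M.
Hypothesis Msupp : forall p, supp M p <-> supp (R^o : lmodType R) p.
Local Notation A := (End_alg M).
Local Notation Q := (total_quotient_ring R).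
Local Notation io := (@to_quotient R).

Lemma center_normalization_isomorphic :
  (forall w : Q, w \in @integral R -> exists f : A, acts_as f w) ->
  alg_isomorphic (center A) (normalization R).
Proof.
move=> hI.
have /choice[phi hphi] : forall z : center_ring A, exists w : normalization_ring R,
    acts_as (val z) (val w).
  move=> z; have [w zw] := central_acts_as noeR Rred fgM Mtf Msupp (valP z).
  have wi := acts_as_integral noeR Rred fgM Mtf Msupp zw.
  by exists (NormalizationRing wi).
have uniq f v w := @acts_as_uniq _ _ noeR Rred Mtf Msupp f v w.
have inj f g w := @acts_as_inj _ _ Mtf f g w.
have phi_zmod : zmod_morphism phi.
  move=> x y; apply: val_inj; apply: (uniq _ _ _ (hphi (x - y))).
  by rewrite !raddfB; apply: acts_asB => //; exact: hphi.
have phi_monoid : monoid_morphism phi.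
  split=> [|x y]; apply: val_inj.
    apply: (uniq _ _ _ (hphi 1)).
    by rewrite /= -(rmorph1 io) -(rmorph1 (alg_map A)); exact: acts_as_io.
  by apply: (uniq _ _ _ (hphi (x * y))); rewrite !rmorphM; apply: acts_asM => //; exact: hphi.
pose Phi : {rmorphism center A -> normalization R} :=
  HB.pack phi (GRing.isZmodMorphism.Build _ _ phi phi_zmod)
    (GRing.isMonoidMorphism.Build _ _ phi phi_monoid).
have /choice[psi hpsi] : forall w : normalization_ring R, exists z : center_ring A,
    acts_as (val z) (val w).
  move=> w; have [f fw] := hI _ (valP w).
  by exists (CenterRing (acts_as_central Mtf fw)).
exists Phi.
  exists psi => x; apply: val_inj.
    exact: (inj _ _ _ (hpsi _)).
  exact: (uniq _ _ _ (hphi _)).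
move=> r; apply: val_inj; apply: (uniq _ _ _ (hphi _)).
exact: acts_as_io.
Qed.
End Isomorphism.

Lemma homogeneous_center (R : comNzRingType) (Rnoeth : noetherian R) (Rred : reduced R)
    (M : lmodType R) : finitely_generated M -> torsion_free M ->
     (forall p, supp M p <-> supp (R^o : lmodType R) p) ->
     homologically_homogeneous (End_alg M) ->
     alg_isomorphic (center (End_alg M)) (normalization R).
Proof.
move=> fgM Mtf Msupp hh.
have noeR : noetherian_module (R^o : lmodType R) := left_noetherianP (proj1 Rnoeth).
have [fgA _ _] := hh.
apply: center_normalization_isomorphic => //.
apply: integral_acts => // p c0 e0 pp c0reg pE.
apply: gldim_at_cancellation => //.
apply: (@homogeneous_gldim_at _ _ noeR fgA p c0 e0 hh pp _ pE) => a ha.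
apply: End_ringP => x; apply: (regular_cancel Mtf c0reg).
rewrite -[LHS]/((alg_map (End_alg M) c0 * a : End_ring M) x) ha.
by rewrite scaler0.
Qed.

(** * Depth over a local ring *)

Lemma noetherian_quotient (B : pzRingType) (V L : lmodType B) (g : {linear V -> L}) :
  surj g -> noetherian_module V -> noetherian_module L.
Proof.
move=> gs noeV N hN.
have hN' : is_submod (fun v => N (g v)).
  split; first by rewrite linear0; exact: submod0.
  by move=> a x y Nx Ny; rewrite linearP; apply: (proj2 hN).
have [t tE] := noeV _ hN'; exists (map g t) => y; split; last first.
  apply: lspan_min => // _ /mapP[x xt ->]; apply/(tE x); exact: lspan_mem.
have [x <-] := gs y => /(tE x); elim: t {tE} x => [|e t IH] x /=.
  by move=> ->; rewrite linear0.
by move=> [r [z [/IH h ->]]]; exists r, (g z); rewrite linearP.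
Qed.

Section Depth.
Variables (S : comNzRingType) (n : S -> Prop) (Y : lmodType S).
Hypothesis noeS : noetherian_module (S^o : lmodType S).
Hypothesis noeY : noetherian_module Y.
Hypotheses (nI : is_ideal n) (n1 : ~ n 1) (nU : forall x, ~ n x -> exists y, y * x = 1).
Implicit Types (N U : Y -> Prop) (x y z : S).

(* A submodule [N] of [Y] stands for the module [Y / N], and [quot N x] for its
   quotient [Y / (N + x Y)]. *)
Definition quot N x (v : Y) := exists2 w, N w & exists u, v - w = x *: u.

Definition regular_on N x := forall u, N (x *: u) -> N u.

Fixpoint regular_seq N (s : seq S) : Prop :=
  if s is x :: s' then [/\ n x, regular_on N x & regular_seq (quot N x) s']
  else exists v, ~ N v.

Lemma local_prime : is_prime n.
Proof.
split=> // a b nab; apply: contrapT => /not_orP[/nU[a' ha] nb]; apply: nb.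
by rewrite -[b]mul1r -ha -mulrA; exact: ideal_mull.
Qed.

Lemma quot_memP N x v : is_submod N -> quot N x v <-> exists w u, N w /\ v = w + x *: u.
Proof.
move=> hN; split=> [[w Nw [u e]]|[w [u [Nw ->]]]].
  by exists w, u; split=> //; rewrite -e addrC subrK.
by exists w => //; exists u; rewrite addrC addKr.
Qed.

Lemma quot_submod N x : is_submod N -> is_submod (quot N x).
Proof.
move=> hN; apply: (submod_add hN (N' := fun v => exists u, v = x *: u)).
split; first by exists 0; rewrite scaler0.
move=> a _ _ [u ->] [v ->]; exists (a *: u + v).
by rewrite scalerDr !scalerA mulrC.
Qed.

Lemma quot_sub N x v : is_submod N -> N v -> quot N x v.
Proof. by move=> hN Nv; exists v => //; exists 0; rewrite subrr scaler0. Qed.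

Lemma quot_scale N x v : is_submod N -> quot N x (x *: v).
Proof. by move=> hN; exists 0; [exact: submod0|exists v; rewrite subr0]. Qed.

Lemma quotC N x z : is_submod N -> quot (quot N x) z = quot (quot N z) x.
Proof.
move=> hN; suff sub a b v : quot (quot N a) b v -> quot (quot N b) a v.
  by apply/funext => v; apply/propext; split; exact: sub.
move=> /(quot_memP _ _ (quot_submod _ hN))[w [u [/(quot_memP _ _ hN)[w' [u' [Nw' ->]]] ->]]].
apply/(quot_memP _ _ (quot_submod _ hN)); exists (w' + b *: u), u'; split.
  by apply/(quot_memP _ _ hN); exists w', u.
by rewrite addrAC.
Qed.

Lemma local_nakayama N U x : is_submod N -> is_submod U -> n x ->
  (forall u, U u -> exists w v, [/\ N w, U v & u = w + x *: v]) -> forall u, U u -> N u.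
Proof.
move=> hN hU nx h.
have [t tE] := noeY hU.
have hx := principal_ideal x.
have [w _ nw [r ->]|e /lspan_mem/tE/h[w [v [Nw /tE Uv eE]]]|s ns hs] := @nakayama S (fun s => ~ n s)
    (fun x' => exists r, x' = r * x) Y N t (prime_mult_set local_prime) hx hN.
- move=> h'; apply: nw; rewrite -[w](subrK (r * x)).
  by apply: idealD => //; exact: ideal_mull.
- exists 1 => //; rewrite scale1r eE.
  apply: submodD; [exact: ideal_span_submod| |].
    elim: (t) => //= f t' IH; exists 0, w; split=> //; first by exists 0; rewrite mul0r.
    by rewrite scale0r add0r.
  elim: (t) (v) Uv => [|f t' IH] z /=; first by move=> ->; rewrite scaler0; exact: submod0.
  move=> [r [z' [/IH h' ->]]]; exists (r * x), (x *: z'); split=> //; first by exists r.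
  by rewrite scalerDr scalerA mulrC.
have [s' ss'] := nU ns; have su : is_submod (fun u => N (s *: u)).
  split; first by rewrite scaler0; exact: submod0.
  move=> a y z hy hz; rewrite scalerDr scalerA mulrC -scalerA.
  exact: (proj2 hN).
move=> u /tE tu; rewrite -[u]scale1r -ss' -scalerA; apply: submodZ => //.
exact: (lspan_min su hs tu).
Qed.

Lemma regular_on_swap N y z : is_submod N -> regular_on N y -> regular_on (quot N y) z ->
  regular_on (quot N z) y.
Proof.
move=> hN hy hz u /(quot_memP _ _ hN)[w [v [Nw e]]].
have /hz/(quot_memP _ _ hN)[w' [v' [Nw' e']]] : quot N y (z *: v).
  apply/(quot_memP _ _ hN); exists (- w), u; split; first exact: submodN.
  by rewrite e addKr.
have Nuv : N (u - z *: v').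
  apply: hy; rewrite scalerBr e e' scalerDr.
  have -> : w + (z *: w' + z *: (y *: v')) - y *: (z *: v') = w + z *: w'.
    by rewrite !scalerA [y * z]mulrC addrA addrK.
  by apply: submodD => //; exact: submodZ.
by exists (u - z *: v') => //; exists v'; rewrite opprB addrC subrK.
Qed.

Definition socle N (u : Y) := forall a, n a -> N (a *: u).

Lemma socle_transfer N x y u : is_submod N -> n y -> regular_on N x -> regular_on N y ->
  socle (quot N x) u -> ~ quot N x u ->
  exists2 v, socle (quot N y) v & ~ quot N y v.
Proof.
move=> hN ny hx hy su nu.
have /(quot_memP _ _ hN)[w [v [Nw e]]] := su y ny.
exists v => [a na|/(quot_memP _ _ hN)[w' [v' [Nw' ve]]]].
  have /(quot_memP _ _ hN)[w1 [u1 [Nw1 e1]]] := su a na.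
  apply/(quot_memP _ _ hN); exists (a *: v - y *: u1), u1; split; last by rewrite subrK.
  apply: hx.
  have xv : x *: v = y *: u - w by rewrite e addrC addKr.
  have xu1 : x *: u1 = a *: u - w1 by rewrite e1 addrC addKr.
  have -> : x *: (a *: v - y *: u1) = a *: (x *: v) - y *: (x *: u1).
    by rewrite scalerBr !scalerA [x * a]mulrC [x * y]mulrC.
  rewrite xv xu1 !scalerBr opprB.
  have -> : a *: (y *: u) = y *: (a *: u) by rewrite !scalerA mulrC.
  rewrite addrC addrA subrK.
  by apply: submodB => //; exact: submodZ.
apply: nu; apply/(quot_memP _ _ hN); exists (u - x *: v'), v'; split; last by rewrite subrK.
apply: hy; rewrite scalerBr e ve scalerDr.
have -> : w + (x *: w' + x *: (y *: v')) - y *: (x *: v') = w + x *: w'.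
  by rewrite !scalerA [y * x]mulrC addrA addrK.
by apply: submodD => //; exact: submodZ.
Qed.

Lemma regular_element_quot N1 N2 : is_submod N1 -> is_submod N2 ->
  (forall u, socle N1 u -> N1 u) -> (forall u, socle N2 u -> N2 u) ->
  exists z, [/\ n z, regular_on N1 z & regular_on N2 z].
Proof.
move=> hN1 hN2 s1 s2.
have [Q1 [g1 [gs1 gE1]]] := quotient_module_exists hN1.
have [Q2 [g2 [gs2 gE2]]] := quotient_module_exists hN2.
have nosoc N (Q : lmodType S) (g : {linear Y -> Q}) : surj g -> (forall v, g v = 0 <-> N v) ->
    (forall u, socle N u -> N u) ->
    forall q : Q, is_prime (fun a => a *: q = 0) -> exists2 x, n x & x *: q <> 0.
  move=> gs gE hs q qp; have [v gv] := gs q; apply: contrapT => h.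
  have [_ h1 _] := qp; apply: h1; rewrite scale1r -gv; apply/gE/hs => a na.
  apply/gE; rewrite linearZ /= gv; apply: contrapT => h'; apply: h; by exists a.
have [z [nz hz1 hz2]] := regular_element2 noeS (noetherian_quotient gs1 noeY)
  (noetherian_quotient gs2 noeY) nI (nosoc _ _ _ gs1 gE1 s1) (nosoc _ _ _ gs2 gE2 s2).
exists z; split=> // u.
  by move=> /gE1; rewrite linearZ => /hz1/gE1.
by move=> /gE2; rewrite linearZ => /hz2/gE2.
Qed.

Lemma quot_proper N x : is_submod N -> n x -> (exists v, ~ N v) -> exists v, ~ quot N x v.
Proof.
move=> hN nx [v Nv]; apply: contrapT => h; apply: Nv.
apply: (@local_nakayama N (fun _ => True) x) => // u _.
have /(quot_memP _ _ hN)[w [u' [Nw ->]]] : quot N x u by apply: contrapT => h'; apply: h; exists u.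
by exists w, u'.
Qed.

Lemma regular_seq_proper N s : is_submod N -> regular_seq N s -> exists v, ~ N v.
Proof.
elim: s N => [|x s IH] N hN //= [nx hx /IH[|v hv]]; first exact: quot_submod.
by exists v => Nv; apply: hv; exact: quot_sub.
Qed.

(* An element [z] regular modulo both [x] and the head [y] of [s] can be exchanged
   with either of them, so that the induction hypothesis applies modulo [z]. *)
Lemma regular_seq_quot l N x s : is_submod N -> n x -> regular_on N x ->
  regular_seq N s -> size s = l.+1 -> exists2 s', regular_seq (quot N x) s' & size s' = l.
Proof.
elim: l N x s => [|l IH] N x s hN nx hx hs sl.
  exists [::] => //=; apply: quot_proper => //; exact: regular_seq_proper hs.
case: s sl hs => // y s [sl] [ny hy hs].
have hNy := quot_submod y hN; have hNx := quot_submod x hN.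
have soc_y u : socle (quot N y) u -> quot N y u.
  by case: s sl hs => // y2 s _ [ny2 hy2 _] su; apply: hy2; exact: su.
have soc_x u : socle (quot N x) u -> quot N x u.
  move=> su; apply: contrapT => nu.
  by have [v /soc_y] := socle_transfer hN ny hx hy su nu.
have [z [nz zy zx]] := regular_element_quot hNy hNx soc_y soc_x.
have [s1 hs1 s1l] := IH _ z s hNy nz zy hs sl.
have hNz := quot_submod z hN.
have [|s2 hs2 s2l] := IH (quot N z) x (y :: s1) hNz nx (regular_on_swap hN hx zx) _ (congr1 succn s1l).
  split=> //; first exact: regular_on_swap.
  by rewrite quotC.
by exists (z :: s2); rewrite /= ?s2l //; split=> //; rewrite quotC.
Qed.

Lemma regular_seq_bounded N : is_submod N ->
  exists l, forall s, regular_seq N s -> (size s <= l)%N.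
Proof.
move=> hN; apply: contrapT => hno.
pose unb N := is_submod N /\ ~ exists l, forall s, regular_seq N s -> (size s <= l)%N.
have [||N' [hN' hu] hmax] := @noetherian_module_max _ _ unb noeY.
- by exists N.
- by move=> N' [].
have long l : exists2 s, regular_seq N' s & (l < size s)%N.
  apply: contrapT => h; apply: hu; exists l => s hs; rewrite leqNgt; apply/negP => ls.
  by apply: h; exists s.
have [s hs s0] := long 0%N; case: s hs s0 => // x s [nx hx hs] _.
have [v hv] := regular_seq_proper (quot_submod x hN') hs.
have [v' hv'] : exists v, ~ N' v by exists v => h; apply: hv; exact: quot_sub.
apply: hv'; apply: (hx); apply: (hmax (quot N' x)); last exact: quot_scale.
  split; first exact: quot_submod.
  move=> [l hl]; have [[|y t] ht tl] := long l.+1; first by [].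
  have [t' ht' t'l] := regular_seq_quot hN' nx hx ht erefl.
  by have := hl _ ht'; rewrite t'l leqNgt -ltnS tl.
by move=> u Nu; exact: quot_sub.
Qed.

Lemma associated_chain (q : S -> Prop) N (u : Y) s : is_submod N -> is_prime q ->
  (forall a, q a <-> N (a *: u)) -> regular_seq N s ->
  exists c : nat -> S -> Prop, [/\ c 0%N = q,
    forall i, (i <= size s)%N -> is_prime (c i) &
    forall i, (i < size s)%N -> (forall x, c i x -> c i.+1 x) /\ ~ (forall x, c i.+1 x -> c i x)].
Proof.
elim: s q N u => [|x s IH] q N u hN qp qE; first by exists (fun _ => q); split=> // -[].
move=> [nx hx hs].
have [qI q1 qM] := qp.
have Nu : ~ N u by move=> h; apply: q1; apply/qE; rewrite scale1r.
have [v qv nv] : exists2 v, forall a, q a -> N (a *: v) & ~ quot N x v.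
  apply: contrapT => hno; apply: Nu.
  have hU : is_submod (fun v => forall a, q a -> N (a *: v)).
    split=> [a _|b y z hy hz a qa]; first by rewrite scaler0; exact: submod0.
    rewrite scalerDr scalerA mulrC -scalerA; apply: (proj2 hN); [exact: hy|exact: hz].
  apply: (local_nakayama hN hU nx) => [v hv|a /qE //].
  have /(quot_memP _ _ hN)[w [v' [Nw ve]]] : quot N x v.
    by apply: contrapT => h; apply: hno; exists v.
  exists w, v'; split=> // a qa; apply: hx.
  have -> : x *: (a *: v') = a *: v - a *: w.
    by rewrite ve scalerDr addrAC subrr add0r !scalerA mulrC.
  by apply: submodB => //; [exact: hv|exact: submodZ].
have hNx := quot_submod x hN.
have [Q [g [gs gE]]] := quotient_module_exists hNx.
have [|r rp] := @associated_prime0 S noeS Q (g v); first by move=> /gE/nv.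
have rE a : a *: (r *: g v) = 0 <-> quot N x (a *: (r *: v)).
  have e : g (a *: (r *: v)) = a *: (r *: g v) by rewrite linearZ /= linearZ.
  by rewrite -gE e; split.
have [c [c0 cp cc]] := IH _ _ (r *: v) hNx rp rE hs.
exists (fun i => if i is j.+1 then c j else q); split=> //.
  by case=> // i; rewrite ltnS; exact: cp.
case=> [_|i]; last by rewrite ltnS; exact: cc.
rewrite c0; split=> [a qa|h].
  by apply/rE; apply: quot_sub => //; rewrite scalerA mulrC -scalerA; apply: submodZ => //; exact: qv.
apply: Nu; apply: hx; apply/qE/h/rE.
by apply: quot_scale.
Qed.
End Depth.

Section DepthOfLocalModules.
Variables (S : comNzRingType) (I : {pred S}) (Y : lmodType S).
Local Notation n := (fun x => x \in I).
Implicit Types (N : Y -> Prop).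

Fixpoint quots N (s : seq S) : Y -> Prop :=
  if s is x :: s' then quots (quot N x) s' else N.

Lemma quotsP N s v : is_submod N ->
  quots N s v <-> exists w (c : 'I_(size s) -> Y), N w /\ v = w + \sum_(i < size s) s`_i *: c i.
Proof.
elim: s N v => [|x s IH] N v hN /=.
  split=> [Nv|[w [c [Nw ->]]]]; last by rewrite big_ord0 addr0.
  by exists v, (fun _ => 0); rewrite big_ord0 addr0.
rewrite IH; last exact: quot_submod.
split=> [[w [c [/(quot_memP _ _ hN)[w' [u [Nw' ->]]] ->]]]|[w [c [Nw ->]]]].
  exists w', (fun i => if unlift ord0 i is Some j then c j else u); split=> //.
  rewrite big_ord_recl unlift_none /= addrA; congr (_ + _).
  by apply: eq_bigr => i _; rewrite liftK.
exists (w + x *: c ord0), (fun j => c (lift ord0 j)); split.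
  by apply/(quot_memP _ _ hN); exists w, (c ord0).
by rewrite big_ord_recl /= addrA.
Qed.

Lemma in_ideal_mulP s v : in_ideal_mul s v <-> quots (fun v => v = 0) s v.
Proof.
have h0 := @submod_zero _ (Y).
rewrite (quotsP _ _ h0); split=> [[c ->]|[_ [c [-> ->]]]]; last by exists c; rewrite add0r.
by exists 0, c; rewrite add0r.
Qed.

Lemma regular_seqP N s : regular_seq n N s <->
  [/\ {subset s <= I}, forall i, (i < size s)%N -> regular_on (quots N (take i s)) s`_i &
    exists v, ~ quots N s v].
Proof.
elim: s N => [|x s IH] N /=; first by split=> [h|[_ _ h]] //; split.
split=> [[nx hx /IH[sI hs hv]]|[sI hs hv]].
  split=> // [y|[|i]]; first by rewrite in_cons => /orP[/eqP ->|/sI].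
    by [].
  by rewrite ltnS; exact: hs.
split; [by apply: sI; exact: mem_head|exact: (hs 0%N isT)|apply/IH; split=> //].
  by move=> y ys; apply: sI; rewrite in_cons ys orbT.
by move=> i isz; exact: (hs i.+1 isz).
Qed.

Lemma regular_sequenceP s : {subset s <= I} ->
  regular_sequence Y s <-> regular_seq n (fun v : Y => v = 0) s.
Proof.
move=> sI; rewrite regular_seqP; split=> [[h [v hv]]|[_ h [v hv]]].
  split=> //; last by exists v => /in_ideal_mulP.
  by move=> i isz u /in_ideal_mulP/(h i isz)/in_ideal_mulP.
split; last by exists v => /in_ideal_mulP.
by move=> i isz u /in_ideal_mulP/(h i isz)/in_ideal_mulP.
Qed.

Hypothesis noeS : noetherian_module (S^o : lmodType S).
Hypothesis noeY : noetherian_module Y.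
Hypotheses (nI : is_ideal n) (n1 : ~ n 1) (nU : forall x, ~ n x -> exists y, y * x = 1).

Lemma depth_regular_seq : exists d, [/\ depth Y I = Some d,
  forall s, regular_seq n (fun v : Y => v = 0) s -> (size s <= d)%N &
  (0 < d)%N -> exists2 s, regular_seq n (fun v : Y => v = 0) s & size s = d].
Proof.
have h0 := @submod_zero _ (Y).
have [l hl] := regular_seq_bounded noeS noeY nI n1 nU h0.
pose P k := forall rs : seq S, {subset rs <= I} -> regular_sequence Y rs -> (size rs <= k)%N.
have exP : exists k, `[< P k >].
  by exists l; apply/asboolP => rs rI /(regular_sequenceP rI)/hl.
case: (ex_minnP exP) => d /asboolP Pd dmin.
exists d; split.
- by apply: leastE => // k Pk; apply/dmin/asboolP.
- move=> s hs; have [sI _ _] := (regular_seqP _ _).1 hs.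
  by apply: Pd => //; apply/regular_sequenceP.
- case: d Pd dmin => // d Pd dmin _; apply: contrapT => h.
  have /dmin : `[< P d >]; last by rewrite ltnn.
  apply/asboolP => rs rI hr; rewrite leqNgt; apply/negP => dr; apply: h.
  exists rs; first exact/regular_sequenceP.
  by apply/eqP; rewrite eqn_leq dr Pd.
Qed.
End DepthOfLocalModules.

Section Localization.
Variables (R : comNzRingType) (p : prime_idealr R).
Local Notation W := (at_prime p).
Local Notation S := (loc_ring W).
Local Notation den := {s : R | s \in W}.

Definition rfrac (a : R) (s : den) : S := lfrac (a : R^o) s.

Lemma rfracP (z : S) : exists a s, z = rfrac a s.
Proof. by have [a [s ->]] := @lfracP R W R^o z; exists a, s. Qed.

Lemma rfrac_eq a b (s t : den) : rfrac a s = rfrac b t <->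
  exists u : den, sval u * (sval t * a) = sval u * (sval s * b).
Proof. exact: lfrac_eq. Qed.

Lemma rfracM a b s t : rfrac a s * rfrac b t = rfrac (a * b) (denM s t).
Proof. exact: loc_mulE. Qed.

Lemma rfracD a b s t : rfrac a s + rfrac b t = rfrac (sval t * a + sval s * b) (denM s t).
Proof. exact: lfracD. Qed.

Lemma rfrac_scale (V : lmodType R) a s (x : V) t :
  rfrac a s *: (lfrac x t : loc_mod W V) = lfrac (a *: x) (denM s t).
Proof. exact: loc_scaleE. Qed.

Lemma denP (s : den) : sval s \notin p.
Proof. by case: s. Qed.

Lemma rfrac_inv (s t : den) : rfrac (sval t) s * rfrac (sval s) t = 1.
Proof. by rewrite rfracM; apply/rfrac_eq; exists (den1 W) => /=; ring. Qed.

Lemma localization_noetherian (V : lmodType R) : noetherian_module V ->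
  noetherian_module (loc_mod W V : lmodType S).
Proof.
move=> noeV N hN.
have scale1 (x : V) (s : den) : rfrac (sval s) (den1 W) *: lfrac x s = lfrac x (den1 W).
  by rewrite rfrac_scale; apply: lfrac_eqW; rewrite /= scale1r mul1r.
have scaleV (x : V) (s : den) : lfrac x s = rfrac 1 s *: lfrac x (den1 W).
  by rewrite rfrac_scale; apply: lfrac_eqW; rewrite /= scale1r mulr1.
have hN' : is_submod (fun x : V => N (lfrac x (den1 W))).
  split; first by rewrite -lfrac0; exact: submod0.
  move=> a x y Nx Ny.
  have -> : lfrac (a *: x + y) (den1 W) = rfrac a (den1 W) *: lfrac x (den1 W) + lfrac y (den1 W).
    rewrite rfrac_scale lfracD; apply: lfrac_eqW.
    by rewrite /= !mul1r !scale1r.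
  exact: (proj2 hN).
have [t tE] := noeV _ hN'.
exists [seq lfrac x (den1 W) | x <- t] => z; split; last first.
  by apply: lspan_min => // _ /mapP[x xt ->]; apply/(tE x); exact: lspan_mem.
have [x [s ->]] := lfracP z => Nz; rewrite scaleV; apply: submodZ; first exact: lspan_submod.
have /tE : N (lfrac x (den1 W)) by rewrite -(scale1 x s); apply: submodZ.
elim: {tE} t x {Nz} => [|e t IH] x /=; first by move=> ->.
move=> [r [y [/IH h ->]]]; exists (rfrac r (den1 W)), (lfrac y (den1 W)); split=> //.
by rewrite rfrac_scale lfracD; apply: lfrac_eqW; rewrite /= !mul1r !scale1r.
Qed.

Definition extension (q : R -> Prop) (z : S) := exists a s, q a /\ z = rfrac a s.

Lemma extensionE q a s : is_prime q -> (forall x, q x -> x \in p) ->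
  extension q (rfrac a s) <-> q a.
Proof.
move=> [qI q1 qM] qp; split=> [[b [t [qb /rfrac_eq[u e]]]]|qa]; last by exists a, s.
have nq (v : den) : ~ q (sval v) by move=> /qp; apply/negP/denP.
have /qM[/nq//|] : q (sval u * (sval t * a)).
  by rewrite e; do 2!apply: ideal_mull => //.
by move=> /qM[/nq|].
Qed.

Lemma extension_prime q : is_prime q -> (forall x, q x -> x \in p) -> is_prime (extension q).
Proof.
move=> hq qp; have [qI q1 qM] := hq; split.
- split; first by exists 0, (den1 W); split; [exact: ideal0|].
  move=> z _ _ [a [s [qa ->]]] [b [t [qb ->]]]; have [c [u ->]] := rfracP z.
  exists (sval t * (c * a) + sval (denM u s) * b), (denM (denM u s) t); split.
    by apply: idealD => //; do ?apply: ideal_mull => //.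
  by rewrite -rfracD -rfracM.
- have -> : 1 = rfrac 1 (den1 W) by [].
  by move=> /(extensionE _ _ hq qp).
- move=> z z'; have [a [s ->]] := rfracP z; have [b [t ->]] := rfracP z'.
  by rewrite rfracM !(extensionE _ _ hq qp); exact: qM.
Qed.

Lemma contraction_prime (q : S -> Prop) : is_prime q ->
  is_prime (fun a => q (rfrac a (den1 W))).
Proof.
move=> [qI q1 qM]; split; [split| |].
- exact: (ideal0 qI).
- move=> a x y qx qy.
  have -> : rfrac (a *: (x : R^o) + y) (den1 W)
     = rfrac a (den1 W) * rfrac x (den1 W) + rfrac y (den1 W).
    by rewrite rfracM rfracD; apply/rfrac_eq; exists (den1 W); rewrite /GRing.scale /=; ring.
  by apply: (proj2 qI).
- exact: q1.
- move=> a b qab; apply: qM.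
  have -> // : rfrac a (den1 W) * rfrac b (den1 W) = rfrac (a * b) (den1 W).
  by rewrite rfracM; apply/rfrac_eq; exists (den1 W) => /=; ring.
Qed.

Lemma contraction_rfrac (q : S -> Prop) a s : is_ideal q ->
  q (rfrac a s) <-> q (rfrac a (den1 W)).
Proof.
move=> qI; split=> h.
  have -> : rfrac a (den1 W) = rfrac (sval s) (den1 W) * rfrac a s.
    by rewrite rfracM; apply/rfrac_eq; exists (den1 W) => /=; ring.
  exact: ideal_mull.
have -> : rfrac a s = rfrac 1 s * rfrac a (den1 W).
  by rewrite rfracM; apply/rfrac_eq; exists (den1 W) => /=; ring.
exact: ideal_mull.
Qed.

Lemma contraction_sub (q : S -> Prop) a : is_prime q -> q (rfrac a (den1 W)) -> a \in p.
Proof.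
move=> [qI q1 qM] qa; apply: contrapT => /negP ap; apply: q1.
have aW : a \in W by [].
rewrite -(rfrac_inv (exist _ a aW) (den1 W)); exact: ideal_mull.
Qed.

Lemma loc_maximalE : (fun z : S => is_true (z \in @loc_maximal R p)) = extension (fun x => x \in p).
Proof.
apply/funext => z; apply/propext; split=> [/asboolP[a [s [ap ->]]]|[a [s [ap ->]]]].
  by exists a, s.
by apply/asboolP; exists a, s.
Qed.

Lemma loc_maximal_unit (z : S) : ~ z \in @loc_maximal R p -> exists y, y * z = 1.
Proof.
have [a [s ->]] := rfracP z => h.
have aW : a \in W by apply/negP => ap; apply: h; apply/asboolP; exists a, s.
by exists (rfrac (sval s) (exist _ a aW)); rewrite -(rfrac_inv (exist _ a aW) s) /=.
Qed.
End Localization.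

Lemma prime_chain_exists (S : comNzRingType) k (D : nat -> S -> Prop) :
  (forall i, (i <= k)%N -> is_prime (D i)) ->
  (forall i, (i < k)%N -> (forall x, D i x -> D i.+1 x) /\ ~ (forall x, D i.+1 x -> D i x)) ->
  exists c : nat -> prime_idealr S, prime_chain k c.
Proof.
move=> Dp DS; have [P0 _] := prime_idealr_exists (Dp 0%N isT).
have /choice[c cE] : forall i, exists P : prime_idealr S, (i <= k)%N -> forall x, x \in P <-> D i x.
  move=> i; case: (leqP i k) => [ik|]; last by exists P0.
  by have [P hP] := prime_idealr_exists (Dp i ik); exists P.
exists c => i ik; have hi := cE i (ltnW ik); have hi1 := cE i.+1 ik.
have [h1 h2] := DS i ik; split=> [x /hi/h1/hi1//|h].
by apply: h2 => x /hi1/h/hi.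
Qed.

Lemma idealr_closed_ideal (R : comNzRingType) (I : {pred R}) :
  idealr_closed I -> is_ideal (fun x => x \in I) /\ ~ 1 \in I.
Proof. by move=> [I0 I1 IM]; split; [split=> // a x y|exact/negP]; exact: IM. Qed.

Lemma maximal_prime_exists (R : comNzRingType) (p : R -> Prop) :
  noetherian_module (R^o : lmodType R) -> is_prime p ->
  exists m : prime_idealr R, is_maximal m /\ forall x, p x -> x \in m.
Proof.
move=> noeR [pI p1 pM].
have [m [mI m1 pm mmax]] := maximal_ideal_exists noeR pI p1.
have mp := maximal_ideal_prime mI m1 (maximal_inverse mI mmax).
have [P PE] := prime_idealr_exists mp; exists P; split; last by move=> x /pm/PE.
split.
  split; [exact: idealr0|by rewrite idealr1|].
  by move=> a x y xp yp; apply: rpredD => //; exact: idealMr.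
move=> I /idealr_closed_ideal[II I1] PI x; apply/idP/idP; last exact: PI.
move=> Ix; apply/PE; apply: (mmax (fun x => x \in I)) => // y /PE; exact: PI.
Qed.

Section CohenMacaulay.
Variables (R : comNzRingType) (A : ralgebra R).
Hypothesis noeR : noetherian_module (R^o : lmodType R).
Hypothesis fgA : finitely_generated (alg_mod A : lmodType R).
Variables (p : prime_idealr R) (c0 : R) (e0 : A).
Hypothesis c0reg : forall a : A, alg_map A c0 * a = 0 -> a = 0.
Hypothesis pE : forall r, r \in p <-> exists a, alg_map A r * e0 = alg_map A c0 * a.

(* [p] is associated to [A / c0 A], so it lies in a chain of primes of length
   [depth A_m - 1] ending at [m]; a prime chain of length two below [p] would
   then make [dim R_m] exceed [depth A_m]. *)
Lemma associated_codim_one : maximal_cohen_macaulay (alg_mod A : lmodType R) ->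
  forall k (c : nat -> prime_idealr (loc_ring (at_prime p))), prime_chain k c -> (k <= 1)%N.
Proof.
move=> [_ mcm] k c hc; rewrite leqNgt; apply/negP => k2.
have pp := prime_idealr_prime p.
pose q i a := rfrac a (den1 (at_prime p)) \in c i.
have qp i : is_prime (q i) := contraction_prime (prime_idealr_prime (c i)).
have qsub i a : q i a -> a \in p by exact: contraction_sub (prime_idealr_prime (c i)).
have qS i : (i < k)%N -> (forall a, q i a -> q i.+1 a) /\ ~ (forall a, q i.+1 a -> q i a).
  move=> ik; have [h1 h2] := hc i ik; split=> [a|h]; first exact: h1.
  apply: h2 => z; have [a [s ->]] := rfracP z.
  have [cI _ _] := prime_idealr_prime (c i); have [cI1 _ _] := prime_idealr_prime (c i.+1).
  by move=> /(contraction_rfrac a s cI1)/h/(contraction_rfrac a s cI).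
have [m [mm pm]] := maximal_prime_exists noeR pp.
have mp := prime_idealr_prime m.
pose S := loc_ring (at_prime m); pose Y : lmodType S := loc_mod (at_prime m) (alg_mod A).
have noeS : noetherian_module (S^o : lmodType S) := @localization_noetherian R m R^o noeR.
have noeY : noetherian_module Y.
  exact/localization_noetherian/finitely_generated_noetherian.
pose n (z : S) : Prop := z \in @loc_maximal R m.
have nE : n = extension (fun x => x \in m) := loc_maximalE m.
have nP : is_prime n by rewrite nE; apply: extension_prime.
have [nI n1 _] := nP; have nU := @loc_maximal_unit R m.
have [d [depthE dmax dseq]] := depth_regular_seq noeS noeY nI n1 nU.
have [_ dE] := mcm m mm; rewrite depthE in dE.
have [dimS _] := leastP (esym dE).
pose one := den1 (at_prime m); pose c0' : S := rfrac c0 one.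
pose u : Y := lfrac (e0 : alg_mod A) one.
have h0 := @submod_zero _ (Y).
have nc0 : n c0'.
  by rewrite nE; exists c0, one; split=> //; apply/pm/pE; exists e0.
have rc0 : regular_on (fun v : Y => v = 0) c0'.
  move=> v; have [a [s ->]] := lfracP v.
  rewrite rfrac_scale !lfrac0 => /lfrac_eq[w e]; apply/lfrac_eq; exists w.
  rewrite !scaler0 scale1r in e *; apply: c0reg.
  move: e; rewrite /GRing.scale /= /alg_scale !mulrA => <-.
  by rewrite rmorph1 mulr1 -!rmorphM [c0 * _]mulrC.
have pext z : extension (fun x => x \in p) z <-> quot (fun v : Y => v = 0) c0' (z *: u).
  have [a [s ->]] := rfracP z; rewrite (extensionE a s pp) // rfrac_scale.
  split=> [/pE[b ab]|].
    apply/(quot_memP _ _ h0); exists 0, (lfrac (b : alg_mod A) s); split=> //.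
    rewrite add0r rfrac_scale; apply: lfrac_eqW.
    rewrite /= mulr1 mul1r; congr (_ *: _); exact: ab.
  move=> /(quot_memP _ _ h0)[_ [v [-> ]]]; rewrite add0r; have [b [t ->]] := lfracP v.
  rewrite rfrac_scale => /lfrac_eq[w]; rewrite /= mulr1 mul1r => e.
  have : sval w * (sval t * a) \in p.
    apply/pE; exists (alg_map A (sval w * sval s) * b).
    move: e; rewrite /GRing.scale /= /alg_scale !mulrA -!rmorphM !mulrA => ->.
    by congr (alg_map A _ * _); ring.
  have np (x : {s : R | s \in at_prime m}) : sval x \notin p.
    by apply/negP => /pm; apply/negP/denP.
  by rewrite !prime_idealrM (negPf (np w)) (negPf (np t)).
have extp := extension_prime pp pm; have ext1 : ~ extension (fun x => x \in p) (1 : S) by case: extp.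
have proper : exists v : Y, ~ v = 0.
  exists u => u0; apply: ext1; apply/pext; rewrite u0 scaler0; exact: submod0 (quot_submod _ h0).
have d0 : (0 < d)%N.
  apply: (dmax [:: c0']) => /=; split=> //.
  exact: (quot_proper noeY nI n1 nU h0 nc0 proper).
have [s hs sd] := dseq d0.
have [|s' hs' s'd] := regular_seq_quot noeS noeY nI n1 nU (l := d.-1) h0 nc0 rc0 hs.
  by rewrite prednK.
have [C [C0 Cp CS]] := associated_chain noeS noeY nI n1 nU (quot_submod c0' h0) extp pext hs'.
have sub q' x : (forall a, q' a -> a \in p) -> q' x -> x \in m by move=> h /h/pm.
have ext_lt (q1 q2 : R -> Prop) : is_prime q1 -> is_prime q2 -> (forall a, q2 a -> a \in p) ->
    (forall a, q1 a -> q2 a) -> ~ (forall a, q2 a -> q1 a) ->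
    (forall z : S, extension q1 z -> extension q2 z) /\
    ~ (forall z : S, extension q2 z -> extension q1 z).
  move=> hq1 hq2 q2p h12 h21.
  have q2m a : q2 a -> a \in m by move=> /q2p/pm.
  split=> [_ [a [t [/h12 qa ->]]]|h]; first by exists a, t.
  apply: h21 => a qa; apply/(extensionE a one hq1) => [x /h12/q2m //|].
  by apply: h; apply/(extensionE a one hq2).
pose D i : S -> Prop :=
  match i with 0 => extension (q 0%N) | 1 => extension (q 1%N) | j.+2 => C j end.
have [|i|c' hc'] := @prime_chain_exists S d.+1 D.
- case=> [|[|i]] ild /=; [| |by apply: Cp; rewrite s'd; case: (d) d0 ild].
  + by apply: extension_prime => // x /qsub/pm.
  + by apply: extension_prime => // x /qsub/pm.
- case: i => [|[|i]] ild /=.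
  + have [h1 h2] := qS 0%N (ltnW k2); apply: ext_lt => //; exact: qsub.
  + have [h1 h2] := qS 1%N k2; rewrite C0; apply: ext_lt => //.
      by move=> a; exact: qsub.
    by move=> h; apply: h2 => a /qsub/h.
  + by apply: CS; rewrite s'd; case: (d) d0 ild.
by have := dimS _ _ hc'; rewrite ltnn.
Qed.

Lemma lspan_map_alg (B : pzRingType) (f : A -> B) (es : seq A) (x : A) :
  f 0 = 0 -> (forall a b, f (a + b) = f a + f b) -> (forall a b, f (a * b) = f a * f b) ->
  lspan (es : seq A^o) x -> lspan ([seq f e | e <- es] : seq B^o) (f x).
Proof.
move=> f0 fD fM; elim: es x => [|e es IH] x /=; first by move=> ->.
move=> [r [y [/IH h ->]]]; exists (f r), (f y); split=> //.
by rewrite fD fM.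
Qed.

Lemma localized_cancellation :
  (forall k (c : nat -> prime_idealr (loc_ring (at_prime p))), prime_chain k c -> (k <= 1)%N) ->
  global_dim (loc_alg (at_prime p) A) = krull_dim (loc_ring (at_prime p)) ->
  central_cancellation A (fun x => x \in p).
Proof.
move=> dim1 gd es e' c e cC eC hc hes.
pose B : pzRingType := loc_alg (at_prime p) A.
have pdB (L : lmodType B) : local_pd (fun b => b = 1) 1%N L.
  have [k kdim k1] : exists2 k, krull_dim (loc_ring (at_prime p)) = Some k & (k <= 1)%N.
    pose P n := forall k (c : nat -> prime_idealr (loc_ring (at_prime p))), prime_chain k c -> (k <= n)%N.
    have exP : exists n, `[< P n >] by exists 1%N; apply/asboolP.
    case: (ex_minnP exP) => k /asboolP Pk kmin; exists k; last exact/kmin/asboolP.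
    by apply: leastE => // l Pl; apply/kmin/asboolP.
  have [hk _] := leastP (etrans gd kdim).
  apply: resolution_local_pd => //.
  have [P [d [e1 [h1 h2 h3 h4 h5]]]] := hk L; exists P, d, e1; split=> // i i1.
  by apply: h2; apply: leq_ltn_trans i1.
pose one := den1 (at_prime p).
pose f (a : A) : B := lfrac (a : alg_mod A) one.
have fM a b : f (a * b) = f a * f b.
  apply: esym; rewrite /f [LHS]loc_alg_mulE; apply: lfrac_eqW.
  by rewrite /= mulr1.
have fD a b : f (a + b) = f a + f b.
  by apply: esym; rewrite /f [LHS]lfracD; apply: lfrac_eqW; rewrite /= mulr1 !scale1r.
have f0 : f 0 = 0 by [].
have fC a : (forall b, a * b = b * a) -> forall b : B, f a * b = b * f a.
  move=> aC b; have [x [s ->]] := lfracP b.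
  rewrite /f [LHS]loc_alg_mulE [RHS]loc_alg_mulE; apply: lfrac_eqW.
  by rewrite /= aC mulr1 mul1r.
pose esB : seq B^o := [seq f e | e <- es].
have /choice[e'B e'BE] : forall b : B, exists b' : B, b \in esB ->
    [/\ forall x, b * x = x * b, forall x, b' * x = x * b', lspan esB b' & f c * b' = b * f e].
  move=> b; case: (boolP (b \in esB)) => [/mapP[a aes ->]|]; last by exists 0.
  have [aC a'C a's ca'] := hes a aes; exists (f (e' a)) => _; split; try exact: fC.
    exact: lspan_map_alg.
  by rewrite -!fM ca'.
have hI := lspan_submod esB.
have [K [Q [i [g [ses gE]]]]] := submod_short_exact hI.
have [fi gs fge] := ses.
have [_ -> hs] : local_pd (fun b : B => b = 1) 0%N K.
  apply: (local_pd_syzygy (n := 0) _ _ _ ses (@regular_module_projective B) (pdB Q)) => //.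
    by move=> s t -> ->; rewrite mulr1.
  by move=> s -> b; rewrite mulr1 mul1r.
have [||||||a] := @scaled_projective_cancel B K i esB e'B 1 (f c) (f e) fi _ hs.
- by move=> b; rewrite gE; exact: fge.
- exact: fC.
- exact: fC.
- by move=> b; rewrite mul1r mulr1.
- exact: lspan_map_alg.
- exact: e'BE.
rewrite mul1r -!fM; have [x [s ->]] := lfracP a.
rewrite /f [X in X = _]loc_alg_mulE => /lfrac_eq[w].
rewrite /= mul1r scale1r /GRing.scale /= /alg_scale => h.
exists (sval w * sval s); first by rewrite prime_idealrM; apply/negP; rewrite negb_or !denP.
exists (alg_map A (sval w) * x).
rewrite mulrA -alg_mapC -mulrA h rmorphM !mulrA.
by [].
Qed.
End CohenMacaulay.

Lemma NCCR_center (R : comNzRingType) (Rnoeth : noetherian R) (Rred : reduced R)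
    (M : lmodType R) : gives_NCCR M ->
     alg_isomorphic (center (End_alg M)) (normalization R).
Proof.
move=> [fgM Mtf Msupp [mcm gd]].
have noeR : noetherian_module (R^o : lmodType R) := left_noetherianP (proj1 Rnoeth).
have [fgA _] := mcm.
apply: center_normalization_isomorphic => //.
apply: integral_acts => // p c0 e0 pp c0reg pE.
have [P PE] := prime_idealr_exists pp.
have PE' r : r \in P <-> exists a, alg_map (End_alg M) r * e0 = alg_map (End_alg M) c0 * a.
  by rewrite PE.
have -> : p = (fun x => x \in P) by apply/funext => x; apply/propext; rewrite PE.
apply: localized_cancellation (gd P).
apply: (associated_codim_one noeR fgA _ PE' mcm) => a ha.
apply: End_ringP => x; apply: (regular_cancel Mtf c0reg).
rewrite -[LHS]/((alg_map (End_alg M) c0 * a : End_ring M) x) ha.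
by rewrite scaler0.
Qed.

Theorem proposition2p15 (R : comNzRingType)
    (Rnoeth : noetherian R) (Rred : reduced R) :
  (forall M : lmodType R,
     finitely_generated M -> torsion_free M ->
     (forall p, supp M p <-> supp (R^o : lmodType R) p) ->
     homologically_homogeneous (End_alg M) ->
     alg_isomorphic (center (End_alg M)) (normalization R)) /\
  (equicodimensional R ->
   forall M : lmodType R, gives_NCCR M ->
     alg_isomorphic (center (End_alg M)) (normalization R)).
Proof.
by split=> [|_] M; [exact: homogeneous_center|exact: NCCR_center].
Qed.
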